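(* A functional $Z:\mathrm{Conv}_{\mathrm{ld}}(\mathbb{R})\to\mathbb{R}$ is a $\tau$-upper semicontinuous, translation invariant and dually epi-translation invariant valuation if and only if there are constants $c_0,c_1\in\mathbb{R}$ and a function $\zeta\in\mathrm{Conc}([0,\infty))$ such that $$Z(u)=c_0+c_1V_1(\mathrm{dom}\,u)+\int_{\mathrm{dom}\,u}\zeta(u''(x))\,dx$$ for every $u\in\mathrm{Conv}_{\mathrm{ld}}(\mathbb{R})$.
   Context: For $u:\mathbb{R}\to(-\infty,+\infty]$ let $\mathrm{dom}\,u=\{x: u(x)<+\infty\}$. $\mathrm{Conv}(\mathbb{R})$ is the set of convex, lower semicontinuous functions $u:\mathbb{R}\to(-\infty,+\infty]$ with $u\not\equiv+\infty$. $\mathrm{Conv}_{\mathrm{ld}}(\mathbb{R})$ is the set of $u\in\mathrm{Conv}(\mathbb{R})$ such that $\mathrm{dom}\,u$ is compact and $u$ is Lipschitz on the interior of $\mathrm{dom}\,u$ (there is $L_u>0$ with $|u(x)-u(y)|\le L_u|x-y|$ for all $x,y$ in the interior of $\mathrm{dom}\,u$; this is no condition if the interior is empty). $\tau$-convergence: for $u_k,u\in\mathrm{Conv}_{\mathrm{ld}}(\mathbb{R})$, $u_k\xrightarrow{\tau}u$ means: (i) for every $x$ and every sequence $x_k\to x$, $u(x)\le\liminf_{k\to\infty}u_k(x_k)$; (ii) for every $x$ there is a sequence $x_k\to x$ with $u(x)=\lim_{k\to\infty}u_k(x_k)$; (iii) the Lipschitz constants of $u_k$ on the interiors of their domains are bounded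 by some $M>0$ independent of $k$. A functional $Z:\mathrm{Conv}_{\mathrm{ld}}(\mathbb{R})\to\mathbb{R}$ is: a valuation if $Z(u\wedge v)+Z(u\vee v)=Z(u)+Z(v)$ whenever $u,v,u\wedge v,u\vee v\in\mathrm{Conv}_{\mathrm{ld}}(\mathbb{R})$, where $\wedge,\vee$ are pointwise minimum and maximum; $\tau$-upper semicontinuous if $Z(u)\ge\limsup_{k\to\infty}Z(u_k)$ whenever $u_k\xrightarrow{\tau}u$; translation invariant if $Z(u\circ\tau)=Z(u)$ for all $u$ and all translations $\tau$ of $\mathbb{R}$; dually epi-translation invariant if $Z(u+l)=Z(u)$ for all $u$ and all linear $l:\mathbb{R}\to\mathbb{R}$ and $Z(u+c)=Z(u)$ for all $u$ and all constants $c\in\mathbb{R}$. $\mathrm{Conc}([0,\infty))$ is the set of concave functions $\zeta:[0,\infty)\to[0,\infty)$ with $\lim_{t\to0}\zeta(t)=0$ and $\lim_{t\to+\infty}\zeta(t)/t=0$. $V_1$ denotes length. $u''(x)$ is the second derivative of $u$ at $x$ if $u$ is twice differentiable at $x$, and $u''(x)=0$ otherwise (a convex function is twice differentiable almost everywhere on the interior of its domain). *)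

(* Defs.v *)
From HB Require Import structures.
From mathcomp Require Import all_boot all_order all_algebra.
From mathcomp Require Import all_classical all_reals all_analysis.

Set Implicit Arguments.
Unset Strict Implicit.
Unset Printing Implicit Defensive.

Import Order.TTheory GRing.Theory Num.Theory.
Import numFieldNormedType.Exports.

Local Open Scope classical_set_scope.
Local Open Scope ring_scope.

Section functions.
Context {R : realType}.
Implicit Types (u : R -> \bar R) (x p a : R).

Definition dom u : set R := [set x | (u x < +oo)%E].

(* [convex_function] of the library is restricted to real-valued functions.
   Since 0 * +oo = 0 in \bar R, the cases t = 0 and t = 1 hold trivially. *)
Definition econvex u := forall x y (t : R), 0 <= t <= 1 ->
  (u (t * x + (1 - t) * y)%R <= t%:E * u x + (1 - t)%:E * u y)%E.

(* For convex u with values in (-oo, +oo], finite on the interior of its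
   domain, so that [fine] loses no information there. *)
Definition dom_lipschitz (L : R) u := L.-lipschitz_((dom u)°) (fine \o u).

(* Twice differentiability in the sense of Alexandrov: x is an interior point
   of the domain and
     u(x + h) = u(x) + p h + (a / 2) h^2 + o(h^2)   as h --> 0.
   It does not require u to be differentiable near x: the derivative of a
   convex function may have a dense set of jumps, so the twice iterated
   derivative may exist nowhere, whereas the expansion exists almost
   everywhere on the interior of the domain. The coefficients p and a are
   unique, and p = u'(x). *)
Definition taylor2 u x p a :=
  (dom u)° x /\
  (fine (u (x + h)) - fine (u x) - p * h - a / 2 * h ^+ 2) / h ^+ 2
    @[h --> 0^'] --> (0 : R).

Definition second_derivative u x : R :=
  xget 0 [set a | exists p, taylor2 u x p a].

End functions.

Definition Conv (R : realType) : set (R -> \bar R) := [set u |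
  [/\ forall x, u x != -oo%E, econvex u, lower_semicontinuous u
    & exists x, u x != +oo%E]].

Definition Conv_ld (R : realType) : set (R -> \bar R) := [set u |
  [/\ Conv u, compact (dom u) & exists2 L : R, 0 < L & dom_lipschitz L u]].

Arguments Conv_ld : clear implicits.

Section functionals.
Context {R : realType}.
Implicit Types (Z : Conv_ld R -> R) (u v : Conv_ld R).

Definition tau_cvg (u_ : nat -> Conv_ld R) u :=
  [/\ forall (x : R) (x_ : nat -> R), x_ @ \oo --> x ->
        (val u x <= limn_einf (fun k => val (u_ k) (x_ k)))%E,
      forall x : R, exists2 x_ : nat -> R, x_ @ \oo --> x &
        val (u_ k) (x_ k) @[k --> \oo] --> val u x
    & exists2 M : R, 0 < M & forall k, dom_lipschitz M (val (u_ k))].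

Definition valuation Z := forall u v (w j : Conv_ld R),
  val w = (fun x => mine (val u x) (val v x)) ->
  val j = (fun x => maxe (val u x) (val v x)) ->
  Z w + Z j = Z u + Z v.

Definition tau_usc Z := forall (u_ : nat -> Conv_ld R) u,
  tau_cvg u_ u -> (limn_esup (fun k => (Z (u_ k))%:E) <= (Z u)%:E)%E.

(* In the next two definitions the transformed function always belongs to
   Conv_ld R; v is that function seen as an element of the subtype. *)
Definition translation_invariant Z := forall (a : R) u v,
  val v = (fun x => val u (x + a)) -> Z v = Z u.

Definition dually_epi_translation_invariant Z :=
  (forall (l : {linear R^o -> R^o}) u v,
     val v = (fun x => val u x + (l x)%:E)%E -> Z v = Z u) /\
  (forall (c : R) u v,
     val v = (fun x => val u x + c%:E)%E -> Z v = Z u).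

End functionals.

(* An element of Conc is a total function on R of which only the restriction
   to [0, +oo[ is constrained. Its values elsewhere are irrelevant below, the
   second derivative of a convex function being nonnegative. *)
Definition Conc (R : realType) : set (R -> R) := [set zeta |
  [/\ forall t, 0 <= t -> 0 <= zeta t,
      convex_function (`[0, +oo[ : set R^o) (fun t : R^o => - zeta t : R^o),
      zeta t @[t --> 0^'+] --> (0 : R)
    & zeta t / t @[t --> +oo] --> (0 : R)]].

Arguments Conc : clear implicits.

(* Main.v *)
(* Every u in Conv_ld is the restriction to a segment [a, b] of a convex
   function U on R with a bounded nondecreasing selection f of subgradients.

   Necessity. Once the values c0 on points and c1 (b - a) on constants are
   subtracted, Z becomes a functional z(U, a, b) additive over adjacent
   intervals and unchanged by translations and affine terms. So U may be cut
   into pieces and the pieces glued back in another order. If they are short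
   in length and in slope gain and are ordered as in Steinitz' lemma, the
   slope of the result is nearly linear, and semicontinuity gives
     z(U, a, b) <= (b - a) zeta((f b - f a) / (b - a)),
   where zeta t is the value of z at t x^2 / 2 on [0, 1]; this also yields
   that zeta is in Conc. In the other direction, replacing each piece of U by
   a parabola with the same slope gain produces functions that converge to U.
   Hence z(U, a, b) is the limit of the Riemann sums of zeta at the difference
   quotients of f. Since f has a slope almost everywhere and zeta is sublinear,
   these sums converge to the integral of zeta(u'').

   Sufficiency. The formula is a valuation because at almost every point the
   two second derivatives of the minimum and of the maximum are those of u and
   v in some order. It is semicontinuous because Jensen's inequality bounds it
   on each cell of a partition by zeta at a difference quotient of slopes, which
   is controlled by the values of the approximating functions near the cell;
   slightly widening the cells does not change the limit of the Riemann sums. *)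

From HB Require Import structures.
Require Import Defs.
From mathcomp Require Import all_boot all_order all_algebra.
From mathcomp Require Import all_classical all_reals all_analysis.
From mathcomp Require Import measurable_realfun ring lra.

Set Implicit Arguments.
Unset Strict Implicit.
Unset Printing Implicit Defensive.

Import Order.TTheory GRing.Theory Num.Theory.
Import numFieldNormedType.Exports.

Local Open Scope classical_set_scope.
Local Open Scope ring_scope.

(** * Convex functions with a subgradient selection *)

Section subgradients.
Context {R : realType}.
Implicit Types (U V f g : R -> R) (a b x y t d e del eta : R).

(** Cutting the axis alone does not give pieces of small slope gain, since a jump of the slope stays
    in one piece. The cuts are made along the graph of the subdifferential, parametrised by abscissa
    plus slope: in this parameter both coordinates are nondecreasing and 1-Lipschitz, and a kink may
    be divided into several pieces of length zero.

    Kinks cost nothing: on a segment that begins at its kink the function is affine, so additivity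
    makes the kink invisible. Approximation by polygons then gives z >= 0, and a parabola squeezed
    into a kink gives the sublinearity of zeta. Sublinearity in turn replaces domination in the
    limit of the Riemann sums: zeta is unbounded and slope may concentrate, but large difference
    quotients contribute at most e times the total slope gain.

    The selections [f] live on the whole line and need not be derivatives. Translations, sums and
    points slightly outside a cell then require no case distinction at the ends, and integration of
    slopes is replaced by telescoping over equal cells. *)

Definition subgradient U f := forall x y, U x + f x * (y - x) <= U y.

Lemma subgradient_homo U f : subgradient U f -> {homo f : x y / x <= y}.
Proof.
move=> Uf x y; rewrite le_eqVlt => /predU1P[->//|xy].
have := Uf x y; have := Uf y x => h1 h2.
have : (f x - f y) * (y - x) <= 0 by nra.
by rewrite pmulr_lle0 ?subr_gt0// subr_le0.
Qed.

Lemma subgradientD U f V g : subgradient U f -> subgradient V g ->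
  subgradient (fun x => U x + V x) (fun x => f x + g x).
Proof. by move=> Uf Vg x y; have := Uf x y; have := Vg x y; lra. Qed.

Lemma subgradient_shift U f t : subgradient U f ->
  subgradient (fun x => U (x + t)) (fun x => f (x + t)).
Proof. by move=> Uf x y; have := Uf (x + t) (y + t); lra. Qed.

Lemma subgradient_affine a b : subgradient (fun x => a * x + b) (fun=> a).
Proof. by move=> x y; lra. Qed.

Lemma subgradient_opp U f : subgradient U f ->
  subgradient (fun x => U (- x)) (fun x => - f (- x)).
Proof. by move=> Uf x y; have := Uf (- x) (- y); lra. Qed.

Lemma subgradient_ge U f x y : subgradient U f -> x <= y ->
  f x * (y - x) <= U y - U x.
Proof. by move=> Uf xy; have := Uf x y; lra. Qed.

Lemma subgradient_le U f x y : subgradient U f -> x <= y ->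
  U y - U x <= f y * (y - x).
Proof. by move=> Uf xy; have := Uf y x; lra. Qed.

Lemma lt_succn (x : R) : exists n : nat, x < n.+1%:R.
Proof.
exists (Num.truncn x); have [x0|x0] := leP 0 x; last exact: lt_trans x0 _.
by have /andP[] := Num.Theory.truncn_itv x0.
Qed.

Lemma le_archi_eq0 (c d : R) : (forall n : nat, c <= d / n.+1%:R) -> c <= 0.
Proof.
move=> H; rewrite leNgt; apply/negP => c0.
have [n nd] := lt_succn (d / c).
have := H n; rewrite ler_pdivlMr ?ltr0Sn// leNgt => /negP; apply.
by move: nd; rewrite ltr_pdivrMr// mulrC.
Qed.

(* Cutting [a, b] into n equal parts bounds [phi b - phi a] by a telescoping
   sum equal to (m b - m a) (b - a) / n. *)
Lemma telescope_le (phi m : R -> R) a b : a <= b ->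
  (forall x y, a <= x -> x <= y -> y <= b ->
    phi y - phi x <= (m y - m x) * (y - x)) -> phi b <= phi a.
Proof.
move=> ab H; rewrite -subr_le0; apply: (@le_archi_eq0 _ ((m b - m a) * (b - a))).
move=> n; set d := (b - a) / n.+1%:R.
have d0 : 0 <= d by rewrite divr_ge0// subr_ge0.
have dn : d * n.+1%:R = b - a by rewrite /d divfK ?pnatr_eq0.
have step (i : nat) : (i <= n.+1)%N ->
    phi (a + i%:R * d) - phi a <= (m (a + i%:R * d) - m a) * d.
  elim: i => [|i IH] ni; first by rewrite mul0r addr0 !subrr mul0r.
  have := IH (ltnW ni).
  have h1 : a <= a + i%:R * d by rewrite lerDl mulr_ge0.
  have h3 : a + i.+1%:R * d <= b.
    by rewrite -lerBrDl -dn mulrC ler_wpM2l// ler_nat.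
  have h2 : a + i.+1%:R * d = a + i%:R * d + d by rewrite -natr1; ring.
  have := H (a + i%:R * d) (a + i.+1%:R * d) h1 _ h3.
  rewrite h2 lerDl => /(_ d0).
  by nra.
have := step n.+1 (leqnn _).
by rewrite [_ * d]mulrC dn subrKC mulrA.
Qed.

(** Stands for the integration of [f - g]. Over one step [U] grows at most at its right slope and
    [V] at least at its left slope, so the error is an increment of [g] times the step, which
    telescopes. *)
Lemma subgradient_close U f V g b eta : subgradient U f -> subgradient V g ->
  (forall x, 0 <= x <= b -> `|f x - g x| <= eta) ->
  forall x, 0 <= x <= b -> `|(U x - U 0) - (V x - V 0)| <= eta * x.
Proof.
move=> Uf Vg fg x /andP[x0 xb].
have := @telescope_le (fun t => U t - V t - eta * t) g 0 x x0.
have := @telescope_le (fun t => V t - U t - eta * t) f 0 x x0.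
move=> h1 h2; rewrite ler_norml.
have {}h1 : V x - U x - eta * x <= V 0 - U 0 - eta * 0.
  apply: h1 => s t s0 st tx.
  have := subgradient_le Vg st; have := subgradient_ge Uf st.
  have := fg t; rewrite (le_trans s0 st) (le_trans tx xb) => /(_ isT).
  rewrite ler_norml => /andP[k1 k2]; have : 0 <= t - s by lra.
  nra.
have {}h2 : U x - V x - eta * x <= U 0 - V 0 - eta * 0.
  apply: h2 => s t s0 st tx.
  have := subgradient_le Uf st; have := subgradient_ge Vg st.
  have := fg t; rewrite (le_trans s0 st) (le_trans tx xb) => /(_ isT).
  rewrite ler_norml => /andP[k1 k2]; have : 0 <= t - s by lra.
  nra.
lra.
Qed.

Let taylor_right U f x d e del : subgradient U f ->
  (forall y, `|y - x| < del -> `|f y - f x - d * (y - x)| <= e * `|y - x|) ->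
  forall h, 0 <= h < del ->
  `|U (x + h) - U x - f x * h - d / 2 * h ^+ 2| <= e / 2 * h ^+ 2.
Proof.
move=> Uf fx h /andP[h0 hdel].
have fx' t : 0 <= t <= h -> `|f (x + t) - f x - d * t| <= e * t.
  move=> /andP[t0 th]; have := fx (x + t).
  rewrite (_ : x + t - x = t); last by ring.
  by rewrite ger0_norm//; apply; apply: le_lt_trans th hdel.
(* The quadratic terms are primitives of [(d + e) * t] and [(d - e) * t], the bounds on
   [f (x + t) - f x]. Taking a slope at an end of a step costs an increment of the linear function
   given as [m]. *)
have := @telescope_le
  (fun t => U (x + t) - f x * t - (d + e) / 2 * t ^+ 2)
  (fun t => (d + e) / 2 * t) 0 h h0.
have := @telescope_le
  (fun t => f x * t + (d - e) / 2 * t ^+ 2 - U (x + t))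
  (fun t => (d - e) / 2 * t) 0 h h0.
rewrite !addr0 !expr0n/= !mulr0 !subr0 ?addr0 => h1 h2.
rewrite ler_norml.
have {}h1 : f x * h + (d - e) / 2 * h ^+ 2 - U (x + h) <= 0 - U x.
  apply: h1 => s t s0 st th.
  have := @subgradient_ge _ _ (x + s) (x + t) Uf.
  rewrite lerD2l => /(_ st).
  have := fx' s; rewrite s0 (le_trans st th) => /(_ isT).
  rewrite ler_norml => /andP[k1 k2]; have : 0 <= t - s by lra.
  nra.
have {}h2 : U (x + h) - f x * h - (d + e) / 2 * h ^+ 2 <= U x.
  apply: h2 => s t s0 st th.
  have := @subgradient_le _ _ (x + s) (x + t) Uf.
  rewrite lerD2l => /(_ st).
  have := fx' t; rewrite th (le_trans s0 st) => /(_ isT).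
  rewrite ler_norml => /andP[k1 k2]; have : 0 <= t - s by lra.
  nra.
lra.
Qed.

(** Integrates the first-order expansion of [f], whence the factors 1/2. The left half is the right
    half for the reflected function. *)
Lemma subgradient_taylor U f x d e del : subgradient U f ->
  (forall y, `|y - x| < del -> `|f y - f x - d * (y - x)| <= e * `|y - x|) ->
  forall h, `|h| < del ->
  `|U (x + h) - U x - f x * h - d / 2 * h ^+ 2| <= e / 2 * h ^+ 2.
Proof.
move=> Uf fx h; have [h0|h0] := leP 0 h.
  by rewrite ger0_norm// => hd; apply: taylor_right Uf fx _ _; rewrite h0.
rewrite ltr0_norm// => hd.
have fx' y : `|y - (- x)| < del ->
    `|(- f (- y)) - (- f (- - x)) - d * (y - (- x))| <= e * `|y - (- x)|.
  have -> : `|y - - x| = `|- y - x| by rewrite -normrN; congr `|_|; ring.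
  move=> /fx; apply: le_trans; rewrite -normrN opprK.
  by rewrite [- - x]opprK le_eqVlt; apply/orP; left; apply/eqP; congr `|_|; ring.
have := taylor_right (subgradient_opp Uf) fx' (h := - h).
rewrite oppr_ge0 (ltW h0) hd => /(_ isT).
rewrite !opprK opprD !opprK sqrrN; apply: le_trans.
by rewrite le_eqVlt; apply/orP; left; apply/eqP; congr `|_|; ring.
Qed.

End subgradients.

(** * Normalised convex pieces *)

Section profiles.
Context {R : realType}.
Implicit Types (U V f g : R -> R) (a b x y t l s : R).

(* A profile is a convex function that vanishes on the negative half-line,
   has slopes in [0, pgain], and slope pgain beyond plen. *)
Record profile := Profile {
  plen : R; pgain : R; pfun : R -> R; pder : R -> R }.

Record is_profile (p : profile) : Prop := IsProfile {
  plen_ge0 : 0 <= plen p;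
  pder_sub : subgradient (pfun p) (pder p);
  pder_ge0 : forall x, 0 <= pder p x;
  pder_le : forall x, pder p x <= pgain p;
  pder_lt0 : forall x, x < 0 -> pder p x = 0;
  pder_len : forall x, plen p <= x -> pder p x = pgain p;
  pfun_le0 : forall x, x <= 0 -> pfun p x = 0;
  pfun_len : forall x, plen p <= x ->
    pfun p x = pfun p (plen p) + pgain p * (x - plen p) }.

Lemma pgain_ge0 p : is_profile p -> 0 <= pgain p.
Proof. by move=> pp; apply: le_trans (pder_ge0 pp 0) (pder_le pp 0). Qed.

Lemma pfun_ge0 p x : is_profile p -> 0 <= pfun p x.
Proof.
move=> pp; have := pder_sub pp (- 1) x.
by rewrite (pder_lt0 pp (ltrN10 _)) (pfun_le0 pp (lerN10 _)); lra.
Qed.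

Lemma pfun_le p x : is_profile p -> 0 <= x -> pfun p x <= pgain p * x.
Proof.
move=> pp x0; have := pder_sub pp x 0.
have := pder_le pp x; rewrite (pfun_le0 pp (lexx 0)); nra.
Qed.

(** The whole gain sits in the kink at 0, so the profile is linear on [0, l]. *)
Definition kink_profile l s :=
  Profile l s (fun x => if x <= 0 then 0 else s * x)
              (fun x => if x < 0 then 0 else s).

Lemma kink_profileP l s : 0 <= l -> 0 <= s -> is_profile (kink_profile l s).
Proof.
move=> l0 s0; split => //=.
- move=> x y; have [x0|x0] := ltP x 0.
    rewrite (ltW x0) mul0r addr0; case: (leP y 0) => // y0.
    by rewrite mulr_ge0// ltW.
  have -> : (if x <= 0 then 0 else s * x) = s * x.
    by case: (leP x 0) => // x0'; have -> : x = 0; [lra|rewrite mulr0].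
  rewrite -mulrDr subrKC; case: (leP y 0) => // y0.
  by rewrite mulr_ge0_le0.
- by move=> x; case: ifP.
- by move=> x; case: ifP.
- by move=> x ->.
- by move=> x lx; case: (ltP x 0) => //; lra.
- by move=> x ->.
- move=> x lx; case: (leP x 0) => x0; case: (leP l 0) => l0'; try lra.
    have -> : x = 0 by lra.
    have -> : l = 0 by lra.
    lra.
  have -> : l = 0 by lra.
  lra.
Qed.

(** The arc of [U] over [x0, x1], moved to the origin, tilted to initial slope 0 and continued by
    lines. The slopes [m0] and [m1] are arbitrary subgradients at the ends rather than values of
    [f], so a kink can be shared by consecutive arcs; for x0 = x1 the arc is a pure kink. *)
Definition arc_profile U f x0 m0 x1 m1 : profile :=
  Profile (x1 - x0) (m1 - m0)
   (fun x => if x <= 0 then 0 else if x <= x1 - x0 then U (x0 + x) - U x0 - m0 * x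
      else U x1 - U x0 - m0 * (x1 - x0) + (m1 - m0) * (x - (x1 - x0)))
   (fun x => if x1 - x0 <= x then m1 - m0 else if x <= 0 then 0
     else f (x0 + x) - m0).

Lemma arc_profileP U f x0 m0 x1 m1 : subgradient U f -> x0 <= x1 -> m0 <= m1 ->
  (forall y, U x0 + m0 * (y - x0) <= U y) ->
  (forall y, U x1 + m1 * (y - x1) <= U y) ->
  is_profile (arc_profile U f x0 m0 x1 m1).
Proof.
move=> Uf x01 m01 H0 H1.
have fm0 x : 0 < x -> m0 <= f (x0 + x).
  move=> x0'; have := Uf (x0 + x) x0; have := H0 (x0 + x); nra.
have fm1 x : x < x1 - x0 -> f (x0 + x) <= m1.
  move=> x0'; have := Uf (x0 + x) x1; have := H1 (x0 + x); nra.
split => /=.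
- lra.
- move=> x y; set l := x1 - x0; set s := m1 - m0.
  have l0 : 0 <= l by rewrite subr_ge0.
  have s0 : 0 <= s by rewrite subr_ge0.
  pose V t := U (x0 + t) - U x0 - m0 * t; pose v t := f (x0 + t) - m0.
  rewrite -/(V x) -/(V y) -/(v x).
  have -> : U x1 - U x0 - m0 * l = V l by rewrite /V /l subrKC.
  have V0 : V 0 = 0 by rewrite /V addr0; ring.
  have Vv r t : V r + v r * (t - r) <= V t.
    by have := Uf (x0 + r) (x0 + t); rewrite /V /v; lra.
  have V_ge0 t : 0 <= V t by have := H0 (x0 + t); rewrite /V; lra.
  have Vl t : V l + s * (t - l) <= V t.
    by have := H1 (x0 + t); rewrite /V /l /s subrKC; lra.
  have v0 : 0 < x -> 0 <= v x by move=> /fm0; rewrite subr_ge0.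
  have vs : x < l -> v x <= s by move=> /fm1; rewrite lerD2r.
  have := Vl y; have := V_ge0 y; have := Vl 0; rewrite V0.
  case: (leP l x) => hx.
    have -> : (if x <= 0 then 0 else if x <= l then V x else
        V l + s * (x - l)) = V l + s * (x - l).
      case: (leP x 0) => hx0.
        have -> : x = l by lra.
        have -> : l = 0 by lra.
        by rewrite V0; lra.
      case: (leP x l) => hx1 //; have -> : x = l by lra.
      by lra.
    case: (leP y 0) => hy0; last by case: (leP y l) => hy1; lra.
    have : s * y <= 0 by rewrite mulr_ge0_le0.
    by lra.
  rewrite !(ltW hx).
  case: (leP x 0) => hx0.
    case: (leP y 0) => hy0; first by lra.
    case: (leP y l) => hy1; first by lra.
    have := V_ge0 l; have : 0 <= s * (y - l) by rewrite mulr_ge0//; lra.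
    by lra.
  have {}v0 := v0 hx0; have {}vs := vs hx.
  have := Vv x y; have := Vv x 0; have := Vv x l; rewrite V0.
  case: (leP y 0) => hy0.
    have : v x * y <= 0 by rewrite mulr_ge0_le0.
    by lra.
  case: (leP y l) => hy1; first lra.
  by have : v x * (y - l) <= s * (y - l); [rewrite ler_wpM2r//; lra | lra].
- move=> x; case: (leP (x1 - x0) x) => h; first by lra.
  by case: (leP x 0) => h0 //; rewrite subr_ge0 fm0.
- move=> x; case: (leP (x1 - x0) x) => h //; case: (leP x 0) => h0; first by lra.
  by rewrite lerD2r fm1.
- by move=> x x0'; rewrite (ltW x0'); case: (leP (x1 - x0) x) => //; lra.
- by move=> x ->.
- by move=> x ->.
- move=> x hx; have e1 : x0 + (x1 - x0) = x1 by ring.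
  rewrite lexx e1; case: (leP x 0) => hx0.
    have -> : x1 - x0 <= 0 by lra.
    have -> : x = x1 - x0 by lra.
    by lra.
  have e2 : x1 - x0 <= 0 -> x1 = x0 by lra.
  case: (leP x (x1 - x0)) => hx1; case: (leP (x1 - x0) 0) => h1.
  + by lra.
  + have -> : x = x1 - x0 by lra.
    by rewrite e1; lra.
  + by rewrite (e2 h1); lra.
  + by lra.
Qed.

End profiles.

(** * Concatenation and rearrangement of pieces *)

Section glued_profiles.
Context {R : realType}.
Implicit Types (U V f g : R -> R) (a b x y t l d : R) (s : seq nat).
Local Notation profile := (@profile R).

(** A sum that acts as a concatenation: over one piece, the later profiles still vanish and the
    earlier ones are already affine. Convexity is immediate, whatever the order of the pieces. *)
Fixpoint glue (p : nat -> profile) (s : seq nat) x : R :=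
  if s is i :: s' then pfun (p i) x + glue p s' (x - plen (p i)) else 0.

Fixpoint glue_der (p : nat -> profile) (s : seq nat) x : R :=
  if s is i :: s' then pder (p i) x + glue_der p s' (x - plen (p i)) else 0.

Context (p : nat -> profile) (pP : forall i, is_profile (p i)).

Lemma glue_sub s : subgradient (glue p s) (glue_der p s).
Proof.
elim: s => [|i s IH] /=; first by move=> x y; lra.
apply: subgradientD (pder_sub (pP i)) _.
exact: (subgradient_shift (- plen (p i)) IH).
Qed.

Lemma glue_le0 s x : x <= 0 -> glue p s x = 0.
Proof.
elim: s x => [//|i s IH] x x0 /=; rewrite (pfun_le0 (pP i))// IH ?add0r//.
by have := plen_ge0 (pP i); lra.
Qed.

Lemma glue_der_lt0 s x : x < 0 -> glue_der p s x = 0.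
Proof.
elim: s x => [//|i s IH] x x0 /=; rewrite (pder_lt0 (pP i))// IH ?add0r//.
by have := plen_ge0 (pP i); lra.
Qed.

Lemma glue_der_ge0 s x : 0 <= glue_der p s x.
Proof. by elim: s x => [//|i s IH] x /=; rewrite addr_ge0// (pder_ge0 (pP i)). Qed.

Lemma glue_der_le s x : glue_der p s x <= \sum_(i <- s) pgain (p i).
Proof.
elim: s x => [|i s IH] x /=; first by rewrite big_nil.
by rewrite big_cons lerD// (pder_le (pP i)).
Qed.

Lemma glue_len_ge0 (s : seq nat) : 0 <= \sum_(i <- s) plen (p i).
Proof. by apply: sumr_ge0 => i _; exact: plen_ge0. Qed.

(* [drift] is the deviation of the slopes of the glued function from the line
   of slope [sigma], followed along the successive pieces. *)
Fixpoint drift_le (e : nat -> R) eps t (s : seq nat) : Prop :=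
  if s is i :: s' then `|t + e i| <= eps /\ drift_le e eps (t + e i) s'
  else True.

(** At the junctions the deviation is a partial sum of drifts. Inside a piece the slope stays
    between its values at the two junctions, while the line rises by at most [sigma * eta]. *)
Lemma glue_der_close (sigma eta eps : R) t s x :
  0 <= sigma -> (forall i, plen (p i) <= eta) -> `|t| <= eps ->
  drift_le (fun i => pgain (p i) - sigma * plen (p i)) eps t s ->
  0 <= x <= \sum_(i <- s) plen (p i) ->
  `|t + glue_der p s x - sigma * x| <= eps + sigma * eta.
Proof.
move=> sigma0 peta; have eta0 : 0 <= eta.
  exact: le_trans (plen_ge0 (pP 0)) (peta 0%N).
elim: s t x => [|i s IH] t x teps /=.
  rewrite big_nil => _ x0; have -> : x = 0 by lra.
  by rewrite addr0 mulr0 subr0 (le_trans teps)// lerDl mulr_ge0.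
move=> [ti dr]; rewrite big_cons => /andP[x0 xs].
have [xl|lx] := ltP x (plen (p i)).
  rewrite glue_der_lt0 ?addr0; last by lra.
  have := pder_ge0 (pP i) x; have := pder_le (pP i) x.
  move: teps ti; rewrite !ler_norml => /andP[t1 t2] /andP[t3 t4] h1 h2.
  have : sigma * x <= sigma * plen (p i) by rewrite ler_wpM2l// ltW.
  have : sigma * plen (p i) <= sigma * eta by rewrite ler_wpM2l.
  have : 0 <= sigma * x by rewrite mulr_ge0.
  lra.
rewrite (pder_len (pP i))//.
have := IH _ (x - plen (p i)) ti dr.
rewrite subr_ge0 lx/= lerBlDl => /(_ xs).
by congr (`|_| <= _); ring.
Qed.

(* One-dimensional Steinitz lemma: always pick a summand whose sign is opposite
   to that of the current partial sum. *)
Lemma drift_le_exists (e : nat -> R) eps t (s : seq nat) :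
  (forall i, i \in s -> `|e i| <= eps) -> `|t| <= eps ->
  t + \sum_(i <- s) e i = 0 ->
  exists2 s', perm_eq s' s & drift_le e eps t s'.
Proof.
elim: {s}(size s) {-2}s (erefl (size s)) t => [|n IH] s.
  by move/size0nil => -> t _ _ _; exists [::].
move=> sn t es teps sum0.
have [i /andP[is_ ei]] : exists i, (i \in s) && ((t <= 0) && (0 <= e i) || (0 <= t) && (e i <= 0)).
  have [/hasP[i is_ /=]|/hasPn H] := boolP (has (fun i =>
    (t <= 0) && (0 <= e i) || (0 <= t) && (e i <= 0)) s).
    by move=> ei; exists i; rewrite is_.
  have sne : {i | i \in s}.
    by case: s sn {es sum0 H} => [//|i s _]; exists i; rewrite mem_head.
  case: sne => i0 i0s; exfalso; have [t0|t0] := leP t 0.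
    have : \sum_(i <- s) e i < 0.
      rewrite (big_rem i0)//= -[X in _ < X]addr0 ltr_leD//.
        by have := H _ i0s; rewrite t0/=; case: ltP.
      rewrite big_seq; apply: sumr_le0 => i /mem_rem/H.
      by rewrite t0/= negb_or -ltNge => /andP[/ltW].
    by lra.
  have : 0 < \sum_(i <- s) e i.
    rewrite (big_rem i0)//= -[X in X < _]addr0 ltr_leD//.
      by have := H _ i0s; rewrite (ltW t0)/= negb_or -!ltNge => /andP[].
    rewrite big_seq; apply: sumr_ge0 => i /mem_rem/H.
    by rewrite (ltW t0)/= negb_or -!ltNge => /andP[_ /ltW].
  by lra.
have ti : `|t + e i| <= eps.
  move: ei teps (es i is_); rewrite !ler_norml; lra.
have sz : size (rem i s) = n by rewrite size_rem// sn.
have [|||s' s'P s'd] := IH _ sz (t + e i).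
- by move=> j /mem_rem; exact: es.
- exact: ti.
- by rewrite -[RHS]sum0 [in RHS](big_rem i is_)/= addrA.
exists (i :: s') => //=; rewrite (perm_trans _ (_ : perm_eq (i :: rem i s) s))//.
  by rewrite perm_cons.
by rewrite perm_sym perm_to_rem.
Qed.

(** Over a cell both functions lie above the line of the initial slope by at most the gain times
    [d]. The gap at a junction is passed on unchanged, as the slopes agree again there. The total is
    [d] times the whole gain, independently of the number of cells. *)
Lemma glue_chart_close U f (xs ms : nat -> R) d k n :
  subgradient U f ->
  (forall i y, U (xs i) + ms i * (y - xs i) <= U y) ->
  (forall i, plen (p i) = xs i.+1 - xs i) ->
  (forall i, pgain (p i) = ms i.+1 - ms i) ->
  (forall i, plen (p i) <= d) ->
  forall t, 0 <= t <= xs (k + n)%N - xs k ->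
  `|(U (xs k + t) - U (xs k) - ms k * t) - glue p (iota k n) t|
     <= d * (ms (k + n)%N - ms k).
Proof.
move=> Uf Um xsE msE pd; elim: n k => [|n IH] k t.
  rewrite addn0 !subrr => h; have -> : t = 0 by lra.
  by rewrite /= mulr0 addr0 !subrr normr0 mulr0.
rewrite addnS -addSn => /andP[t0 tx] /=.
have d0 : 0 <= d by apply: le_trans (plen_ge0 (pP k)) (pd k).
have g0 := pgain_ge0 (pP k).
have gk := msE k; have lk := xsE k.
have small r : 0 <= r <= plen (p k) ->
    `|U (xs k + r) - U (xs k) - ms k * r - pfun (p k) r| <= d * pgain (p k).
  move=> /andP[r0 rl].
  have h1 : 0 <= U (xs k + r) - U (xs k) - ms k * r.
    by have := Um k (xs k + r); lra.
  have h2 : U (xs k + r) - U (xs k) - ms k * r <= pgain (p k) * d.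
    set y := xs k + r; have yr : y - xs k = r by rewrite /y; ring.
    have mk : 0 <= r -> U y - U (xs k) <= ms k.+1 * r.
      have [yx|yx] := ltP y (xs k.+1).
        have fy : f y <= ms k.+1.
          have := Uf y (xs k.+1); have := Um k.+1 y; nra.
        have := Uf y (xs k); rewrite -yr; nra.
      have -> : y = xs k.+1 by rewrite /y in yx *; lra.
      have := Um k.+1 (xs k); rewrite /y in yx.
      have -> : r = xs k.+1 - xs k by lra.
      lra.
    have := mk r0; rewrite gk.
    have : (ms k.+1 - ms k) * r <= (ms k.+1 - ms k) * d.
      by rewrite -gk ler_wpM2l// (le_trans rl).
    lra.
  have h3 := pfun_ge0 r (pP k).
  have h4 : pfun (p k) r <= pgain (p k) * d.
    by rewrite (le_trans (pfun_le (pP k) r0))// ler_wpM2l// (le_trans rl).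
  by rewrite ler_norml; lra.
have [tl|lt] := leP t (plen (p k)).
  rewrite glue_le0 ?addr0; last by lra.
  apply: le_trans (small _ _) _; first by rewrite t0.
  rewrite ler_wpM2l// gk lerD2r.
  have : 0 <= \sum_(i <- iota k.+1 n) pgain (p i).
    by apply: sumr_ge0 => i _; exact: pgain_ge0.
  have -> : \sum_(i <- iota k.+1 n) pgain (p i) = ms (k.+1 + n)%N - ms k.+1.
    rewrite -[iota _ _](_ : index_iota k.+1 (k.+1 + n) = _); last first.
      by rewrite /index_iota addKn.
    under eq_bigr do rewrite msE.
    by rewrite telescope_sumr// leq_addr.
  lra.
have xk : xs k.+1 = xs k + plen (p k) by rewrite lk; ring.
have := IH k.+1 (t - plen (p k)).
have -> : xs k.+1 + (t - plen (p k)) = xs k + t by rewrite xk; ring.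
have -> : 0 <= t - plen (p k) <= xs (k.+1 + n)%N - xs k.+1.
  by rewrite xk; apply/andP; split; lra.
move=> /(_ isT) h1.
have := small (plen (p k)); rewrite lexx (plen_ge0 (pP k)) => /(_ isT).
rewrite (pfun_len (pP k) (ltW lt)) -xk.
have mk : ms k.+1 = ms k + pgain (p k) by rewrite gk; ring.
move: h1; rewrite mk !ler_norml; lra.
Qed.

End glued_profiles.

(** * The resolvent of a subdifferential *)

Section minty.
Context {R : realType}.
Implicit Types (U f : R -> R) (x y z : R).

(* Minty: the resolvent [(id + f)^-1] parametrises the subgradients of [U]. *)
Lemma minty_resolvent U f : subgradient U f ->
  exists phi : R -> R, forall y z, U (phi y) + (y - phi y) * (z - phi y) <= U z.
Proof.
move=> Uf; pose E y := [set x | x + f x <= y].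
have fh := subgradient_homo Uf.
have supE y : has_sup (E y).
  split.
    exists (Num.min 0 (y - f 0)); rewrite /E /=.
    have h1 : Num.min 0 (y - f 0) <= 0 by rewrite ge_min lexx.
    have h2 : Num.min 0 (y - f 0) <= y - f 0 by rewrite ge_min lexx orbT.
    by have := fh _ _ h1; lra.
  exists (Num.max 0 (y - f 0)) => x; rewrite /E /= => xy.
  rewrite leNgt; apply/negP; rewrite gt_max => /andP[x0 xf].
  by have := fh _ _ (ltW x0); lra.
exists (fun y => sup (E y)) => y z; set x := sup (E y).
have gt_x w : x < w -> y < w + f w.
  move=> xw; rewrite ltNge; apply/negP => wy.
  have : w <= x by apply: ub_le_sup => //; exact: (supE y).2.
  by rewrite leNgt xw.
have lt_x w : w < x -> w + f w <= y.
  move=> wx; have [e [Ee we]] : exists e, E y e /\ w < e.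
    have := @sup_adherent _ (E y) (x - w); rewrite subr_gt0 => /(_ wx (supE y)).
    by case=> e Ee; rewrite -/x => h; exists e; split => //; lra.
  by move: Ee; rewrite /E /=; have := fh _ _ (ltW we); lra.
(* At a jump of [f] the value [y - x] is only some subgradient at [x]. The inequality is first
   obtained at points [w] between [x] and [z], where [y] compares with [w + f w], up to an error
   linear in [w - x]. *)
have key w : (x < w <= z) \/ (z <= w < x) ->
   (w - x) * (f x - (z - x) - (y - x)) <= U z - U x - (y - x) * (z - x).
  move=> H; have h1 : U x + f x * (w - x) + (y - w) * (z - w) <= U z.
    have := Uf x w; have := Uf w z.
    case: H => /andP[h1 h2].
      by have := gt_x _ h1; nra.
    by have := lt_x _ h2; nra.
  by have : 0 <= (w - x) ^+ 2 by [exact: sqr_ge0|]; nra.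
have [->|zx] := eqVneq z x; first by lra.
rewrite -subr_le0; set C := f x - (z - x) - (y - x) in key.
apply: (@le_archi_eq0 _ _ (- (z - x) * C)) => n.
have := key (x + (z - x) / n.+1%:R).
have n0 : 0 < n.+1%:R^-1 :> R by rewrite invr_gt0.
have n1 : n.+1%:R^-1 <= 1 :> R by rewrite invf_le1// ler1n.
move: n0 n1; set r := _^-1 => r0 r1 /(_ _)/wrap[|].
  case/orP: (lt_total zx) => h; [right|left]; apply/andP; split; nra.
lra.
Qed.

End minty.

(** * Functionals of intervals *)

Lemma eq_ler (R : realType) (x y : R) : x = y -> x <= y. Proof. by move=> ->. Qed.

(** Cauchy's equation with an upper bound only, which is all that semicontinuity provides. The
    difference [g] with the linear function vanishes on multiples of some 1/N, so it is bounded
    above everywhere; additivity forces g <= 0, and g x + g (m - x) = 0 gives equality. *)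
Lemma additive_bounded_linear (R : realType) (h : R -> R) (del B : R) :
  0 < del -> (forall x y, 0 <= x -> 0 <= y -> h (x + y) = h x + h y) ->
  (forall x, 0 <= x <= del -> h x <= B) ->
  forall x, 0 <= x -> h x = h 1 * x.
Proof.
move=> del0 hD hB; pose g x := h x - h 1 * x.
have gD x y : 0 <= x -> 0 <= y -> g (x + y) = g x + g y.
  by move=> x0 y0; rewrite /g hD//; ring.
have gM n y : 0 <= y -> g (n%:R * y) = n%:R * g y.
  move=> y0; elim: n => [|n IH].
    by rewrite !mul0r; have := gD _ _ (lexx 0) (lexx 0); rewrite addr0; lra.
  by rewrite -natr1 !mulrDl !mul1r gD ?IH// mulr_ge0.
have g1 : g 1 = 0 by rewrite /g; ring.
have [N HN] := lt_succn del^-1.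
have N0 : 0 < N.+1%:R :> R by [].
have N0' : 0 < N.+1%:R^-1 :> R by rewrite invr_gt0.
have Ndel : N.+1%:R^-1 <= del by rewrite invf_ple// ltW.
have gN : g N.+1%:R^-1 = 0.
  have := gM N.+1 _ (ltW N0'); rewrite divff ?gt_eqF// g1 => /esym/eqP.
  by rewrite mulf_eq0 pnatr_eq0/= => /eqP.
have gB x : 0 <= x -> g x <= B + `|h 1| * del.
  move=> x0; have t0 : 0 <= x * N.+1%:R by rewrite mulr_ge0.
  have /andP[k1 k2] := Num.Theory.truncn_itv t0.
  move: (Num.truncn _) k1 k2 => m k1 k2.
  pose y := x - m%:R * N.+1%:R^-1.
  have y0 : 0 <= y by rewrite subr_ge0 ler_pdivrMr.
  have yN : y <= N.+1%:R^-1.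
    have : x <= m.+1%:R * N.+1%:R^-1 by rewrite ler_pdivlMr// ltW.
    by rewrite /y -[m.+1%:R]natr1 mulrDl mul1r; move: (N.+1%:R^-1 : R) => r; lra.
  have -> : x = m%:R * N.+1%:R^-1 + y by rewrite /y; ring.
  rewrite gD// ?gM ?gN ?mulr0 ?add0r ?mulr_ge0// ?(ltW N0')//.
  have yd : y <= del by apply: le_trans Ndel.
  have := hB y; rewrite y0 yd => /(_ isT) hy.
  have : - h 1 * y <= `|h 1| * del.
    apply: le_trans (ler_norm _) _; rewrite normrM normrN (ger0_norm y0).
    by rewrite ler_wpM2l.
  by rewrite /g; lra.
have g_le0 x : 0 <= x -> g x <= 0.
  move=> x0; apply: (@le_archi_eq0 _ _ (B + `|h 1| * del)) => n.
  by rewrite ler_pdivlMr// mulrC -gM// gB// mulr_ge0.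
move=> x x0; have [m xm] := lt_succn x.
have := gD x (m.+1%:R - x) x0; rewrite subrKC subr_ge0 => /(_ (ltW xm)).
have := gM m.+1 1 ler01; rewrite mulr1 g1 mulr0 => ->.
have := g_le0 x x0; have := g_le0 (m.+1%:R - x).
rewrite subr_ge0 => /(_ (ltW xm)).
by move: (g (_ - _)) => G; rewrite /g; lra.
Qed.

Lemma additive_ge0_linear (R : realType) (h : R -> R) :
  (forall x y, 0 <= x -> 0 <= y -> h (x + y) = h x + h y) ->
  (forall x, 0 <= x -> 0 <= h x) ->
  forall x, 0 <= x -> h x = h 1 * x.
Proof.
move=> hD h0 x x0; apply: oppr_inj; rewrite -mulNr.
apply: (@additive_bounded_linear _ (fun x => - h x) 1 0) => //.
  by move=> y z y0 z0; rewrite hD// opprD.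
by move=> y /andP[y0 _]; rewrite oppr_le0 h0.
Qed.

Section interval_functional.
Context {R : realType}.
Implicit Types (U V f g : R -> R) (a b c x y t l d e del : R) (s : seq nat).

Definition convex1 U := exists f, subgradient U f.

(** [z_usc] is tau-semicontinuity over a fixed segment in quantified form: the common Lipschitz
    bound becomes [L], on which [del] may depend, and the convergence becomes uniform closeness. *)
Record interval_functional (z : (R -> R) -> R -> R -> R) : Prop := {
  z_split : forall U a b c, convex1 U -> a <= b -> b <= c ->
    z U a c = z U a b + z U b c;
  z_shift : forall U a b t, convex1 U -> a <= b ->
    z (fun x => U (x + t)) a b = z U (a + t) (b + t);
  z_affine : forall U a b k0 k1, convex1 U -> a <= b ->
    z (fun x => U x + (k1 * x + k0)) a b = z U a b;
  z_eq : forall U V a b, (forall x, a <= x <= b -> U x = V x) ->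
    z U a b = z V a b;
  z_cst0 : forall a b, a <= b -> z (fun=> 0) a b = 0;
  z_usc : forall U L a b e, convex1 U -> a <= b -> 0 < e ->
    exists2 del, 0 < del & forall V g, subgradient V g ->
      (forall x, a <= x <= b -> `|g x| <= L) ->
      (forall x, a <= x <= b -> `|V x - U x| <= del) ->
      z V a b <= z U a b + e }.

Lemma convex1_shift U t : convex1 U -> convex1 (fun x => U (x + t)).
Proof. by case=> f Uf; exists (fun x => f (x + t)); exact: subgradient_shift. Qed.

Lemma convex1_affine U k0 k1 : convex1 U -> convex1 (fun x => U x + (k1 * x + k0)).
Proof.
by case=> f Uf; exists (fun x => f x + k1); apply: subgradientD => // x y; lra.
Qed.

Lemma convex1_cst0 : convex1 (fun=> 0 : R).
Proof. by exists (fun=> 0) => x y; lra. Qed.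

Definition parabola t x := t / 2 * x ^+ 2.

Lemma parabola_sub t : 0 <= t -> subgradient (parabola t) (fun x => t * x).
Proof. by move=> t0 x y; rewrite /parabola; have := mulr_ge0 t0 (sqr_ge0 (x - y)); lra. Qed.

Lemma convex1_parabola t : 0 <= t -> convex1 (parabola t).
Proof. by move=> t0; exists (fun x => t * x); exact: parabola_sub. Qed.

Context (z : (R -> R) -> R -> R -> R) (zP : interval_functional z).

Lemma z_point U a : convex1 U -> z U a a = 0.
Proof. by move=> cU; have := z_split zP cU (lexx a) (lexx a); lra. Qed.

(** The right-hand side ignores the order of [s]; this is the invariance under rearrangement. *)
Lemma z_glue (p : nat -> profile) s : (forall i, is_profile (p i)) ->
  z (glue p s) 0 (\sum_(i <- s) plen (p i)) =
  \sum_(i <- s) z (pfun (p i)) 0 (plen (p i)).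
Proof.
move=> pP; have cg s' : convex1 (glue p s').
  by exists (glue_der p s'); exact: glue_sub.
have cp i : convex1 (pfun (p i)) by exists (pder (p i)); exact: pder_sub.
elim: s => [|i s IH]; first by rewrite !big_nil z_point//; exact: convex1_cst0.
have l0 := plen_ge0 (pP i); have L0 := glue_len_ge0 pP s.
rewrite !big_cons (z_split zP (b := plen (p i)))//; last by rewrite lerDl.
congr (_ + _).
  apply: (z_eq zP) => x /andP[x0 xl] /=.
  by rewrite (glue_le0 pP) ?addr0// subr_le0.
rewrite -IH; set l := plen (p i) in l0 *; set L := bigop _ _ _ in L0 *.
transitivity (z (fun x => glue p s (x + - l) +
   (pgain (p i) * x + (pfun (p i) l - pgain (p i) * l))) l (l + L)).
  apply: (z_eq zP) => x /andP[lx xl] /=.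
  by rewrite (pfun_len (pP i))//= -/l; ring.
rewrite (z_affine zP) ?lerDl//; last exact: convex1_shift.
rewrite (z_shift zP) ?lerDl// subrr addrC addKr//.
Qed.

Lemma z_kink l m : 0 <= l -> z (pfun (kink_profile l m)) 0 l = 0.
Proof.
move=> l0; rewrite -[RHS](z_cst0 zP l0) -[RHS](z_affine zP 0 m convex1_cst0 l0).
apply: (z_eq zP) => x /andP[x0 _] /=; case: (leP x 0) => h; last by lra.
have -> : x = 0 by lra.
lra.
Qed.

Lemma z_chart U (xs : nat -> R) k n : convex1 U ->
  (forall i, xs i <= xs i.+1) ->
  z U (xs k) (xs (k + n)%N) = \sum_(i <- iota k n) z U (xs i) (xs i.+1).
Proof.
move=> cU xsS; elim: n k => [|n IH] k; first by rewrite addn0 big_nil z_point.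
rewrite /= big_cons -IH addnS -addSn; apply: (z_split zP) => //.
by apply: (homo_leq lexx le_trans xsS); rewrite leq_addr.
Qed.

Lemma iota_last (T : Type) (k n : nat) (F : nat -> R) :
  \sum_(i <- iota 0 n) F i = \sum_(i < n) F i.
Proof. by rewrite -(big_mkord xpredT F) /index_iota subn0. Qed.

(** Only lengths and gains of the pieces matter for convergence to [U], so their shape is free:
    kinks will give positivity, parabolas the Riemann sums. *)
Lemma z_approx U f a b e : subgradient U f -> a <= b -> 0 < e ->
  exists N, forall n (p : nat -> profile), (N <= n)%N ->
    let d := (b - a) / n.+1%:R in
    (forall i, is_profile (p i)) -> (forall i, plen (p i) = d) ->
    (forall i, pgain (p i) = f (a + i.+1%:R * d) - f (a + i%:R * d)) ->
    \sum_(i < n.+1) z (pfun (p i)) 0 d <= z U a b + e.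
Proof.
move=> Uf ab e0; have cU : convex1 U by exists f.
have fh := subgradient_homo Uf.
have fab := fh _ _ ab.
have [del del0 usc] := z_usc zP (`|f a| + `|f b|) cU ab e0.
set C := (b - a) * (f b - f a).
have C0 : 0 <= C by rewrite mulr_ge0// subr_ge0.
(* Makes [d * (f b - f a)], the distance given by [glue_chart_close], at most [del]. *)
exists (Num.truncn (C / del)) => n p Nn d pP pl pg.
have n0 : 0 < n.+1%:R :> R by [].
have d0 : 0 <= d by rewrite divr_ge0// subr_ge0.
have dn : n.+1%:R * d = b - a by rewrite /d mulrC divfK ?pnatr_eq0.
have Cd : d * (f b - f a) <= del.
  have : C / del < n.+1%:R.
    have /andP[_ h] := Num.Theory.truncn_itv (divr_ge0 C0 (ltW del0)).
    by rewrite (lt_le_trans h)// ler_nat.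
  rewrite ltr_pdivrMr// /C -dn -mulrA ltr_pM2l//; exact: ltW.
pose xs (i : nat) := a + i%:R * d.
have xsn : xs n.+1 = b by rewrite /xs dn; ring.
have xsS i : xs i.+1 - xs i = d by rewrite /xs -natr1; ring.
have sd : \sum_(i <- iota 0 n.+1) plen (p i) = b - a.
  rewrite (iota_last nat 0%N) (eq_bigr (fun=> d)) => [|i _]; last exact: pl.
  by rewrite sumr_const card_ord -mulr_natl.
have sg : \sum_(i <- iota 0 n.+1) pgain (p i) = f b - f a.
  rewrite (iota_last nat 0%N).
  rewrite (eq_bigr (fun i : 'I_n.+1 => f (xs i.+1) - f (xs i))) => [|i _]; last exact: pg.
  rewrite -(big_mkord xpredT (fun i => f (xs i.+1) - f (xs i))) telescope_sumr//.
  by rewrite xsn /xs mul0r addr0.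
pose G := glue p (iota 0 n.+1).
(* The glued function moved back to [a], with the value [U a] and the slope [f a] restored there. *)
pose V x := G (x + (- a)) + (f a * x + (U a - f a * a)).
have cG : convex1 G by exists (glue_der p (iota 0 n.+1)); exact: glue_sub.
have zG : z V a b = \sum_(i < n.+1) z (pfun (p i)) 0 d.
  rewrite /V (z_affine zP)//; last exact: convex1_shift.
  rewrite (z_shift zP)// subrr -sd z_glue// (iota_last nat 0%N).
  by apply: eq_bigr => i _; rewrite pl.
rewrite -zG; apply: (usc _ (fun x => glue_der p (iota 0 n.+1) (x - a) + f a)).
- apply: subgradientD; last by move=> x y; lra.
  exact/(subgradient_shift (- a))/glue_sub.
- move=> x _; have h1 := glue_der_ge0 pP (iota 0 n.+1) (x - a).
  have := glue_der_le pP (iota 0 n.+1) (x - a); rewrite sg => h2.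
  have := ler_norm (f a); have := ler_norm (f b).
  have := ler_norm (- f a); have := ler_norm (- f b); rewrite !normrN.
  by rewrite ler_norml; lra.
move=> x /andP[ax xb].
have h1 i y : U (xs i) + f (xs i) * (y - xs i) <= U y by exact: Uf.
have h2 i : plen (p i) = xs i.+1 - xs i by rewrite pl xsS.
have h4 i : plen (p i) <= d by rewrite pl.
have := @glue_chart_close _ p pP U f xs (fun i => f (xs i)) d 0 n.+1 Uf h1 h2 pg h4 (x - a).
have xs0 : xs 0%N = a by rewrite /xs mul0r addr0.
rewrite add0n xsn xs0.
rewrite subr_ge0 ax lerD2r xb => /(_ isT) h; apply: le_trans (le_trans h Cd).
rewrite distrC; apply/eq_ler; congr `|_|; rewrite /V /G; have -> : a + (x - a) = x by ring.
ring.
Qed.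

(** [U] is a limit of polygons made of kink profiles, on which [z] vanishes; semicontinuity bounds
    this 0 by [z U a b]. *)
Lemma z_ge0 U a b : convex1 U -> a <= b -> 0 <= z U a b.
Proof.
move=> [f Uf] ab; rewrite leNgt; apply/negP => z0.
have e0 : 0 < - z U a b / 2 by lra.
have [N /(_ N)] := z_approx Uf ab e0.
set d := _ / _.
have d0 : 0 <= d by rewrite divr_ge0// subr_ge0.
move=> /(_ (fun i => kink_profile d (f (a + i.+1%:R * d) - f (a + i%:R * d))) (leqnn _)).
move=> /= H.
have kP i : is_profile (kink_profile d (f (a + i.+1%:R * d) - f (a + i%:R * d))).
  apply: kink_profileP => //; rewrite subr_ge0; apply: (subgradient_homo Uf).
  by rewrite lerD2l ler_wpM2r// ler_nat.
have := H kP (fun=> erefl) (fun=> erefl).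
rewrite big1 => [|i _]; last exact: (z_kink _ d0).
by move: z0; clear; lra.
Qed.

Definition zeta t := z (parabola t) 0 1.

(** A translation changes a parabola by an affine term, so the value depends on the length alone,
    additively; being nonnegative it is linear in the length. *)
Lemma z_parabola t a b : 0 <= t -> a <= b ->
  z (parabola t) a b = zeta t * (b - a).
Proof.
move=> t0 ab; have cq := convex1_parabola t0.
have sh c x y : x <= y -> z (parabola t) (x + c) (y + c) = z (parabola t) x y.
  move=> xy; rewrite -(z_shift zP)//.
  rewrite -(z_affine zP (t / 2 * c ^+ 2) (t * c) cq xy).
  by apply: (z_eq zP) => r _; rewrite /parabola; field.
have := sh a 0 (b - a); rewrite subr_ge0 add0r subrK => -> //.
apply: (@additive_ge0_linear _ (fun l => z (parabola t) 0 l)); last first.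
- by rewrite subr_ge0.
- by move=> l l0; exact: z_ge0.
move=> x y x0 y0; rewrite (z_split zP (b := x))// ?lerDl//; congr (_ + _).
by have := sh x _ _ y0; rewrite add0r addrC.
Qed.

Lemma zeta_ge0 t : 0 <= t -> 0 <= zeta t.
Proof. by move=> t0; apply: z_ge0 => //; exact: convex1_parabola. Qed.

Lemma z_ge_riemann U f a b e : subgradient U f -> a < b -> 0 < e ->
  exists N, forall n d, (N <= n)%N -> d = (b - a) / n.+1%:R ->
    \sum_(i < n.+1) d * zeta ((f (a + i.+1%:R * d) - f (a + i%:R * d)) / d)
    <= z U a b + e.
Proof.
move=> Uf ab e0; have [N H] := z_approx Uf (ltW ab) e0.
exists N => n d Nn dE; have := fun p => H n p Nn; rewrite /= -dE => {}H.
have d0 : 0 < d by rewrite dE divr_gt0// subr_gt0.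
pose s i := f (a + i.+1%:R * d) - f (a + i%:R * d).
have s0 i : 0 <= s i.
  rewrite subr_ge0; apply: (subgradient_homo Uf).
  by rewrite lerD2l ler_wpM2r// ?ler_nat// ltW.
have sd0 i : 0 <= s i / d by rewrite divr_ge0// ltW.
have {}H := H (fun i => arc_profile (parabola (s i / d)) (fun x => s i / d * x) 0 0 d (s i)).
have kP i : is_profile (arc_profile (parabola (s i / d)) (fun x => s i / d * x) 0 0 d (s i)).
  apply: arc_profileP => //; [exact: parabola_sub|exact: ltW| |] => y.
    by have := parabola_sub (sd0 i) 0 y; rewrite mulr0.
  by have := parabola_sub (sd0 i) d y; rewrite divfK// gt_eqF.
have := H kP (fun=> subr0 d) (fun i => subr0 (s i)).
apply: le_trans; apply: ler_sum => i _; rewrite -/(s i).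
have -> : d * zeta (s i / d) = z (parabola (s i / d)) 0 d.
  by rewrite z_parabola ?(ltW d0)// subr0 mulrC.
apply/eq_ler/(z_eq zP) => x /andP[x0 xd].
rewrite /= subr0 xd /parabola; case: (leP x 0) => h; last by rewrite add0r; lra.
have -> : x = 0 by lra.
by rewrite expr0n/= mulr0.
Qed.

End interval_functional.

(** * Upper bound by the mean slope, and the shape of zeta *)

Section jensen.
Context {R : realType}.
Implicit Types (U V f g : R -> R) (a b c x y t l d e del : R) (s : seq nat).
Context (z : (R -> R) -> R -> R -> R) (zP : interval_functional z).
Local Notation zeta := (zeta z).

(* Cut [U] along the resolvent into pieces of length plus gain [eta], reorder
   them so that the slopes stay near the line of slope [sigma], and glue them
   back: the result converges to a parabola, and [z] has not changed. *)
Lemma z_jensen U f a b ma mb : subgradient U f -> a < b ->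
  (forall y, U a + ma * (y - a) <= U y) ->
  (forall y, U b + mb * (y - b) <= U y) ->
  z U a b <= (b - a) * zeta ((mb - ma) / (b - a)).
Proof.
move=> Uf ab Ua Ub; have cU : convex1 U by exists f.
have ba0 : 0 < b - a by rewrite subr_gt0.
have mab : 0 <= mb - ma.
  by have := Ua b; have := Ub a; have := ba0; nra.
set sigma := (mb - ma) / (b - a).
have sigma0 : 0 <= sigma by rewrite divr_ge0// ltW.
have sigE : sigma * (b - a) = mb - ma by rewrite /sigma divfK// gt_eqF.
have [phi phiP] := minty_resolvent Uf.
(* Monotonicity of the subdifferential: both [phi y] and [y - phi y] are nondecreasing, so one step
   [eta] in [y] bounds the length and the gain of a piece at once. *)
have mono y y' : y <= y' -> 0 <= phi y' - phi y <= y' - y.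
  move=> yy; have := phiP y (phi y'); have := phiP y' (phi y) => h1 h2.
  have : (phi y' - phi y) * (phi y' - phi y) <= (y' - y) * (phi y' - phi y) by lra.
  have := yy; rewrite -subr_ge0; set w := y' - y; set v := phi y' - phi y => w0 vw.
  by apply/andP; split; nra.
have phia : phi (a + ma) = a.
  have := phiP (a + ma) a; have := Ua (phi (a + ma)); set x := phi _ => h1 h2.
  have : (x - a) ^+ 2 <= 0 by nra.
  by move=> h; apply/eqP; rewrite -subr_eq0 -(sqrf_eq0 (x - a)) eq_le h sqr_ge0.
have phib : phi (b + mb) = b.
  have := phiP (b + mb) b; have := Ub (phi (b + mb)); set x := phi _ => h1 h2.
  have : (x - b) ^+ 2 <= 0 by nra.
  by move=> h; apply/eqP; rewrite -subr_eq0 -(sqrf_eq0 (x - b)) eq_le h sqr_ge0.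
apply/ler_addgt0Pr => e e0.
have [del del0 usc] := z_usc zP (mb - ma) (convex1_parabola sigma0) (ltW ba0) e0.
(* Gains and lengths lie in [0, eta], so a single drift is at most [(1 + sigma) * eta]; the line
   moves by [sigma * eta] inside a piece. The sum of these slope errors, integrated over the length
   [b - a], is [C / n.+1]. *)
pose C := (b + mb - (a + ma)) * (1 + sigma + sigma) * (b - a).
have C0 : 0 <= C by rewrite !mulr_ge0//; lra.
have [n nC] := lt_succn (C / del); pose eta := (b + mb - (a + ma)) / n.+1%:R.
have n0 : 0 < n.+1%:R :> R by [].
have eta0 : 0 <= eta by rewrite divr_ge0//; lra.
have etan : n.+1%:R * eta = b + mb - (a + ma) by rewrite mulrC divfK ?pnatr_eq0.
have Cdel : eta * (1 + sigma + sigma) * (b - a) <= del.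
  have := nC; rewrite ltr_pdivrMr// /C -etan -!mulrA ltr_pM2l// => h.
  exact: ltW.
pose ys (i : nat) := a + ma + i%:R * eta.
have ysS i : ys i.+1 = ys i + eta by rewrite /ys -natr1; ring.
pose xs i := phi (ys i); pose ms i := ys i - phi (ys i).
have xsS i : 0 <= xs i.+1 - xs i <= eta.
  by have := mono (ys i) (ys i.+1); rewrite ysS lerDl => /(_ eta0); rewrite /xs ysS; lra.
have msS i : 0 <= ms i.+1 - ms i <= eta.
  by have := xsS i; rewrite /ms -/(xs i) -/(xs i.+1) ysS; lra.
have xs0 : xs 0%N = a by rewrite /xs /ys mul0r addr0.
have xsn : xs n.+1 = b by rewrite /xs /ys etan subrKC.
have ms0 : ms 0%N = ma by rewrite /ms -/(xs 0%N) xs0 /ys mul0r addr0; ring.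
have msn : ms n.+1 = mb by rewrite /ms -/(xs n.+1) xsn /ys etan; ring.
pose p i := arc_profile U f (xs i) (ms i) (xs i.+1) (ms i.+1).
have pP i : is_profile (p i).
  have /andP[m0 _] := msS i; have /andP[x0 _] := xsS i.
  rewrite subr_ge0 in m0; rewrite subr_ge0 in x0.
  exact: (arc_profileP Uf x0 m0 (phiP (ys i)) (phiP (ys i.+1))).
have zp i : z U (xs i) (xs i.+1) = z (pfun (p i)) 0 (plen (p i)).
  have /andP[x0 _] := xsS i.
  have -> : z U (xs i) (xs i.+1) = z (fun x => U (x + xs i)) 0 (xs i.+1 - xs i).
    by rewrite (z_shift zP)// add0r subrK.
  rewrite -(z_affine zP (- U (xs i)) (- ms i) (convex1_shift _ cU) x0).
  apply: (z_eq zP) => x /andP[x0' xl] /=; rewrite xl.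
  case: (leP x 0) => h; last by rewrite addrC [x + _]addrC; ring.
  have -> : x = 0 by lra.
  by rewrite add0r; ring.
have -> : z U a b = \sum_(i <- iota 0 n.+1) z (pfun (p i)) 0 (plen (p i)).
  rewrite -xs0 -xsn -[in LHS](add0n n.+1) z_chart//; last first.
    by move=> i; have /andP[] := xsS i; rewrite subr_ge0.
  by apply: eq_bigr => i _; rewrite zp.
have sum_len : \sum_(i <- iota 0 n.+1) plen (p i) = b - a.
  rewrite (iota_last nat 0%N) -(big_mkord xpredT (fun i => xs i.+1 - xs i)) telescope_sumr//.
  by rewrite xsn xs0.
have sum_gain : \sum_(i <- iota 0 n.+1) pgain (p i) = mb - ma.
  rewrite (iota_last nat 0%N) -(big_mkord xpredT (fun i => ms i.+1 - ms i)) telescope_sumr//.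
  by rewrite msn ms0.
pose ee i := pgain (p i) - sigma * plen (p i).
have [|||s sP dr] := @drift_le_exists R ee ((1 + sigma) * eta) 0 (iota 0 n.+1).
- move=> i _; rewrite /ee /=; have /andP[x0 x1] := xsS i.
  have /andP[m0 m1] := msS i; rewrite ler_norml; nra.
- by rewrite normr0 mulr_ge0// addr_ge0.
- by rewrite add0r sumrB -mulr_sumr sum_len sum_gain sigE subrr.
rewrite -(perm_big _ sP)/= -(z_glue zP _ pP).
have sum_len' : \sum_(i <- s) plen (p i) = b - a by rewrite (perm_big _ sP).
have sum_gain' : \sum_(i <- s) pgain (p i) = mb - ma by rewrite (perm_big _ sP).
rewrite sum_len'.
have -> : (b - a) * zeta sigma = z (parabola sigma) a b.
  by rewrite (z_parabola zP) ?(ltW ab)// mulrC.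
have -> : z (parabola sigma) a b = z (parabola sigma) 0 (b - a).
  by rewrite !(z_parabola zP) ?(ltW ab) ?(ltW ba0)// subr0.
apply: (usc _ (glue_der p s)); first exact: glue_sub.
  move=> x _; have := glue_der_le pP s x; rewrite sum_gain'.
  by rewrite ger0_norm// glue_der_ge0.
have := @subgradient_close R (glue p s) (glue_der p s) (parabola sigma)
  (fun x => sigma * x) (b - a) ((1 + sigma) * eta + sigma * eta)
  (glue_sub pP s) (parabola_sub sigma0).
rewrite (glue_le0 pP)// /parabola expr0n/= mulr0 => close x x0b.
have slope y : 0 <= y <= b - a ->
    `|glue_der p s y - sigma * y| <= (1 + sigma) * eta + sigma * eta.
  rewrite -sum_len' => yb; rewrite -[glue_der _ _ _]add0r.
  apply: (glue_der_close pP) dr yb => // [i|]; first by have /andP[] := xsS i.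
  by rewrite normr0 mulr_ge0// addr_ge0.
have := close slope x x0b; rewrite !subr0 => /le_trans; apply; apply: le_trans Cdel.
have /andP[_ xb] := x0b.
rewrite -mulrDl [_ * eta]mulrC ler_wpM2l// mulr_ge0//.
by rewrite !addr_ge0.
Qed.

Lemma z_le_riemann U f a b n d : subgradient U f -> a < b ->
  d = (b - a) / n.+1%:R ->
  z U a b <=
    \sum_(i < n.+1) d * zeta ((f (a + i.+1%:R * d) - f (a + i%:R * d)) / d).
Proof.
move=> Uf ab dE; have cU : convex1 U by exists f.
have d0 : 0 < d by rewrite dE divr_gt0// subr_gt0.
pose xs (i : nat) := a + i%:R * d.
have xsS i : xs i.+1 - xs i = d by rewrite /xs -natr1; ring.
have xsn : xs n.+1 = b by rewrite /xs dE mulrC divfK ?pnatr_eq0// subrKC.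
have xs0 : xs 0%N = a by rewrite /xs mul0r addr0.
have lexs i : xs i < xs i.+1 by rewrite -subr_gt0 xsS.
have -> : z U a b = z U (xs 0%N) (xs (0 + n.+1)%N) by rewrite add0n xs0 xsn.
rewrite (z_chart zP)//; last by move=> i; exact: ltW.
rewrite (iota_last nat 0%N); apply: ler_sum => i _; rewrite -/(xs i) -/(xs i.+1).
by have := z_jensen Uf (lexs i) (Uf (xs i)) (Uf (xs i.+1)); rewrite xsS.
Qed.

(** [z_jensen] for the function on [0, 1] with second derivative [t] before [l] and [s] after, whose
    slope gain is [l * t + (1 - l) * s]. For t <= s it is a sum of two convex functions. *)
Lemma zeta_concave t (s : R) l : 0 <= t -> 0 <= s -> 0 <= l <= 1 ->
  l * zeta t + (1 - l) * zeta s <= zeta (l * t + (1 - l) * s).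
Proof.
wlog ts : t s l / t <= s.
  move=> H t0 s0 /andP[l0 l1]; have [ts|/ltW st] := leP t s.
    by apply: H => //; rewrite l0.
  have := H _ _ (1 - l) st s0 t0; rewrite subr_ge0 l1 lerBlDr lerDl l0 => /(_ isT).
  rewrite (_ : 1 - (1 - l) = l); last by ring.
  by rewrite addrC [X in _ <= zeta X]addrC.
move=> t0 s0 /andP[l0 l1].
pose U x := parabola t x + if x <= l then 0 else (s - t) / 2 * (x - l) ^+ 2.
pose f x := t * x + if x <= l then 0 else (s - t) * (x - l).
have Uf : subgradient U f.
  apply: subgradientD; first exact: parabola_sub.
  have st : 0 <= s - t by rewrite subr_ge0.
  move=> x y; have h := mulr_ge0 st (sqr_ge0 (x - y)).
  case: (leP x l) => xl; case: (leP y l) => yl; rewrite ?mul0r ?addr0//.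
  - by rewrite mulr_ge0// ?sqr_ge0// divr_ge0.
  - have h2 : 0 <= (s - t) * ((x - l) * (l - y)) by rewrite !mulr_ge0//; lra.
    have h3 := mulr_ge0 st (sqr_ge0 (x - l)); lra.
  - by move: h; lra.
have := @z_jensen U f 0 1 (f 0) (f 1) Uf ltr01 (Uf 0) (Uf 1).
have cU : convex1 U by exists f.
rewrite (z_split zP cU l0 l1).
have -> : z U 0 l = l * zeta t.
  rewrite -[l in RHS]subr0 mulrC -(z_parabola zP)//.
  by apply: (z_eq zP) => x /andP[_ xl]; rewrite /U xl addr0.
have -> : z U l 1 = (1 - l) * zeta s.
  rewrite mulrC -(z_parabola zP)//.
  rewrite -(z_affine zP ((s - t) / 2 * l ^+ 2) ((t - s) * l) (convex1_parabola s0))//.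
  apply: (z_eq zP) => x /andP[lx _]; rewrite /U /parabola.
  case: (leP x l) => xl; last by field.
  have -> : x = l by lra.
  by field.
have -> : f 1 - f 0 = l * t + (1 - l) * s.
  rewrite /f l0; case: (leP 1 l) => h; last by ring.
  have -> : l = 1 by lra.
  by ring.
by rewrite subr0 divr1 mul1r.
Qed.

Lemma zeta0_cvg e : 0 < e -> exists2 del, 0 < del &
  forall t, 0 <= t <= del -> zeta t <= e.
Proof.
move=> e0; have [del del0 usc] := z_usc zP 1 (@convex1_cst0 R) ler01 e0.
exists (Num.min del 1); first by rewrite lt_min del0 ltr01.
move=> t /andP[t0]; rewrite le_min => /andP[td t1].
rewrite -[X in _ <= X]add0r -{1}(z_cst0 zP (@ler01 R)).
apply: (usc _ (fun x => t * x)); first exact: parabola_sub.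
  by move=> x /andP[x0 x1]; rewrite ger0_norm ?mulr_ge0// mulr_ile1.
move=> x /andP[x0 x1]; rewrite subr0 /parabola ger0_norm; last first.
  by rewrite mulr_ge0 ?sqr_ge0// divr_ge0.
have : x ^+ 2 <= 1 by rewrite expr_le1.
have := sqr_ge0 x; nra.
Qed.

(** The parabola of curvature [t] over [0, 1/t], continued by its tangent, has gain 1 and [z]-value
    [zeta t / t] on [0, 1]. As [t] grows it tends to the kink [U], which is linear on [0, 1] and has
    value 0. *)
Lemma zeta_sublinear e : 0 < e -> exists2 K, 0 < K &
  forall t, K <= t -> zeta t <= e * t.
Proof.
move=> e0; pose U x : R := if x <= 0 then 0 else x.
have Uf : subgradient U (fun x => if x <= 0 then 0 else 1).
  by move=> x y; rewrite /U; case: (leP x 0) => h; case: (leP y 0) => h'; lra.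
have cU : convex1 U by exists (fun x => if x <= 0 then 0 else 1).
have [del del0 usc] := z_usc zP 1 cU ler01 e0.
have zU : z U 0 1 = 0.
  rewrite -[RHS](z_cst0 zP (@ler01 R)) -[RHS](z_affine zP 0 1 (@convex1_cst0 R) ler01).
  apply: (z_eq zP) => x /andP[x0 _]; rewrite /U; case: (leP x 0) => h; last by ring.
  have -> : x = 0 by lra.
  by ring.
rewrite zU add0r in usc.
exists (Num.max 1 del^-1); first by rewrite lt_max ltr01.
move=> t; rewrite ge_max => /andP[t1 td].
have t0 : 0 < t by lra.
pose l := t^-1.
have l0 : 0 < l by rewrite invr_gt0.
have l1 : l <= 1 by rewrite invf_le1.
have ld : l <= del by rewrite /l invf_ple.
have tl : t * l = 1 by rewrite divff// gt_eqF.
pose p := arc_profile (parabola t) (fun x => t * x) 0 0 l 1.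
have pP : is_profile p.
  apply: arc_profileP; [exact/parabola_sub/ltW|exact: ltW|exact: ler01| |] => y.
    by have := parabola_sub (ltW t0) 0 y; rewrite mulr0.
  by have := parabola_sub (ltW t0) l y; rewrite tl.
have := usc (pfun p) (pder p) (pder_sub pP).
have cp : convex1 (pfun p) by exists (pder p); exact: pder_sub.
have -> : z (pfun p) 0 1 = zeta t * l.
  rewrite (z_split zP cp (ltW l0) l1).
  have -> : z (pfun p) l 1 = 0.
    rewrite -[RHS](z_cst0 zP l1) -[RHS](z_affine zP (pfun p l - l) 1 (@convex1_cst0 R) l1).
    apply: (z_eq zP) => x /andP[lx _]; rewrite (pfun_len pP) /=; last by rewrite subr0.
    by rewrite !subr0; ring.
  rewrite addr0 -[l in RHS]subr0 -(z_parabola zP) ?(ltW t0) ?(ltW l0)//.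
  apply: (z_eq zP) => x /andP[x0 xl] /=; rewrite subr0 xl /parabola.
  case: (leP x 0) => h; last by ring.
  have -> : x = 0 by lra.
  by ring.
move=> H; have : zeta t * l <= e.
  apply: H => x /andP[x0 x1].
    have := pder_le pP x; have := pder_ge0 pP x; rewrite /p /= => h1 h2.
    by rewrite ger0_norm//; lra.
  have h1 := pfun_le pP x0; have h2 := pfun_ge0 x pP.
  have pg : pgain p = 1 by rewrite /= subr0.
  have pl : plen p = l by rewrite /= subr0.
  have -> : U x = x.
    rewrite /U; case: (leP x 0) => h //; lra.
  have := pder_sub pP l x; rewrite (pder_len pP) ?pl// pg.
  have h4 := pfun_ge0 l pP; rewrite pg in h1.
  by move=> h5; rewrite ler_norml; lra.
by rewrite -ler_pdivlMr ?invr_gt0// /l invrK.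
Qed.

End jensen.

(** * Concave sublinear functions on the half-line *)

Section conc.
Context {R : realType}.
Implicit Types (zeta : R -> R) (s t l e K : R).

Record conc_fun zeta : Prop := {
  conc_ge0 : forall t, 0 <= t -> 0 <= zeta t;
  conc_concave : forall t s l, 0 <= t -> 0 <= s -> 0 <= l <= 1 ->
    l * zeta t + (1 - l) * zeta s <= zeta (l * t + (1 - l) * s);
  conc_small : forall e, 0 < e -> exists2 del, 0 < del &
    forall t, 0 <= t <= del -> zeta t <= e;
  conc_sublinear : forall e, 0 < e -> exists2 K, 0 < K &
    forall t, K <= t -> zeta t <= e * t }.

Context zeta (zP : conc_fun zeta).

Lemma conc0 : zeta 0 = 0.
Proof.
apply/eqP; rewrite eq_le (conc_ge0 zP)// andbT.
apply/ler_addgt0Pr => e e0; have [del del0 H] := conc_small zP e0.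
by rewrite add0r H// lexx ltW.
Qed.

Lemma conc_le s t : 0 <= s -> s <= t -> zeta s <= zeta t.
Proof.
move=> s0; rewrite le_eqVlt => /predU1P[->//|st].
have t0 : 0 <= t by lra.
rewrite -subr_le0; apply: (@le_archi_eq0 _ _ (zeta s)) => n.
have n0 : 0 < n.+1%:R :> R by [].
(* A far point with [t] between [s] and [T], of weight 1/(n+1) on [T]: as [zeta T] is nonnegative,
   the loss is at most a fraction 1/(n+1) of [zeta s]. *)
pose T := s + n.+1%:R * (t - s).
have T0 : 0 <= T by rewrite addr_ge0// mulr_ge0//; lra.
have l01 : 0 <= (n.+1%:R^-1 : R) <= 1.
  by rewrite invr_ge0 (ltW n0)/= invf_le1// ler1n.
have := conc_concave zP T0 s0 l01.
have -> : n.+1%:R^-1 * T + (1 - n.+1%:R^-1) * s = t.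
  by rewrite /T; field; rewrite addrC natr1 pnatr_eq0.
have := mulr_ge0 (proj1 (andP l01)) (conc_ge0 zP T0).
by move: (n.+1%:R^-1 : R) => r; lra.
Qed.

Lemma conc_subadd s t : 0 <= s -> 0 <= t -> zeta (s + t) <= zeta s + zeta t.
Proof.
move=> s0 t0; have [st0|st0] := eqVneq (s + t) 0.
  by rewrite st0 conc0 addr_ge0// conc_ge0.
have st : 0 < s + t by rewrite lt_neqAle eq_sym st0 addr_ge0.
pose l := s / (s + t).
have l0 : 0 <= l by rewrite divr_ge0// ltW.
have l1 : l <= 1 by rewrite ler_pdivrMr//; lra.
have hs : l * (s + t) = s by rewrite divfK.
have h1 : 0 <= l <= 1 by rewrite l0.
have h2 : 0 <= 1 - l <= 1 by apply/andP; split; lra.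
have := conc_concave zP (ltW st) (lexx 0) h1.
have := conc_concave zP (ltW st) (lexx 0) h2.
rewrite conc0 !mulr0 !addr0 hs.
have -> : (1 - l) * (s + t) = t by rewrite mulrBl hs; ring.
lra.
Qed.

(** By monotonicity and subadditivity [zeta] is its own modulus of continuity. *)
Lemma conc_dist s t : 0 <= s -> 0 <= t -> `|zeta s - zeta t| <= zeta `|s - t|.
Proof.
wlog st : s t / s <= t.
  move=> H s0 t0; have [st|/ltW ts] := leP s t; first exact: H.
  by rewrite distrC [`|s - t|]distrC; exact: H.
move=> s0 t0; rewrite ler0_norm ?subr_le0//; last exact: conc_le.
rewrite ler0_norm ?subr_le0// !opprB lerBlDl -lerBlDl.
have ts0 : 0 <= t - s by rewrite subr_ge0.
by have := conc_subadd s0 ts0; rewrite subrKC; lra.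
Qed.

Lemma conc_dist_le e : 0 < e -> exists2 del, 0 < del &
  forall s t, 0 <= s -> 0 <= t -> `|s - t| <= del -> `|zeta s - zeta t| <= e.
Proof.
move=> e0; have [del del0 H] := conc_small zP e0; exists del => // s t s0 t0 st.
by apply: le_trans (conc_dist s0 t0) _; rewrite H// normr_ge0.
Qed.

(** Splits [zeta] into a bounded part and a tail that, summed over cells, costs at most [e] times
    the total slope gain. *)
Lemma conc_affine_le e : 0 < e -> exists2 K, 0 < K &
  forall t, 0 <= t -> zeta t <= zeta (Num.min t K) + e * t.
Proof.
move=> e0; have [K K0 H] := conc_sublinear zP e0; exists K => // t t0.
have [tK|Kt] := leP t K; first by rewrite lerDl mulr_ge0// ltW.
by rewrite -[leLHS]add0r lerD ?(conc_ge0 zP (ltW K0))// H// ltW.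
Qed.

Lemma conc_jensen n (d : R) (v : nat -> R) : 0 <= d -> (forall i, 0 <= v i) ->
  \sum_(i < n.+1) d * zeta (v i) <=
  n.+1%:R * d * zeta ((\sum_(i < n.+1) v i) / n.+1%:R).
Proof.
move=> d0 v0; rewrite -mulr_sumr [_ * d]mulrC -mulrA ler_wpM2l//.
elim: n => [|n IH]; first by rewrite !big_ord1 divr1 mul1r.
rewrite big_ord_recr/= [\sum_(i < n.+2) v i]big_ord_recr/=.
set S := \sum_(i < n.+1) v i in IH *.
have S0 : 0 <= S by exact: sumr_ge0.
have -> : n.+2%:R = n.+1%:R + 1 :> R by rewrite natr1.
have : 0 < n.+1%:R :> R by [].
move: (n.+1%:R : R) IH => N IH N0.
have N1 : 0 < N + 1 by lra.
pose l := N / (N + 1).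
have h1 : 0 <= l <= 1.
  by rewrite divr_ge0 ?(ltW N0) ?(ltW N1)//= ler_pdivrMr//; lra.
have := conc_concave zP (divr_ge0 S0 (ltW N0)) (v0 n.+1) h1.
have -> : l * (S / N) + (1 - l) * v n.+1 = (S + v n.+1) / (N + 1).
  by rewrite /l; field; rewrite !gt_eqF.
have -> : l * zeta (S / N) + (1 - l) * zeta (v n.+1) =
    (N * zeta (S / N) + zeta (v n.+1)) / (N + 1).
  by rewrite /l; field; rewrite gt_eqF.
by rewrite ler_pdivrMr// [_ * (N + 1)]mulrC; apply: le_trans; rewrite lerD2r.
Qed.

End conc.

(** * Slopes of monotone functions *)

Section monotone_derivable.
Context {R : realType}.
Local Notation mu := (@lebesgue_measure R).
Implicit Types (f g : R -> R) (a b x y e del : R).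

Definition has_slope f x d := forall e, 0 < e -> exists2 del, 0 < del &
  forall y, `|y - x| < del -> `|f y - f x - d * (y - x)| <= e * `|y - x|.

Lemma derivable_has_slope f x : derivable f x 1 -> has_slope f x (derive1 f x).
Proof.
move=> fx e e0; have := fx; rewrite /derivable => /cvg_ex[l Hl].
have lE : derive1 f x = l by rewrite derive1E /derive; apply/cvg_lim.
move/cvgrPdist_le : Hl => /(_ e e0)[del /= del0 H].
exists del => // y yx; have [->|yx0] := eqVneq y x.
  by rewrite !subrr mulr0 subrr normr0 mulr0.
have h0 : y - x != 0 by rewrite subr_eq0.
have := H (y - x); rewrite /= sub0r normrN => /(_ yx h0).
rewrite lE /GRing.scale /= mulr1 subrK => h.
have -> : f y - f x - l * (y - x) = - ((y - x) * (l - (y - x)^-1 * (f y - f x))).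
  by field.
by rewrite normrN normrM mulrC ler_wpM2r.
Qed.

Lemma has_slope_ge0 f x d : {homo f : x y / x <= y} -> has_slope f x d -> 0 <= d.
Proof.
move=> fh fx; apply/ler_addgt0Pr => e e0; have [del del0 H] := fx e e0.
have d2 : 0 < del / 2 by rewrite divr_gt0.
have := H (x + del / 2); rewrite addrAC subrr add0r gtr0_norm//.
have -> : del / 2 < del by lra.
move=> /(_ isT); rewrite ler_norml => /andP[_].
have := fh x (x + del / 2); rewrite lerDl (ltW d2) => /(_ isT).
move: d2; set r := del / 2; nra.
Qed.

(* [id + f] expands distances, so that the image under it of Lebesgue measure
   has a density h <= 1; [f] has slope 1 / h - 1 at almost every point. *)
Context f a b (fh : {homo f : x y / x <= y}) (ab : a < b).
Let g x : measurableTypeR R := x + f x.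

Let gD x y : x <= y -> y - x <= g y - g x.
Proof. by move=> xy; have := fh xy; rewrite /g; lra. Qed.

Let g_homo : {homo g : x y / x <= y >-> (x <= y :> R)}.
Proof. by move=> x y xy; have := gD xy; lra. Qed.

Let mg : measurable_fun [set: measurableTypeR R] g.
Proof. exact: nondecreasing_measurable. Qed.

Let I := `[a, b]%classic : set (measurableTypeR R).
Let mI : measurable I. Proof. exact: measurable_itv. Qed.
Let muI : (mu I < +oo)%E.
Proof. by rewrite lebesgue_measure_itv/= lte_fin ab ltry. Qed.

Let nu (A : set (measurableTypeR R)) := mu (g @^-1` A `&` I).

Let mpre A : measurable A -> measurable (g @^-1` A `&` I).
Proof.
by move=> mA; apply: measurableI => //; rewrite -[_ @^-1` _]setTI; exact: mg.
Qed.

Let nu0 : nu set0 = 0%E.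
Proof. by rewrite /nu preimage_set0 set0I measure0. Qed.

Let nu_ge0 A : (0 <= nu A)%E. Proof. exact: measure_ge0. Qed.

Let nu_sigma_additive : semi_sigma_additive nu.
Proof.
move=> F mF tF mUF; rewrite /nu preimage_bigcup setI_bigcupl.
apply: measure_semi_sigma_additive.
- by move=> n; exact: mpre.
- apply/trivIsetP => /= i j _ _ ij; rewrite setIACA -preimage_setI.
  by move/trivIsetP : tF => /(_ _ _ _ _ ij) ->//; rewrite preimage_set0 set0I.
- by rewrite -setI_bigcupl -preimage_bigcup; exact: mpre.
Qed.

HB.instance Definition _ := isMeasure.Build _ _ _ nu nu0 nu_ge0 nu_sigma_additive.

Let nu_fin : fin_num_fun nu.
Proof.
move=> A mA; rewrite ge0_fin_numE//; apply: le_lt_trans muI.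
by apply: le_measure; rewrite ?inE//; exact: mpre.
Qed.

HB.instance Definition _ := Measure_isFinite.Build _ _ _ nu nu_fin.

(** Since [g] expands distances, the preimage of the interval has diameter at most [y - x] and fits
    in a segment of that length starting at its infimum. *)
Let nu_itv x y : (nu `]x, y]%classic <= mu `]x, y])%E.
Proof.
rewrite /nu; set S := _ `&` _.
have SD s t : S s -> S t -> x < y /\ s - t <= y - x.
  rewrite /S /= !in_itv/= => -[/andP[xs sy] _] [/andP[xt ty] _].
  split; first exact: lt_le_trans xs sy.
  have [st|/ltW ts] := leP s t; last by have := gD ts; lra.
  by have := g_homo st; lra.
have [[s Ss]|S0] := pselect (exists s, S s); last first.
  rewrite (_ : S = set0) ?measure0//; apply/seteqP; split => // s Ss.
  by apply: S0; exists s.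
have [xy _] := SD _ _ Ss Ss.
have SI : S `<=` `[inf S, inf S + (y - x)].
  move=> t St; have hS : has_inf S.
    split; first by exists s.
    by exists (s - (y - x)) => r Sr; have [_] := SD _ _ Ss Sr; lra.
  rewrite /= in_itv/= (ge_inf hS.2 St)/= -lerBlDr.
  by apply: lb_le_inf; [exists s|move=> r Sr; have [_] := SD _ _ St Sr; lra].
apply: (@le_trans _ _ (mu `[inf S, inf S + (y - x)])).
  by apply: le_measure; rewrite ?inE//; exact: mpre.
rewrite !lebesgue_measure_itv/= !lte_fin xy ltrDl subr_gt0 xy -!EFinB lee_fin.
by lra.
Qed.

(** A null set is covered by half-open intervals of small total length, and [nu] of each is at most
    its length. *)
Let nu_dom A : measurable A -> mu A = 0%E -> nu A = 0%E.
Proof.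
move=> mA A0; apply/eqP; rewrite eq_le nu_ge0 andbT.
apply/lee_addgt0Pr => e e0; rewrite add0e.
have /ereal_inf_lt[z [/= M covAM sMz zDe]] : (mu A < e%:E)%E.
  by rewrite A0 lte_fin.
have mM k : measurable (M k : set (measurableTypeR R)).
  by apply: sub_sigma_algebra; exact: covAM.1.
have nuM k : (nu (M k) <= wlength idfun (M k))%E.
  have /ocitvP[->|[[x y] /= xy ->]] := covAM.1 k.
    by rewrite nu0.
  apply: le_trans (nu_itv x y) _.
  by rewrite lebesgue_measure_itv/= lte_fin xy wlength_itv_bnd// ltW.
apply: (@le_trans _ _ (\sum_(0 <= k <oo) nu (M k))%E).
  by apply: measure_sigma_subadditive => //; exact: covAM.2.
apply: le_trans (ltW zDe); rewrite -sMz.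
by apply: lee_nneseries => [k _|k _].
Qed.

Let nu_dominated : nu `<< mu.
Proof. by apply/null_content_dominatesP => A mA; exact: nu_dom. Qed.

Let density : exists h : R -> R, [/\ forall x, 0 <= h x,
  mu.-integrable [set: R] (EFin \o h) &
  forall A, measurable A -> nu A = (\int[mu]_(x in A) (h x)%:E)%E].
Proof.
have [h [h0 hfin ih nuh]] := radon_nikodym_sigma_finite nu_dominated.
have hE : (EFin \o (fine \o h)) = h by apply/funext => x /=; rewrite fineK.
exists (fine \o h); split; first by move=> x; exact: fine_ge0.
  by rewrite hE.
by move=> A /nuh ->; apply: eq_integral => x _; rewrite /= fineK.
Qed.

Lemma monotone_has_slope_ae : exists N, [/\ measurable N, mu N = 0%E &
  forall x, a < x < b -> ~ N x -> exists2 d, 0 <= d & has_slope f x d].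
Proof.
have [h [h0 ih nuh]] := density.
have mh : measurable_fun [set: R] h by move/integrableP : ih => [/measurable_EFinP].
pose F y := fine (nu `]-oo, y]).
have FE : (fun y => Rintegral mu `]-oo, y] h) = F.
  by apply/funext => y; rewrite /Rintegral /F nuh.
have nufin (A : set (measurableTypeR R)) : measurable A -> (nu A = (fine (nu A))%:E)%E.
  by move=> mA; rewrite fineK// nu_fin.
have F_homo y y' : y <= y' -> F y <= F y'.
  move=> yy; rewrite /F fine_le// ?nu_fin//; apply: le_measure; rewrite ?inE//.
  by apply: subset_itvl; rewrite bnd_simp.
(* [F] inverts [g] up to the constant [a]; differentiating [F] at [g x] thus gives the reciprocal of
   the slope of [g]. *)
have Fg x : a <= x <= b -> F (g x) = x - a.
  move=> /andP[ax xb]; rewrite /F /nu.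
  have -> : g @^-1` `]-oo, g x] `&` I = `[a, x]%classic.
    apply/seteqP; split => t /=; rewrite !in_itv/=.
      rewrite /I /= in_itv/= => -[gt /andP[-> _]] /=; rewrite leNgt; apply/negP => xt.
      by have := gD (ltW xt); lra.
    move=> /andP[at_ tx]; split; first exact: g_homo.
    by rewrite /I /= in_itv/= at_ (le_trans tx).
  rewrite lebesgue_measure_itv/= lte_fin; case: ltP => ax'; first by rewrite -EFinB.
  by rewrite /=; lra.
have [N1 [mN1 N10 HN1]] : {ae mu, forall y, derivable F y 1 /\ derive1 F y = h y}.
  rewrite -FE; apply: FTC1Ny.
    by move=> y; apply: integrableS ih.
  apply: open_integrable_locally ih; exact: openT.
(* Where the density vanishes the slope of [f] would be infinite. This set is [nu]-null, so its
   preimage in [a, b] is Lebesgue-null. *)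
pose Z := [set y : measurableTypeR R | h y = 0].
have mZ : measurable Z.
  rewrite (_ : Z = h @^-1` [set 0])//; rewrite -[_ @^-1` _]setTI.
  exact: mh.
have Z0 : nu Z = 0%E.
  rewrite nuh//; apply: integral0_eq => y Zy; by rewrite Zy.
exists (g @^-1` (N1 `|` Z) `&` I); split.
- by apply: mpre; exact: measurableU.
- apply/eqP; rewrite eq_le measure_ge0 andbT.
  apply: (@le_trans _ _ (nu N1 + nu Z)%E); first exact: measureU2.
  by rewrite Z0 nu_dom// adde0.
move=> x /andP[ax xb] Nx.
have [Fd Fh hx] : [/\ derivable F (g x) 1, derive1 F (g x) = h (g x) & 0 < h (g x)].
  have {}Nx : ~ (N1 `|` Z) (g x).
    by move=> H; apply: Nx; split => //; rewrite /I /= in_itv/= (ltW ax) ltW.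
  have [Nx1|] := pselect (N1 (g x)); first by exfalso; apply: Nx; left.
  move=> /(contra_not (HN1 (g x))); rewrite notK => -[? ?]; split => //.
  rewrite lt_neqAle h0 andbT eq_sym; apply/eqP => hz.
  by apply: Nx; right.
have := derivable_has_slope Fd; rewrite Fh; set c := h (g x) in hx * => {Fd Fh} Fs.
suff fs : has_slope f x (c^-1 - 1) by exists (c^-1 - 1) => //; exact: has_slope_ge0 fs.
(* The bound [c / 2] yields [c * |g y - g x| <= 2 * |y - x|]; the bound [e * c ^+ 2 / 2] then leaves
   an error [e * |y - x|] after division by [c]. *)
move=> e e0; pose e' := Num.min (c / 2) (e * c ^+ 2 / 2).
have e'0 : 0 < e' by rewrite lt_min !divr_gt0// mulr_gt0// exprn_gt0.
have e'c : e' <= c / 2 by rewrite ge_min lexx.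
have e'e : e' <= e * c ^+ 2 / 2 by rewrite ge_min lexx orbT.
have [del del0 Hdel] := Fs _ e'0.
exists (Num.min (Num.min (x - a) (b - x)) (c * del / 4)).
  by rewrite !lt_min !subr_gt0 ax xb divr_gt0// mulr_gt0.
move=> y; rewrite !lt_min -andbA => /and3P[yxa ybx yxc].
have ay : a <= y by move: yxa; rewrite ltr_norml => /andP[]; lra.
have yb : y <= b by move: ybx; rewrite ltr_norml => /andP[]; lra.
have Fy : F (g y) - F (g x) = y - x.
  by rewrite !Fg ?ay ?yb ?(ltW ax) ?(ltW xb)//; ring.
have d20 : 0 < del / 2 by rewrite divr_gt0.
(* Continuity of [g] at [x] has to be derived: over a distance [del / 2] from [g x] the function [F]
   moves by at least [c * del / 4], whereas [F (g y) - F (g x)] is only [y - x]. *)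
have d2 : `|g y - g x| < del.
  rewrite ltr_norml; apply/andP; split; rewrite ltNge; apply/negP => h1.
    have := Hdel (g x - del / 2); rewrite addrAC subrr add0r normrN gtr0_norm//.
    have -> : del / 2 < del by lra.
    move=> /(_ isT); rewrite ler_norml => /andP[k1 k2].
    have := F_homo (g y) (g x - del / 2).
    have -> : g y <= g x - del / 2 by lra.
    move: yxc; rewrite ltr_norml => /andP[k3 k4] /(_ isT).
    by nra.
  have := Hdel (g x + del / 2); rewrite addrAC subrr add0r gtr0_norm//.
  have -> : del / 2 < del by lra.
  move=> /(_ isT); rewrite ler_norml => /andP[k1 k2].
  have := F_homo (g x + del / 2) (g y).
  have -> : g x + del / 2 <= g y by lra.
  move: yxc; rewrite ltr_norml => /andP[k3 k4] /(_ isT).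
  by nra.
have := Hdel _ d2; rewrite Fy.
have -> : f y - f x - (c^-1 - 1) * (y - x) = - c^-1 * (y - x - c * (g y - g x)).
  by rewrite /g; field; rewrite gt_eqF.
set G := g y - g x; set D := y - x => h1.
have h2 : c * `|G| <= 2 * `|D|.
  have : c * `|G| <= `|D| + e' * `|G|.
    rewrite -{1}(gtr0_norm hx) -normrM.
    have -> : c * G = D - (D - c * G) by ring.
    by apply: le_trans (ler_normB _ _) _; rewrite lerD2l.
  by have := normr_ge0 G; nra.
have -> : `|- c^-1 * (D - c * G)| = `|D - c * G| / c.
  by rewrite mulNr normrN normrM [X in X * _]gtr0_norm ?invr_gt0 1?mulrC.
rewrite ler_pdivrMr//.
apply: le_trans h1 _; apply: (@le_trans _ _ (e * c ^+ 2 / 2 * `|G|)).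
  by rewrite ler_wpM2r.
have -> : e * c ^+ 2 / 2 * `|G| = e * c / 2 * (c * `|G|) by ring.
have -> : e * `|D| * c = e * c / 2 * (2 * `|D|) by field.
by rewrite ler_wpM2l// divr_ge0// mulr_ge0// ltW.
Qed.

End monotone_derivable.

(** * Limits of Riemann sums *)

Section limn.
Context {R : realType}.
Local Open Scope ereal_scope.
Implicit Types (u : nat -> \bar R) (l : \bar R).

Lemma limn_esup_lt u l : limn_esup u < l -> \forall n \near \oo, u n < l.
Proof.
move=> /ereal_inf_lt[_ [V Voo <-]] Vl; apply: filterS Voo => n Vn.
by apply: le_lt_trans Vl; apply: ereal_sup_ubound; exists n.
Qed.

Lemma limn_esup_le u l : (\forall n \near \oo, u n <= l) -> limn_esup u <= l.
Proof.
move=> ul; apply: le_trans (_ : ereal_sup (u @` [set n | u n <= l]) <= l).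
  by apply: ereal_inf_lbound; exists [set n | u n <= l].
by apply: ge_ereal_sup => _ [n /= un <-].
Qed.

Lemma limn_einf_gt u l : l < limn_einf u -> \forall n \near \oo, l < u n.
Proof.
rewrite /limn_einf lteNr => /limn_esup_lt; apply: filterS => n.
by rewrite lteNl oppeK.
Qed.

Lemma limn_einf_ge u l : (\forall n \near \oo, l <= u n) -> l <= limn_einf u.
Proof.
move=> lu; rewrite /limn_einf leeNr; apply: limn_esup_le.
by apply: filterS lu => n; rewrite leeN2.
Qed.

End limn.

Section integrals.
Context {R : realType}.
Local Notation mu := (@lebesgue_measure R).
Implicit Types (E N : set R).
Import HBNNSimple.

(** Serves integrands whose measurability is known only off a null set. The integral is a supremum
    over simple functions, and multiplying one by the indicator of the complement of [N] keeps its
    integral. *)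
Lemma integral_off_null E N (h : R -> \bar R) :
  measurable N -> mu N = 0%E -> (forall x, E x -> (0 <= h x)%E) ->
  (\int[mu]_(x in E) h x = \int[mu]_(x in E `\` N) h x)%E.
Proof.
move=> mN N0 h0; rewrite !ge0_integralE//; last by move=> x [/h0].
apply/eqP; rewrite eq_le; apply/andP; split; last first.
  apply: le_ereal_sup => _ [k kh <-]; exists k => //= x; apply: le_trans (kh x) _.
  rewrite /patch; case: ifPn => [|_]; first by rewrite inE => -[Ex _]; rewrite mem_set.
  by case: ifPn => //; rewrite inE => /h0.
apply: ge_ereal_sup => _ [k kh <-].
have mNC : measurable (~` N) by exact: measurableC.
apply: ereal_sup_ubound; exists (proj_nnsfun k mNC) => /=.
  move=> x; rewrite mindicE; have := kh x; rewrite /patch.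
  have [Nx|Nx] := pselect (N x).
    rewrite [x \in ~` N]memNset ?mulr0; last by move=> /(_ Nx).
    by rewrite [x \in _ `\` _]memNset//; move=> [_ /(_ Nx)].
  rewrite [x \in ~` N]mem_set// mulr1.
  have -> // : (x \in E `\` N) = (x \in E).
  by apply/idP/idP; rewrite !inE => // -[].
rewrite -[RHS]integralT_nnsfun -(integralT_nnsfun _ (proj_nnsfun k mNC)).
apply: ge0_ae_eq_integral => //.
- by apply/measurable_EFinP; exact: measurable_funPT.
- by apply/measurable_EFinP; exact: measurable_funPT.
- by move=> x _; rewrite lee_fin.
- by move=> x _; rewrite lee_fin.
exists N; split => // x /= /not_implyP[_ kx]; apply: contrapT => Nx; apply: kx.
by rewrite /= mindicE mem_set// mulr1.
Qed.

Lemma integral_step (G : R -> R) (w : nat -> R) (a d : R) : 0 < d ->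
  (forall i, 0 <= w i) ->
  (forall i x, a + i%:R * d <= x < a + i.+1%:R * d -> G x = w i) ->
  forall k, measurable_fun `[a, a + k%:R * d[ G /\
   (\int[mu]_(x in `[a, (a + k%:R * d)%R[) (G x)%:E = (\sum_(i < k) d * w i)%R%:E)%E.
Proof.
move=> d0 w0 Gw; elim=> [|k [mG IH]].
  rewrite mul0r addr0 set_itvco0; split; first exact: measurable_fun_set0.
  by rewrite integral_set0 big_ord0.
set x := a + k%:R * d; set y := a + k.+1%:R * d.
have xy : x < y by rewrite /x /y ltrD2l ltr_pM2r// ltr_nat.
have ax : a <= x by rewrite lerDl mulr_ge0// ltW.
have eG : {in `[x, y[%classic, cst (w k) =1 G}.
  by move=> t; rewrite inE /= in_itv/= => /Gw ->.
have mGk : measurable_fun `[x, y[ G.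
  exact: eq_measurable_fun eG (measurable_cst _).
have -> : `[a, y[%classic = `[a, x[ `|` `[x, y[.
  by rewrite -itv_bndbnd_setU// bnd_simp// ltW.
have mGU : measurable_fun (`[a, x[ `|` `[x, y[) G by apply/measurable_funU.
have Gpos t : a <= t -> 0 <= G t.
  move=> at_; have t0 : 0 <= (t - a) / d by rewrite divr_ge0 ?subr_ge0// ltW.
  have /andP[h1 h2] := Num.Theory.truncn_itv t0.
  rewrite (Gw (Num.truncn ((t - a) / d)))//.
  by move: h1 h2; rewrite ler_pdivlMr// ltr_pdivrMr// => h1 h2; apply/andP; split; lra.
split => //; rewrite ge0_integral_setU//=.
- rewrite IH big_ord_recr/= EFinD; congr (_ + _)%E.
  rewrite (eq_integral (cst (w k)%:E)); last by move=> t /eG <-.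
  rewrite integral_cst//= lebesgue_measure_itv/= lte_fin xy -EFinB -EFinM mulrC.
  by congr ((_ * _)%:E); rewrite /x /y -natr1; ring.
- exact/measurable_EFinP.
- by move=> t []; rewrite in_itv/= => /andP[h1 _]; rewrite lee_fin Gpos// (le_trans ax).
- apply/disj_setPS => t /=; rewrite !in_itv/= => -[/andP[_ h1] /andP[h2 _]].
  by move: h1; rewrite ltNge h2.
Qed.
End integrals.

Section riemann.
Context {R : realType} (zeta : R -> R) (zP : conc_fun zeta).
Local Notation mu := (@lebesgue_measure R).
Context (a b C : R) (ab : a < b) (v : nat -> nat -> R) (D : R -> R).
Context (N : set (measurableTypeR R)) (mN : measurable N) (N0 : mu N = 0%E).
Let d n := (b - a) / n.+1%:R.
Context (v0 : forall n i, 0 <= v n i) (D0 : forall x, 0 <= D x).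
Context (vC : forall n, \sum_(i < n.+1) d n * v n i <= C).
Context (vD : forall x e : R, a < x < b -> ~ N x -> 0 < e -> exists M : nat,
  forall n i, (M <= n)%N -> a + i%:R * d n <= x < a + i.+1%:R * d n ->
  `|v n i - D x| <= e).

Let d_gt0 n : 0 < d n. Proof. by rewrite divr_gt0// subr_gt0. Qed.

Let dn n : a + n.+1%:R * d n = b.
Proof. by rewrite /d mulrC divfK ?pnatr_eq0// subrKC. Qed.

Let idx n x := Num.truncn ((x - a) / d n).

Let idxP n x : a <= x -> a + (idx n x)%:R * d n <= x < a + (idx n x).+1%:R * d n.
Proof.
move=> ax; have t0 : 0 <= (x - a) / d n by rewrite divr_ge0 ?subr_ge0// ltW.
have /andP[] := Num.Theory.truncn_itv t0; rewrite -/(idx n x).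
by rewrite ler_pdivlMr// ltr_pdivrMr// => h1 h2; apply/andP; split; lra.
Qed.

Let idx_eq n i x : a + i%:R * d n <= x < a + i.+1%:R * d n -> idx n x = i.
Proof.
move=> /andP[h1 h2]; apply/Num.Theory.truncn_def.
rewrite ler_pdivlMr// ltr_pdivrMr//; apply/andP; split; lra.
Qed.

Let G n x := v n (idx n x).
Let W := `[a, b] `\` (N `|` [set a; b]).

Let mNab : measurable (N `|` [set a; b] : set (measurableTypeR R)).
Proof. by apply: measurableU => //; apply: measurableU. Qed.

Let Nab0 : mu (N `|` [set a; b]) = 0%E.
Proof.
apply/eqP; rewrite eq_le measure_ge0 andbT.
apply: (@le_trans _ _ (mu N + (mu [set a] + mu [set b]))%E).
  apply: le_trans (measureU2 _ _ _) _ => //; first exact: measurableU.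
  by rewrite leeD2l//; exact: measureU2.
by rewrite N0 !lebesgue_measure_set1 !adde0.
Qed.

Let mW : measurable W. Proof. by apply: measurableD => //; exact: measurable_itv. Qed.

Let WE : W = `[a, b[ `\` (N `|` [set a; b]).
Proof.
apply/seteqP; split => x [] /=; rewrite !in_itv/= => /andP[ax xb] xN; split => //.
  rewrite ax/= lt_neqAle xb andbT; apply/eqP => xb'; apply: xN.
  by right; right.
by rewrite /= in_itv/= ax ltW.
Qed.

Let W_ab x : W x -> a < x < b /\ ~ N x.
Proof.
case=> /=; rewrite in_itv/= => /andP[ax xb] xN; split; last by move=> ?; apply: xN; left.
rewrite !lt_neqAle ax xb !andbT; apply/andP; split; apply/eqP => h; apply: xN; right.
  by left.
by right.
Qed.

Let step_integral (F : R -> R) n : (forall t, 0 <= t -> 0 <= F t) ->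
  measurable_fun W (F \o G n) /\
  (\int[mu]_(x in W) (F (G n x))%:E = (\sum_(i < n.+1) d n * F (v n i))%:E)%E.
Proof.
move=> F0.
have [i x /idx_eq xi|] := @integral_step R (F \o G n) (F \o v n) a (d n) (d_gt0 n)
   (fun i => F0 _ (v0 n i)) _ n.+1; first by rewrite /G /= xi.
rewrite dn => mF <-; split.
  by apply: measurable_funS mF; [exact: measurable_itv|rewrite WE; exact: subDsetl].
rewrite WE -(integral_off_null mNab Nab0)// => x _.
by rewrite lee_fin; apply: F0; exact: v0.
Qed.

Let G_cvg x : W x -> G n x @[n --> \oo] --> D x.
Proof.
move=> /W_ab[axb xN]; apply/cvgrPdist_le => e e0.
have [M HM] := vD axb xN e0; exists M => // n /= Mn.
by rewrite distrC; apply: HM => //; apply/idxP/ltW; case/andP: axb.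
Qed.

Let mG n : measurable_fun W (G n).
Proof. exact: (step_integral n (F := id) (fun t h => h)).1. Qed.

Let mD : measurable_fun W D.
Proof.
apply/measurable_EFinP; apply: (emeasurable_fun_cvg (fun n => EFin \o G n)) => [n|x Wx].
  exact/measurable_EFinP.
by apply: cvg_EFin; [exact: nearW|exact: G_cvg].
Qed.

(** Outside a null set [D] is a pointwise limit of step functions. *)
Lemma riemann_limit_measurable : exists N', [/\ measurable N', mu N' = 0%E,
  measurable_fun (`[a, b] `\` N') D &
  forall x, a <= x <= b -> ~ N' x -> a < x < b /\ ~ N x].
Proof.
exists (N `|` [set a; b]); split => // x axb xN.
by apply: W_ab; split => //; rewrite /= in_itv.
Qed.

(** Fatou's lemma gives the lower bound. Dominated convergence applies only to [zeta (min t K)]; the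
    tail left over is at most [e * C], by sublinearity and the bound [C] on the total gain. *)
Lemma riemann_integral_cvg :
  exists J, (\int[mu]_(x in `[a, b]) (zeta (D x))%:E = J%:E)%E /\
  forall e : R, 0 < e -> exists M : nat, forall n, (M <= n)%N ->
    `|\sum_(i < n.+1) d n * zeta (v n i) - J| <= e.
Proof.
rewrite (integral_off_null mNab Nab0); last by move=> x _; rewrite lee_fin (conc_ge0 zP).
rewrite -/W; set I := (\int[mu]_(x in W) _)%E.
pose S n := \sum_(i < n.+1) d n * zeta (v n i).
have SE n : (\int[mu]_(x in W) (zeta (G n x))%:E = (S n)%:E)%E.
  exact: (step_integral n (conc_ge0 zP)).2.
have mzG n : measurable_fun W (fun x => (zeta (G n x))%:E).
  by apply/measurable_EFinP; exact: (step_integral n (conc_ge0 zP)).1.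
have zG0 n x : W x -> (0 <= (zeta (G n x))%:E)%E.
  by move=> _; rewrite lee_fin; apply: (conc_ge0 zP); exact: v0.
have zG_cvg x : W x -> zeta (G n x) @[n --> \oo] --> zeta (D x).
  move=> Wx; apply/cvgrPdist_le => e e0.
  have [del del0 H] := conc_dist_le zP e0.
  have /cvgrPdist_le/(_ _ del0) := G_cvg Wx; apply: filterS => n.
  by apply: H; [exact: D0|exact: v0].
have mzD : measurable_fun W (EFin \o (zeta \o D)).
  apply: (emeasurable_fun_cvg (fun n x => (zeta (G n x))%:E)) => // x Wx.
  by apply: cvg_EFin; [exact: nearW|exact: zG_cvg].
have I0 : (0 <= I)%E by apply: integral_ge0 => x _; rewrite lee_fin (conc_ge0 zP).
have fatouI : (I <= limn_einf (fun n => (S n)%:E))%E.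
  have := @fatou _ _ _ mu W mW (fun n x => (zeta (G n x))%:E) mzG zG0.
  under [X in (_ <= limn_einf X)%E]eq_fun do rewrite SE.
  apply: le_trans; rewrite le_eqVlt; apply/orP; left; apply/eqP.
  apply: eq_integral => x; rewrite inE => Wx.
  apply/esym/(cvg_limn_einf_sup _).1; apply: cvg_EFin; [exact: nearW|exact: zG_cvg].
have upper e : 0 < e -> exists2 T : nat -> R, (forall n, S n <= T n + e * C) &
    (limn_esup (fun n => (T n)%:E) <= I)%E /\
    exists B, forall n, T n <= B.
  move=> e0; have [K K0 HK] := conc_affine_le zP e0.
  pose F t := zeta (Num.min t K).
  have min0 t : 0 <= t -> 0 <= Num.min t K by move=> t0; rewrite le_min t0 ltW.
  have F0 t : 0 <= t -> 0 <= F t by move=> t0; rewrite (conc_ge0 zP)// min0.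
  have FK t : 0 <= t -> F t <= zeta K.
    by move=> t0; apply: (conc_le zP); rewrite ?min0// ge_min lexx orbT.
  exists (fun n => \sum_(i < n.+1) d n * F (v n i)).
    move=> n; apply: (@le_trans _ _ (\sum_(i < n.+1) d n * F (v n i) +
        e * \sum_(i < n.+1) d n * v n i)).
      rewrite mulr_sumr -big_split/=; apply: ler_sum => i _.
      by rewrite mulrCA -mulrDr ler_wpM2l ?HK// ltW.
    by rewrite lerD2l ler_wpM2l ?vC// ltW.
  split; last first.
    exists ((b - a) * zeta K) => n.
    apply: (@le_trans _ _ (\sum_(i < n.+1) d n * zeta K)).
      by apply: ler_sum => i _; rewrite ler_wpM2l ?FK// ltW.
    rewrite sumr_const card_ord -mulr_natl mulrA.
    by rewrite [_ * d n](_ : _ = b - a)//; have := dn n; lra.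
  have FE n : (\int[mu]_(x in W) (F (G n x))%:E = (\sum_(i < n.+1) d n * F (v n i))%:E)%E.
    exact: (step_integral n F0).2.
  have mFG n : measurable_fun W (fun x => (F (G n x))%:E).
    by apply/measurable_EFinP; exact: (step_integral n F0).1.
  have FG_cvg x : W x -> (F (G n x))%:E @[n --> \oo] --> (F (D x))%:E.
    move=> Wx; apply: cvg_EFin; first exact: nearW.
    apply/cvgrPdist_le => e' e'0.
    have [del del0 H] := conc_dist_le zP e'0.
    have /cvgrPdist_le/(_ _ del0) := G_cvg Wx; apply: filterS => n GD.
    apply: H; [exact/min0/D0|exact/min0/v0|apply: le_trans GD].
    rewrite /Num.min; case: ltP => h1; case: ltP => h2 //.
    - by rewrite !ler0_norm; lra.
    - by rewrite !ger0_norm; lra.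
    - by rewrite subrr normr0.
  have mFD : measurable_fun W (EFin \o (F \o D)).
    apply: (emeasurable_fun_cvg (fun n x => (F (G n x))%:E)).
    - exact: mFG.
    - exact: FG_cvg.
  have zK0 := conc_ge0 zP (ltW K0).
  have icst : mu.-integrable W (cst (zeta K)%:E).
    apply/integrableP; split; first exact: measurable_cst.
    rewrite (eq_integral (cst (zeta K)%:E)); last first.
      by move=> x _ /=; rewrite ger0_norm.
    rewrite integral_cst// lte_mul_pinfty ?lee_fin//.
    apply: (@le_lt_trans _ _ (mu `[a, b])).
      by apply: le_measure; rewrite ?inE//; exact: subDsetl.
    by rewrite lebesgue_measure_itv/= lte_fin ab -EFinB ltry.
  have dom : {ae mu, forall x n, W x -> (`|(F (G n x))%:E| <= cst (zeta K)%:E x)%E}.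
    apply: aeW => x n Wx; rewrite gee0_abs ?lee_fin; first by apply: FK; exact: v0.
    by apply: F0; exact: v0.
  have FGae : {ae mu, forall x, W x -> (F (G n x))%:E @[n --> \oo] --> (F (D x))%:E}.
    by apply: aeW => x; exact: FG_cvg.
  have [_ _] := @dominated_convergence _ _ _ mu W mW (fun n x => (F (G n x))%:E)
    (fun x => (F (D x))%:E) (cst (zeta K)%:E) mFG mFD FGae icst dom.
  move=> /cvg_limn_einf_sup[_]; under [X in limn_esup X]eq_fun do rewrite FE.
  move=> ->; apply: ge0_le_integral => //.
  - by move=> x Wx; rewrite lee_fin; exact/F0/D0.
  - move=> x Wx; rewrite lee_fin; apply: (conc_le zP); first exact/min0/D0.
    by rewrite ge_min lexx.
(* With e = 1 the sums [S n] are at most [B + C], and Fatou's lemma carries this bound to [I]. *)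
have Ifin : I \is a fin_num.
  have [T ST [_ [B TB]]] := upper _ ltr01.
  rewrite ge0_fin_numE//; apply: le_lt_trans fatouI _.
  apply: (@le_lt_trans _ _ (B + C)%:E); last exact: ltry.
  apply: le_trans (limn_einf_sup _) _; apply: limn_esup_le; apply: nearW => n.
  by rewrite lee_fin (le_trans (ST n))// mul1r lerD2r.
exists (fine I); rewrite fineK//; split => // e e0.
have e20 : 0 < e / 2 by rewrite divr_gt0.
have lower : ((fine I - e)%:E < limn_einf (fun n => (S n)%:E))%E.
  by apply: lt_le_trans fatouI; rewrite -[ltRHS]fineK// lte_fin; lra.
pose e' := e / 2 / (`|C| + 1).
have C1 : 0 < `|C| + 1 by rewrite ltr_wpDl.
have e'0 : 0 < e' by rewrite divr_gt0.
have [T ST [TI _]] := upper _ e'0.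
have TI' : (limn_esup (fun n => (T n)%:E) < (fine I + e / 2)%:E)%E.
  by apply: le_lt_trans TI _; rewrite -[ltLHS]fineK// lte_fin; lra.
have [M1 _ H1] := limn_einf_gt lower; have [M2 _ H2] := limn_esup_lt TI'.
exists (maxn M1 M2) => n; rewrite geq_max => /andP[M1n M2n].
have := H1 _ M1n; have := H2 _ M2n; rewrite !lte_fin => h2 h1.
have h3 : e' * C <= e / 2.
  apply: (@le_trans _ _ (e' * (`|C| + 1))).
    by rewrite ler_wpM2l ?(ltW e'0)// (le_trans (ler_norm _))// lerDl.
  by rewrite /e' divfK// gt_eqF.
by have := ST n; rewrite ler_norml -/(S n); lra.
Qed.

End riemann.

(** * Second derivatives *)

Section second_derivative.
Context {R : realType}.
Local Notation mu := (@lebesgue_measure R).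
Implicit Types (u : R -> \bar R) (U f : R -> R) (a b x p q e : R).

Lemma taylor2P u x p q : taylor2 u x p q <-> (dom u)° x /\
  forall e, 0 < e -> exists2 del, 0 < del & forall h, `|h| < del ->
    `|fine (u (x + h)) - fine (u x) - p * h - q / 2 * h ^+ 2| <= e * h ^+ 2.
Proof.
split=> -[ux H]; split => //.
  move=> e e0; move/cvgrPdist_le : H => /(_ e e0)[del /= del0 H].
  exists del => // h hdel; have [->|h0] := eqVneq h 0.
    by rewrite addr0 !mulr0 expr0n/= !mulr0 !subr0 subrr normr0.
  have := H h; rewrite /= sub0r normrN => /(_ hdel h0).
  rewrite sub0r normrN normrM normfV [`|h ^+ 2|]ger0_norm ?sqr_ge0//.
  by rewrite ler_pdivrMr// lt_neqAle sqr_ge0 andbT eq_sym sqrf_eq0.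
apply/cvgrPdist_le => e e0; have [del del0 {}H] := H e e0.
exists del => //= h hdel h0; rewrite /ball_/= sub0r normrN in hdel.
rewrite sub0r normrN normrM normfV [`|h ^+ 2|]ger0_norm ?sqr_ge0//.
rewrite ler_pdivrMr; first exact: H.
by rewrite lt_neqAle sqr_ge0 andbT eq_sym sqrf_eq0.
Qed.

(* The coefficients of an expansion are determined by its values on any set
   that clusters at 0. *)
Lemma expansion_eq0 (A : set R) (c p q : R) :
  (forall del, 0 < del -> exists2 h, A h & 0 < `|h| < del) ->
  (forall e, 0 < e -> exists2 del, 0 < del & forall h, A h -> `|h| < del ->
    `|c + p * h + q * h ^+ 2| <= e * h ^+ 2) ->
  [/\ c = 0, p = 0 & q = 0].
Proof.
move=> HA H; have [del1 del10 H1] := H 1 ltr01.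
pose B := `|p| + `|q| + 1.
have B0 : 0 < B by rewrite ltr_wpDl// addr_ge0.
have sq (h : R) : h ^+ 2 = `|h| ^+ 2 by rewrite real_normK ?num_real.
have c0 : c = 0.
  apply/eqP; rewrite -normr_le0 leNgt; apply/negP => c0.
  pose del := Num.min (Num.min del1 1) (`|c| / B).
  have del0 : 0 < del by rewrite !lt_min del10 ltr01 divr_gt0.
  have [h Ah] := HA _ del0; rewrite !lt_min -!andbA => /and4P[h0 hd h1].
  rewrite ltr_pdivlMr// => hc; have := H1 h Ah hd; rewrite mul1r.
  have : `|c| <= `|c + p * h + q * h ^+ 2| + `|p| * `|h| + `|q| * `|h| ^+ 2.
    rewrite -sq -[`|q| * _](_ : `|q * h ^+ 2| = _); last first.
      by rewrite normrM [`|_ ^+ 2|]ger0_norm ?sqr_ge0.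
    rewrite -normrM.
    have -> : c = c + p * h + q * h ^+ 2 - p * h - q * h ^+ 2 by ring.
    apply: le_trans (ler_normB _ _) _; rewrite lerD2r.
    apply: le_trans (ler_normB _ _) _.
    have -> : c + p * h + q * h ^+ 2 - p * h - q * h ^+ 2 + p * h + q * h ^+ 2 =
        c + p * h + q * h ^+ 2 by ring.
    by [].
  rewrite sq; have : `|h| ^+ 2 <= `|h| by rewrite expr2 ler_piMl// ltW.
  have := normr_ge0 p; have := normr_ge0 q; rewrite /B in hc; nra.
have p0 : p = 0.
  apply/eqP; rewrite -normr_le0 leNgt; apply/negP => p0.
  pose del := Num.min del1 (`|p| / B).
  have del0 : 0 < del by rewrite !lt_min del10 divr_gt0.
  have [h Ah] := HA _ del0; rewrite !lt_min => /and3P[h0 hd].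
  rewrite ltr_pdivlMr// => hc; have := H1 h Ah hd; rewrite mul1r c0 add0r.
  have : `|p| * `|h| <= `|p * h + q * h ^+ 2| + `|q| * `|h| ^+ 2.
    rewrite -sq -[`|q| * _](_ : `|q * h ^+ 2| = _); last first.
      by rewrite normrM [`|_ ^+ 2|]ger0_norm ?sqr_ge0.
    rewrite -normrM.
    have {1}-> : p * h = p * h + q * h ^+ 2 - q * h ^+ 2 by ring.
    exact: ler_normB.
  rewrite sq; have := normr_ge0 p; have := normr_ge0 q; rewrite /B in hc; nra.
split => //; apply/eqP; rewrite -normr_le0; apply/ler_addgt0Pr => e e0.
have [del del0 He] := H e e0; have [h Ah /andP[h0 hd]] := HA _ del0.
have := He h Ah hd; rewrite c0 p0 mul0r !add0r normrM [`|_ ^+ 2|]ger0_norm ?sqr_ge0//.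
by rewrite ler_pM2r// lt_neqAle sqr_ge0 andbT eq_sym sqrf_eq0 -normr_gt0.
Qed.

Lemma taylor2_unique u x p q p' q' : taylor2 u x p q -> taylor2 u x p' q' ->
  p = p' /\ q = q'.
Proof.
move=> /taylor2P[_ H] /taylor2P[_ H'].
have [||_ ? ?] := @expansion_eq0 setT 0 (p - p') (q / 2 - q' / 2); last first.
- by split; lra.
- move=> e e0; have e2 : 0 < e / 2 by rewrite divr_gt0.
  have [d1 d10 H1] := H _ e2; have [d2 d20 H2] := H' _ e2.
  exists (Num.min d1 d2) => [|h _]; first by rewrite lt_min d10.
  rewrite lt_min => /andP[/H1 h1 /H2 h2]; move: h1 h2; rewrite !ler_norml; lra.
move=> del del0; exists (del / 2) => //.
by rewrite gtr0_norm ?divr_gt0//=; lra.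
Qed.

Lemma second_derivative_taylor2 u x p q : taylor2 u x p q ->
  second_derivative u x = q.
Proof.
move=> H; rewrite /second_derivative; apply: xget_unique; first by exists p.
by move=> q' [p' /(taylor2_unique H)[]].
Qed.

Definition segment_fun U a b x : \bar R :=
  if a <= x <= b then (U x)%:E else +oo%E.

Lemma segment_funE U a b x : a <= x <= b -> segment_fun U a b x = (U x)%:E.
Proof. by rewrite /segment_fun => ->. Qed.

Lemma dom_segment_fun U a b : dom (segment_fun U a b) = `[a, b]%classic.
Proof.
apply/seteqP; split => x; rewrite /dom /segment_fun /= in_itv/=.
  by case: ifP.
by move=> ->; exact: ltry.
Qed.

Lemma interior_segment a b x : `[a, b]%classic° x <-> a < x < b.
Proof. by rewrite interior_itv_bnd/= in_itv/=. Qed.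

Lemma has_slope_taylor2 U f a b x d : subgradient U f -> has_slope f x d ->
  a < x < b -> taylor2 (segment_fun U a b) x (f x) d.
Proof.
move=> Uf fx axb; apply/taylor2P; rewrite dom_segment_fun interior_segment; split => // e e0.
have [del del0 H] := fx _ e0; have /andP[ax xb] := axb.
exists (Num.min del (Num.min (x - a) (b - x))).
  by rewrite !lt_min del0 !subr_gt0 ax.
move=> h; rewrite !lt_min => /and3P[hd ha hb].
have h1 : a <= x + h <= b.
  by move: ha hb; rewrite !ltr_norml => /andP[? ?] /andP[? ?]; apply/andP; split; lra.
have h2 : a <= x <= b by rewrite !ltW.
rewrite !segment_funE//=.
apply: le_trans (subgradient_taylor Uf H hd) _.
by rewrite ler_wpM2r ?sqr_ge0//; lra.
Qed.

Lemma second_derivative_segment U f a b x d : subgradient U f ->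
  has_slope f x d -> a < x < b -> second_derivative (segment_fun U a b) x = d.
Proof. by move=> Uf fx axb; exact: second_derivative_taylor2 (has_slope_taylor2 Uf fx axb). Qed.

(** Adding the expansions at [h] and [- h] cancels the first-order term and leaves a symmetric
    difference of a convex function. Where no expansion exists the default value is 0. *)
Lemma second_derivative_ge0 U f a b x : subgradient U f ->
  0 <= second_derivative (segment_fun U a b) x.
Proof.
move=> Uf; rewrite /second_derivative; case: xgetP => // q _ [p /taylor2P[]].
rewrite dom_segment_fun interior_segment => /andP[ax xb] H.
apply/ler_addgt0Pr => e e0; have e20 : 0 < e / 2 by rewrite divr_gt0.
have [del del0 {}H] := H _ e20.
pose h := Num.min (del / 2) (Num.min (x - a) (b - x)).
have h0 : 0 < h by rewrite !lt_min divr_gt0//= !subr_gt0 ax.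
have hd : h < del by rewrite gt_min; apply/orP; left; lra.
have [ha hb] : h <= x - a /\ h <= b - x by rewrite !ge_min !lexx !orbT.
have := H h; have := H (- h); rewrite normrN gtr0_norm// => /(_ hd) + /(_ hd).
rewrite !segment_funE/=; try by apply/andP; split; lra.
rewrite !ler_norml => /andP[_ k1] /andP[_ k2].
have := Uf x (x + h); have := Uf x (x - h) => k3 k4.
have : 0 < h ^+ 2 by rewrite exprn_gt0.
move=> h20; rewrite sqrrN in k1; rewrite -(pmulr_lge0 _ h20); lra.
Qed.

(** The gain is taken over the cell enlarged on both sides by [theta * d / n.+1], but divided by the
    original [d]. The enlargement is of lower order than [d], so limits are unaffected. With theta =
    0 this is the difference quotient; theta = 1 leaves the room needed to compare slopes of nearby
    functions. *)
Definition widened_quotient f a b theta n i :=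
  let d := (b - a) / n.+1%:R in
  (f (a + i.+1%:R * d + theta * (d / n.+1%:R)) -
   f (a + i%:R * d - theta * (d / n.+1%:R))) / d.

Section widened_quotient.
Context f (fh : {homo f : x y / x <= y}) a b (ab : a < b).
Context (theta : R) (t0 : 0 <= theta) (t1 : theta <= 1).

Lemma widened_quotient_ge0 : forall n i, 0 <= widened_quotient f a b theta n i.
Proof.
pose d n := (b - a) / n.+1%:R; pose eta n := theta * (d n / n.+1%:R).
have d0 n : 0 < d n by rewrite divr_gt0// subr_gt0.
have n1 n : n.+1%:R^-1 <= 1 :> R by rewrite invf_le1// ler1n.
have n0 n : 0 < n.+1%:R^-1 :> R by rewrite invr_gt0.
have eta0 n : 0 <= eta n by rewrite mulr_ge0// mulr_ge0// ltW.
have etan n : eta n <= d n * n.+1%:R^-1 by rewrite ler_piMl// mulr_ge0// ltW.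
have etad n : eta n <= d n.
  by rewrite (le_trans (etan n))// ler_piMr// ltW.
pose xs n (i : nat) := a + i%:R * d n.
have xsS n i : xs n i.+1 = xs n i + d n by rewrite /xs -natr1; ring.
move=> n i; rewrite /widened_quotient -/(d n) -/(eta n) divr_ge0 ?(ltW (d0 n))//.
rewrite subr_ge0 fh// -/(xs n i) -/(xs n i.+1) xsS.
by have := eta0 n; have := d0 n; lra.
Qed.

Lemma widened_quotient_sum : forall n,
  \sum_(i < n.+1) (b - a) / n.+1%:R * widened_quotient f a b theta n i <=
  3 * (f (b + (b - a)) - f (a - (b - a))).
Proof.
pose d n := (b - a) / n.+1%:R; pose eta n := theta * (d n / n.+1%:R).
have d0 n : 0 < d n by rewrite divr_gt0// subr_gt0.
have n1 n : n.+1%:R^-1 <= 1 :> R by rewrite invf_le1// ler1n.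
have n0 n : 0 < n.+1%:R^-1 :> R by rewrite invr_gt0.
have eta0 n : 0 <= eta n by rewrite mulr_ge0// mulr_ge0// ltW.
have etan n : eta n <= d n * n.+1%:R^-1 by rewrite ler_piMl// mulr_ge0// ltW.
have etad n : eta n <= d n.
  by rewrite (le_trans (etan n))// ler_piMr// ltW.
pose xs n (i : nat) := a + i%:R * d n.
have xsS n i : xs n i.+1 = xs n i + d n by rewrite /xs -natr1; ring.
move=> n; have dn : a + n.+1%:R * d n = b.
  by rewrite /d mulrC divfK ?pnatr_eq0// subrKC.
have dba : d n <= b - a by rewrite /d ler_piMr// subr_ge0 ltW.
(* The enlargement is at most [d] on each side, so each gain is bounded by the gain over three
   consecutive cells; this is the increment of [A], which telescopes. *)
pose A x := f (x - d n) + f x + f (x + d n).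
apply: (@le_trans _ _ (\sum_(i < n.+1) (A (xs n i.+1) - A (xs n i)))).
  apply: ler_sum => i _; rewrite /widened_quotient -/(d n) -/(eta n).
  rewrite mulrC divfK ?gt_eqF// -/(xs n i) -/(xs n i.+1) /A xsS.
  have h1 : f (xs n i + d n + eta n) <= f (xs n i + d n + d n).
    by apply: fh; rewrite lerD2l.
  have h2 : f (xs n i - d n) <= f (xs n i - eta n).
    by apply: fh; rewrite lerD2l lerN2.
  by rewrite addrK; lra.
rewrite -(big_mkord xpredT (fun i => A (xs n i.+1) - A (xs n i))) telescope_sumr//.
rewrite /xs dn mul0r addr0 /A.
have dd := d0 n; have ddb := dba.
have h1 : f (b - d n) <= f (b + (b - a)) by apply: fh; lra.
have h2 : f b <= f (b + (b - a)) by apply: fh; lra.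
have h3 : f (b + d n) <= f (b + (b - a)) by apply: fh; lra.
have h4 : f (a - (b - a)) <= f (a - d n) by apply: fh; lra.
have h5 : f (a - (b - a)) <= f a by apply: fh; lra.
have h6 : f (a - (b - a)) <= f (a + d n) by apply: fh; lra.
lra.
Qed.

Lemma widened_quotient_cvg x c e : has_slope f x c -> 0 <= c -> 0 < e ->
  exists M : nat, forall n i, (M <= n)%N ->
    a + i%:R * ((b - a) / n.+1%:R) <= x < a + i.+1%:R * ((b - a) / n.+1%:R) ->
    `|widened_quotient f a b theta n i - c| <= e.
Proof.
move=> fx c0 e0.
pose d n := (b - a) / n.+1%:R; pose eta n := theta * (d n / n.+1%:R).
have d0 n : 0 < d n by rewrite divr_gt0// subr_gt0.
have n1 n : n.+1%:R^-1 <= 1 :> R by rewrite invf_le1// ler1n.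
have n0 n : 0 < n.+1%:R^-1 :> R by rewrite invr_gt0.
have eta0 n : 0 <= eta n by rewrite mulr_ge0// mulr_ge0// ltW.
have etan n : eta n <= d n * n.+1%:R^-1 by rewrite ler_piMl// mulr_ge0// ltW.
have etad n : eta n <= d n.
  by rewrite (le_trans (etan n))// ler_piMr// ltW.
pose xs n (i : nat) := a + i%:R * d n.
have xsS n i : xs n i.+1 = xs n i + d n by rewrite /xs -natr1; ring.
(* The enlarged cell has length at most [3 * d], so the slope error is at most [e / 2 * d]. [M2]
   makes the enlargement cost another [e / 2 * d], and [M1] keeps both ends within [del] of [x]. *)
have e60 : 0 < e / 6 by rewrite divr_gt0.
have [del del0 H] := fx _ e60.
have [M1 HM1] := lt_succn ((b - a) * 2 / del).
have [M2 HM2] := lt_succn (4 * c / e).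
exists (maxn M1 M2) => n i; rewrite geq_max => /andP[M1n M2n].
rewrite -/(d n) -/(xs n i) -/(xs n i.+1) => /andP[xl xr].
rewrite /widened_quotient -/(d n) -/(eta n) -/(xs n i) -/(xs n i.+1).
set l := xs n i - eta n; set r := xs n i.+1 + eta n.
have dd := d0 n; have ee0 := eta0 n; have eed := etad n.
have dn2 : d n * 2 < del.
  rewrite ltr_pdivrMr// in HM1; rewrite /d mulrAC ltr_pdivrMr//.
  by apply: lt_le_trans HM1 _; rewrite mulrC ler_wpM2l ?(ltW del0)// ler_nat.
have cn : 4 * c * n.+1%:R^-1 <= e.
  rewrite ltr_pdivrMr// in HM2; rewrite ler_pdivrMr//.
  by apply: le_trans (ltW HM2) _; rewrite mulrC ler_wpM2l ?(ltW e0)// ler_nat.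
have rl : r - l = d n + 2 * eta n by rewrite /r /l xsS; ring.
have lx : l <= x by rewrite /l; lra.
have xr' : x <= r by rewrite /r; lra.
have hl : `|l - x| < del by rewrite ler0_norm; rewrite /l xsS in xr *; lra.
have hr : `|r - x| < del by rewrite ger0_norm; rewrite /r xsS in xr *; lra.
have := H l hl; have := H r hr.
rewrite [`|r - x|]ger0_norm; last by lra.
rewrite [`|l - x|]ler0_norm; last by lra.
move=> k1 k2.
have -> : (f r - f l) / d n - c = (f r - f l - c * d n) / d n.
  by field; rewrite gt_eqF.
rewrite normrM normfV (gtr0_norm dd) ler_pdivrMr//.
have k3 : `|f r - f l - c * (r - l)| <= e / 6 * (r - l).
  by move: k1 k2; rewrite !ler_norml; lra.
have k4 : c * (2 * eta n) <= e / 2 * d n.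
  have : c * (2 * eta n) <= c * (2 * (d n * n.+1%:R^-1)).
    by rewrite ler_wpM2l// ler_wpM2l.
  have : 4 * c * n.+1%:R^-1 * d n <= e * d n by rewrite ler_wpM2r// ltW.
  by move: (n.+1%:R^-1 : R) => r0; lra.
have k5 : 0 <= c * eta n by rewrite mulr_ge0.
have k6 : e * eta n <= e * d n by rewrite ler_wpM2l// ltW.
by move: k3; rewrite rl !ler_norml; lra.
Qed.

End widened_quotient.

Lemma riemann_second_derivative (zeta : R -> R) U f a b theta :
  conc_fun zeta -> subgradient U f -> a < b -> 0 <= theta <= 1 ->
  exists J, (\int[mu]_(x in `[a, b])
      (zeta (second_derivative (segment_fun U a b) x))%:E = J%:E)%E /\
    forall e, 0 < e -> exists M : nat, forall n, (M <= n)%N ->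
      `|\sum_(i < n.+1) (b - a) / n.+1%:R *
          zeta (widened_quotient f a b theta n i) - J| <= e.
Proof.
move=> zP Uf ab /andP[t0 t1]; have fh := subgradient_homo Uf.
have [N [mN N0 HN]] := monotone_has_slope_ae fh ab.
pose D := second_derivative (segment_fun U a b).
have D0 x : 0 <= D x by exact: second_derivative_ge0 Uf.
apply: (@riemann_integral_cvg R zeta zP a b _ ab
  (widened_quotient f a b theta) D N mN N0) => //.
- exact: widened_quotient_ge0.
- exact: widened_quotient_sum.
move=> x e axb xN e0; have [c c0 fx] := HN x axb xN.
rewrite /D (second_derivative_segment Uf fx axb); exact: widened_quotient_cvg.
Qed.

Lemma ae_second_derivative U f a b : subgradient U f -> a <= b ->
  exists N, [/\ measurable N, mu N = 0%E,
    measurable_fun (`[a, b] `\` N) (second_derivative (segment_fun U a b)) &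
    forall x, a <= x <= b -> ~ N x ->
      exists p, taylor2 (segment_fun U a b) x p (second_derivative (segment_fun U a b) x)].
Proof.
move=> Uf; rewrite le_eqVlt => /predU1P[->|ab].
  exists [set b]; split => //; first by rewrite lebesgue_measure_set1.
    by rewrite set_itv1 setDv; exact: measurable_fun_set0.
  by move=> x h xb; exfalso; apply: xb => /=; lra.
have fh := subgradient_homo Uf.
have [N [mN N0 HN]] := monotone_has_slope_ae fh ab.
have cvg x e : a < x < b -> ~ N x -> 0 < e -> exists M : nat,
    forall n i, (M <= n)%N ->
    a + i%:R * ((b - a) / n.+1%:R) <= x < a + i.+1%:R * ((b - a) / n.+1%:R) ->
    `|widened_quotient f a b 0 n i - second_derivative (segment_fun U a b) x| <= e.
  move=> axb xN e0; have [c c0 fx] := HN x axb xN.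
  rewrite (second_derivative_segment Uf fx axb).
  exact: (widened_quotient_cvg ab (lexx 0) ler01).
have [N' [mN' N'0 mD H]] := riemann_limit_measurable ab mN N0
  (widened_quotient_ge0 fh ab (lexx 0) ler01) cvg.
exists N'; split => // x hx xN'; have [axb xN] := H x hx xN'.
have [c c0 fx] := HN x axb xN; rewrite (second_derivative_segment Uf fx axb).
by exists (f x); exact: has_slope_taylor2.
Qed.

End second_derivative.

(** * Elements of [Conv_ld] as restrictions to a segment *)

Section conv_ld.
Context {R : realType}.
Implicit Types (u : R -> \bar R) (U f : R -> R) (a b x y t e L : R).

Lemma dom_lipschitzP L u : dom_lipschitz L u <-> forall x y,
  (dom u)° x -> (dom u)° y -> `|fine (u x) - fine (u y)| <= L * `|x - y|.
Proof.
split=> [H x y Dx Dy|H [x y] /= [Dx Dy]]; last exact: H.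
exact: (H (x, y)).
Qed.

Lemma segment_fun_lipschitz U f a b L : subgradient U f ->
  (forall x, a <= x <= b -> `|f x| <= L) ->
  dom_lipschitz L (segment_fun U a b).
Proof.
move=> Uf fL; apply/dom_lipschitzP => x y; rewrite dom_segment_fun !interior_segment.
move=> /andP[/ltW ax /ltW xb] /andP[/ltW ay /ltW yb].
rewrite !segment_funE ?ax ?ay//=.
have := fL x; have := fL y; rewrite ax xb ay yb => /(_ isT) fy /(_ isT) fx.
have := Uf x y; have := Uf y x => h1 h2.
have k1 : f x * (x - y) <= L * `|x - y|.
  by rewrite (le_trans (ler_norm _))// normrM ler_wpM2r.
have k2 : - (f y * (x - y)) <= L * `|x - y|.
  by rewrite (le_trans (ler_norm _))// normrN normrM ler_wpM2r.
by rewrite ler_norml; lra.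
Qed.

Lemma segment_fun_Conv_ld U f a b : subgradient U f -> a <= b ->
  Conv_ld R (segment_fun U a b).
Proof.
move=> Uf ab; have fh := subgradient_homo Uf.
have nNy x : segment_fun U a b x != -oo%E by rewrite /segment_fun; case: ifP.
split; last 2 first.
- by rewrite dom_segment_fun; exact: segment_compact.
- exists (`|f a| + `|f b| + 1); first by rewrite ltr_wpDl// addr_ge0.
  apply: (segment_fun_lipschitz Uf) => x /andP[/fh fa /fh fb].
  have := ler_norm (f b); have := ler_norm (- f a); rewrite normrN.
  have := normr_ge0 (f a); have := normr_ge0 (f b).
  by rewrite ler_norml; lra.
split => //; last by exists a; rewrite segment_funE// lexx.
- move=> x y t /andP[t0 t1].
  have [->|tn0] := eqVneq t 0; first by rewrite subr0 mul0r add0r mul1r mul0e add0e mul1e.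
  have [->|tn1] := eqVneq t 1; first by rewrite subrr mul0r addr0 mul1r mul0e adde0 mul1e.
  have {t0 tn0} t0 : 0 < t by rewrite lt_neqAle eq_sym tn0.
  have {t1 tn1} t1 : 0 < 1 - t by rewrite subr_gt0 lt_neqAle tn1.
  have [hx|hx] := boolP (a <= x <= b); last first.
    rewrite [segment_fun U a b x]/segment_fun (negbTE hx) gt0_muley ?lte_fin//.
    rewrite addye ?leey// -ltNye; have := nNy y; rewrite /segment_fun; case: ifP => _ _.
      by rewrite -EFinM ltNyr.
    by rewrite gt0_muley ?lte_fin.
  have [hy|hy] := boolP (a <= y <= b); last first.
    rewrite [segment_fun U a b y]/segment_fun (negbTE hy) gt0_muley ?lte_fin//.
    by rewrite addey ?leey// -ltNye /segment_fun hx -EFinM ltNyr.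
  move: (hx) (hy) => /andP[ax xb] /andP[ay yb].
  set m := t * x + (1 - t) * y.
  have hm : a <= m <= b by rewrite /m; apply/andP; split; nra.
  rewrite !segment_funE// -!EFinM -EFinD lee_fin.
  have h1 := Uf m x; have h2 := Uf m y.
  have k1 : t * (U m + f m * (x - m)) <= t * U x by rewrite ler_wpM2l// ltW.
  have k2 : (1 - t) * (U m + f m * (y - m)) <= (1 - t) * U y by rewrite ler_wpM2l// ltW.
  have : t * (U m + f m * (x - m)) + (1 - t) * (U m + f m * (y - m)) = U m.
    by rewrite /m; ring.
  by lra.
move=> x al; rewrite {1}/segment_fun; case: ifPn => hx; last first.
  move=> _; exists (~` `[a, b]).
    apply: open_nbhs_nbhs; split; last by rewrite /= in_itv/= => /(negP hx).
    by apply: closed_openC; exact: interval_closed.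
  move=> y; rewrite /= in_itv/= => /negP/negbTE; rewrite /segment_fun => ->.
  exact: ltry.
rewrite lte_fin => alU; pose d := (U x - al) / (`|f x| + 1).
have fx0 : 0 < `|f x| + 1 by rewrite ltr_wpDl.
have d0 : 0 < d by rewrite divr_gt0// subr_gt0.
exists (ball x d); first exact: nbhsx_ballx.
move=> y; rewrite /ball/= => yd; rewrite /segment_fun; case: ifP => _; last exact: ltry.
rewrite lte_fin; apply: lt_le_trans (Uf x y).
have : `|f x * (y - x)| < U x - al.
  rewrite normrM; apply: (@le_lt_trans _ _ ((`|f x| + 1) * `|y - x|)).
    by rewrite ler_wpM2r// lerDl.
  by rewrite distrC -ltr_pdivlMl// mulrC.
by rewrite ltr_norml; lra.
Qed.

Section representation.
Context u L (uC : Conv u) (uK : compact (dom u)) (L0 : 0 < L) (uL : dom_lipschitz L u).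

(** The Lipschitz bound on the interior extends to the ends of the domain; beyond them the function
    is continued by lines of slopes [- L] and [L], which keeps the selection bounded by [L] on the
    whole line. *)
Lemma Conv_ld_segmentE : exists U f a b, [/\ a <= b, subgradient U f,
  forall x, `|f x| <= L & u = segment_fun U a b].
Proof.
have [uNy uconv ulsc [x0 ux0]] := uC.
have D0 : dom u !=set0 by exists x0; rewrite /dom /= ltey.
have idc : {within dom u, continuous (id : R -> R)}.
  by apply: continuous_subspaceT => x; exact: cvg_id.
have [b Db bmax] : exists2 b : R, dom u b & forall x, dom u x -> x <= b.
  have [b] := compact_EVT_max D0 uK idc; rewrite inE => Db H.
  by exists b => // x Dx; apply: H; rewrite inE.
have [a Da amin] : exists2 a : R, dom u a & forall x, dom u x -> a <= x.
  have [a] := compact_EVT_min D0 uK idc; rewrite inE => Da H.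
  by exists a => // x Dx; apply: H; rewrite inE.
have ab : a <= b by exact: amin.
pose V := fine \o u.
have VE x : dom u x -> u x = (V x)%:E.
  by move=> ux; rewrite /V/= fineK// fin_numE uNy -ltey.
have conv_dom x y t : dom u x -> dom u y -> 0 <= t <= 1 ->
    dom u (t * x + (1 - t) * y) /\
    V (t * x + (1 - t) * y) <= t * V x + (1 - t) * V y.
  move=> Dx Dy t01; have := uconv x y t t01.
  rewrite (VE x)// (VE y)// -!EFinM -EFinD => h.
  have Dm : dom u (t * x + (1 - t) * y) by rewrite /dom /=; apply: le_lt_trans h (ltry _).
  by split => //; move: h; rewrite (VE _ Dm) lee_fin.
have Dab x : a <= x <= b -> dom u x.
  move=> /andP[ax xb]; have [ab0|ab0] := eqVneq a b.
    by have -> : x = a by [lra|]; exact: Da.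
  have ba : 0 < b - a by rewrite subr_gt0 lt_neqAle ab0.
  pose t := (b - x) / (b - a).
  have [|+ _] := conv_dom a b t Da Db.
    by rewrite divr_ge0 ?(ltW ba) ?subr_ge0//= ler_pdivrMr//; lra.
  have tE : t * (b - a) = b - x by rewrite divfK// gt_eqF.
  by have -> : t * a + (1 - t) * b = x by lra.
have domE : dom u = `[a, b]%classic.
  apply/seteqP; split => x; rewrite /= in_itv/=; last exact: Dab.
  by move=> Dx; rewrite amin// bmax.
have V_conv x y t : a <= x <= b -> a <= y <= b -> 0 <= t <= 1 ->
    V (t * x + (1 - t) * y) <= t * V x + (1 - t) * V y.
  by move=> /Dab Dx /Dab Dy t01; exact: (conv_dom x y t Dx Dy t01).2.
have V_int x y : a < x < b -> a < y < b -> `|V x - V y| <= L * `|x - y|.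
  by move=> hx hy; apply: (dom_lipschitzP _ _).1; rewrite ?domE// interior_segment.
have V_half x m : a <= x <= b -> a < m < b -> `|V x - V m| <= L * `|x - m|.
  move=> /[dup] hx /andP[ax xb] /[dup] hm /andP[am mb].
  have hm' : a <= m <= b by rewrite !ltW.
  have between l : 0 < l < 1 -> a < l * x + (1 - l) * m < b.
    by move=> /andP[l0 l1]; apply/andP; split; nra.
  have sE l : l * x + (1 - l) * m - m = l * (x - m) by ring.
  (* Convexity at the midpoint prevents [V x] from being too small. Lower semicontinuity prevents it
     from being too large: an excess at [x] would persist at interior points [s] close to [x]. *)
  rewrite ler_norml; apply/andP; split.
    have h2 : 0 < (2^-1 : R) < 1 by apply/andP; split; lra.
    have h2' : 0 <= (2^-1 : R) <= 1 by apply/andP; split; lra.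
    have := V_conv _ _ _ hx hm' h2'.
    have := V_int _ _ (between _ h2) hm.
    rewrite sE normrM (gtr0_norm (proj1 (andP h2))) ler_norml.
    by rewrite mulrCA; move: (V (_ + _)) (L * `|x - m|) => B A; lra.
  rewrite lerBlDr leNgt; apply/negP => lt.
  have [|W Wx HW] := ulsc x (L * `|x - m| + V m).
    by rewrite (VE x (Dab x hx)) lte_fin.
  have /nbhs_ballP[del /= del0 Hdel] := Wx.
  have A0 : 0 < `|x - m| + 1 by rewrite ltr_wpDl.
  pose k := Num.min 2^-1 (del / 2 / (`|x - m| + 1)).
  have k0 : 0 < k by rewrite lt_min !divr_gt0// invr_gt0 ltr0n.
  have k1 : k <= 2^-1 by rewrite ge_min lexx.
  have k2 : k * (`|x - m| + 1) <= del / 2 by rewrite -ler_pdivlMr// ge_min lexx orbT.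
  have l01 : 0 < 1 - k < 1 by apply/andP; split; lra.
  have hs := between _ l01; set s := _ + _ in hs.
  have xs : x - s = k * (x - m) by rewrite /s; ring.
  have /HW : W s.
    apply: Hdel; rewrite /ball/= xs normrM (gtr0_norm k0).
    by have := normr_ge0 (x - m); lra.
  rewrite VE; last by apply: Dab; case/andP: hs => ? ?; rewrite !ltW.
  rewrite lte_fin => h; have := V_int _ _ hs hm.
  rewrite /s sE normrM (gtr0_norm (proj1 (andP l01))) ler_norml => /andP[_].
  have : L * ((1 - k) * `|x - m|) <= L * `|x - m|.
    by rewrite ler_wpM2l ?(ltW L0)// ler_piMl//; lra.
  by rewrite -/s; lra.
have V_lip x y : a <= x <= b -> a <= y <= b -> `|V x - V y| <= L * `|x - y|.
  wlog xy : x y / x <= y.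
    move=> H hx hy; have [|/ltW yx] := leP x y; first by move=> ?; exact: H.
    by rewrite distrC [`|x - y|]distrC; exact: H.
  move=> /[dup] hx /andP[ax xb] /[dup] hy /andP[ay yb].
  have [->|xy0] := eqVneq x y; first by rewrite !subrr normr0 mulr0.
  have {xy0} xy0 : x < y by rewrite lt_neqAle xy0.
  (* The midpoint is interior even if [x] and [y] are the two ends, so the half-interior estimate
     applies twice. *)
  have hm : a < (x + y) / 2 < b by apply/andP; split; lra.
  have := V_half _ _ hx hm; have := V_half _ _ hy hm.
  rewrite [`|x - _|]ltr0_norm; last by lra.
  rewrite [`|y - _|]gtr0_norm; last by lra.
  by rewrite [`|x - y|]ltr0_norm ?subr_lt0// !ler_norml; lra.
have V_slope x y z : a <= x -> x < y -> y < z -> z <= b ->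
    (V y - V x) * (z - y) <= (V z - V y) * (y - x).
  move=> ax xy yz zb; have zx : 0 < z - x by lra.
  pose t := (z - y) / (z - x).
  have tE : t * (z - x) = z - y by rewrite divfK// gt_eqF.
  have := V_conv x z t; have -> : t * x + (1 - t) * z = y by lra.
  have -> : a <= x <= b by apply/andP; split; lra.
  have -> : a <= z <= b by apply/andP; split; lra.
  have -> : 0 <= t <= 1 by rewrite divr_ge0/= ?ler_pdivrMr//; lra.
  move=> /(_ isT isT isT) h.
  have : V y * (z - x) <= (t * V x + (1 - t) * V z) * (z - x) by rewrite ler_wpM2r// ltW.
  have -> : (t * V x + (1 - t) * V z) * (z - x) =
      t * (z - x) * V x + ((z - x) - t * (z - x)) * V z by ring.
  rewrite tE; lra.
(* Slopes of the chords ending at [x] from the left; their supremum is the left derivative, which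
   lies below every chord slope to the right. *)
pose S x := [set (V x - V y) / (x - y) | y in `[a, x[].
have S_ub x z : a < x -> x < z -> z <= b -> ubound (S x) ((V z - V x) / (z - x)).
  move=> ax xz zb _ [y /= /[!in_itv]/= /andP[ay yx] <-].
  rewrite ler_pdivrMr ?subr_gt0// mulrAC ler_pdivlMr ?subr_gt0//.
  by have := V_slope y x z ay yx xz zb; lra.
have S_sup x : a < x < b -> has_sup (S x).
  move=> /andP[ax xb]; split.
    by exists ((V x - V a) / (x - a)), a => //; rewrite /= in_itv/= lexx.
  by exists ((V b - V x) / (b - x)); exact: S_ub.
pose f x := if x <= a then - L else if b <= x then L else sup (S x).
pose U x := if x < a then V a + L * (a - x) else if b < x then V b + L * (x - b)
  else V x.
have f_sub x y : a < x < b -> a <= y <= b -> V x + sup (S x) * (y - x) <= V y.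
  move=> /[dup] hx /andP[ax xb] /andP[ay yb].
  have [->|yx] := eqVneq y x; first by rewrite subrr mulr0 addr0.
  case/orP: (lt_total yx) => {}yx.
    have : (V x - V y) / (x - y) <= sup (S x).
      apply: ub_le_sup; first exact: (S_sup x hx).2.
      by exists y => //; rewrite /= in_itv/= ay.
    rewrite ler_pdivrMr ?subr_gt0//; lra.
  have : sup (S x) <= (V y - V x) / (y - x).
    by apply: ge_sup; [exact: (S_sup x hx).1|exact: S_ub].
  by rewrite ler_pdivlMr ?subr_gt0//; lra.
have f_L x : a < x < b -> `|sup (S x)| <= L.
  move=> /[dup] hx /andP[ax xb].
  have hxx : a <= x <= b by rewrite !ltW.
  have ha : a <= a <= b by rewrite lexx.
  have hb : a <= b <= b by rewrite lexx andbT.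
  have := f_sub x a hx ha; have := f_sub x b hx hb.
  have := V_lip x a hxx ha; have := V_lip x b hxx hb.
  rewrite [`|x - b|]ltr0_norm ?subr_lt0// [`|x - a|]gtr0_norm ?subr_gt0//.
  rewrite !ler_norml => /andP[k1 k2] /andP[k3 k4] k5 k6.
  by apply/andP; split; nra.
exists U, f, a, b; split => //.
- have ha : a <= a <= b by rewrite lexx.
  have hb : a <= b <= b by rewrite lexx andbT.
  have Va y : a <= y <= b -> V a - L * (y - a) <= V y /\ V y <= V a + L * (y - a).
    move=> hy; have := V_lip a y ha hy.
    by rewrite [`|a - y|]ler0_norm ?subr_le0 ?(proj1 (andP hy))// ler_norml; lra.
  have Vb y : a <= y <= b -> V b - L * (b - y) <= V y /\ V y <= V b + L * (b - y).
    move=> hy; have := V_lip b y hb hy.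
    by rewrite [`|b - y|]ger0_norm ?subr_ge0 ?(proj2 (andP hy))// ler_norml; lra.
  have UL y : V a - L * (y - a) <= U y.
    rewrite /U; have [ya|ay] := ltP y a; first lra.
    have [yb|yb] := ltP b y; last by have [] := Va y (introT andP (conj ay yb)).
    by have [+ _] := Va b hb; have : 0 <= L * (y - b); [rewrite mulr_ge0 ?(ltW L0)//|]; lra.
  have UR y : V b + L * (y - b) <= U y.
    rewrite /U; have [ya|ay] := ltP y a.
      have [+ _] := Vb a ha; have : 0 <= L * (a - y); last lra.
      by rewrite mulr_ge0 ?(ltW L0)//; lra.
    have [yb|yb] := ltP b y; first lra.
    by have [] := Vb y (introT andP (conj ay yb)); lra.
  have Uab y : a <= y <= b -> U y = V y.
    by move=> /andP[ay yb]; rewrite /U !ltNge ay yb.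
  move=> x y; rewrite {1}/f; have [xa|ax] := leP x a.
    have -> : U x = V a - L * (x - a).
      have [xa'|xa'] := ltP x a; first by rewrite /U xa'; ring.
      have -> : x = a by lra.
      by rewrite Uab//; ring.
    by have := UL y; lra.
  have [bx|xb] := leP b x.
    have -> : U x = V b + L * (x - b).
      have [xb'|xb'] := ltP b x; first by rewrite /U xb' ltNge (ltW ax).
      have -> : x = b by lra.
      by rewrite Uab//; ring.
    by have := UR y; lra.
  have hx : a < x < b by rewrite ax.
  rewrite (Uab x); last by rewrite !ltW.
  have := f_L x hx; rewrite ler_norml => /andP[fL1 fL2].
  have [ya|ay] := ltP y a.
    rewrite /U ya; have := f_sub x a hx ha.
    have : - sup (S x) * (a - y) <= L * (a - y) by rewrite ler_wpM2r//; lra.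
    by lra.
  have [yb|yb] := ltP b y.
    rewrite /U ltNge ay/= yb; have := f_sub x b hx hb.
    have : sup (S x) * (y - b) <= L * (y - b) by rewrite ler_wpM2r//; lra.
    by lra.
  have hy : a <= y <= b by rewrite ay.
  by rewrite (Uab y)//; exact: f_sub.
- move=> x; rewrite /f; case: (leP x a) => xa; first by rewrite normrN gtr0_norm.
  by case: (leP b x) => bx; [rewrite gtr0_norm|rewrite f_L// xa].
apply/funext => x; rewrite /segment_fun /U; case: ifP => [/andP[ax xb]|hx].
  by rewrite !ltNge ax xb/= -VE//; apply: Dab; rewrite ax.
apply/eqP/negP => /negP ux; move/negP: hx; apply.
have : dom u x by rewrite /dom /= ltey.
by rewrite domE /= in_itv.
Qed.
End representation.
End conv_ld.

(** * Necessity *)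

Section tau_segment.
Context {R : realType}.
Implicit Types (U V f g : R -> R) (a b c x y t d e L : R).

Lemma subgradient_continuous U f x e : subgradient U f -> 0 < e ->
  exists2 del, 0 < del & forall y, `|y - x| < del -> `|U y - U x| <= e.
Proof.
move=> Uf e0; have fh := subgradient_homo Uf.
pose M := `|f (x - 1)| + `|f (x + 1)| + 1.
have M0 : 0 < M by rewrite ltr_wpDl// addr_ge0.
have fM y : x - 1 <= y <= x + 1 -> `|f y| <= M.
  move=> /andP[/fh h1 /fh h2]; have := ler_norm (f (x + 1)).
  have := ler_norm (- f (x - 1)); rewrite normrN => h3 h4.
  have := normr_ge0 (f (x + 1)); have := normr_ge0 (f (x - 1)).
  by rewrite ler_norml /M; lra.
exists (Num.min 1 (e / M)); first by rewrite lt_min ltr01 divr_gt0.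
move=> y; rewrite lt_min => /andP[y1]; rewrite ltr_pdivlMr// => yM.
have := fM y; have := fM x.
have -> : x - 1 <= x <= x + 1 by apply/andP; split; lra.
have -> : x - 1 <= y <= x + 1 by move: y1; rewrite ltr_norml => /andP[? ?]; apply/andP; split; lra.
move=> /(_ isT) fx /(_ isT) fy.
have h1 : `|f x * (y - x)| <= e.
  by rewrite normrM (le_trans _ (ltW yM))// mulrC ler_wpM2l.
have h2 : `|f y * (y - x)| <= e.
  by rewrite normrM (le_trans _ (ltW yM))// mulrC ler_wpM2l.
have := Uf x y; have := Uf y x; move: h1 h2; rewrite !ler_norml; lra.
Qed.

Definition conv_ld_elt (u : R -> \bar R) (h : Conv_ld R u) : Conv_ld R :=
  exist (fun v => v \in Conv_ld R) u (mem_set h).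

(** Reduces tau-convergence to convergence of the end points and closeness on each segment
    [a_ k, b_ k]. *)
Lemma tau_cvg_segment (u_ : nat -> Conv_ld R) (u : Conv_ld R)
    (V g : nat -> R -> R) (a_ b_ d_ : nat -> R) U f a b M :
  0 < M -> (forall k, subgradient (V k) (g k)) -> (forall k, a_ k <= b_ k) ->
  (forall k, val (u_ k) = segment_fun (V k) (a_ k) (b_ k)) ->
  subgradient U f -> val u = segment_fun U a b ->
  (forall k x, a_ k <= x <= b_ k -> `|g k x| <= M) ->
  a_ @ \oo --> a -> b_ @ \oo --> b -> d_ @ \oo --> (0 : R) ->
  (forall k x, a_ k <= x <= b_ k -> `|V k x - U x| <= d_ k) ->
  tau_cvg u_ u.
Proof.
move=> M0 Vg ab_ uE_ Uf uE gM a_a b_b d_0 VU.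
have out x (x_ : nat -> R) : x_ @ \oo --> x -> ~~ (a <= x <= b) ->
    \forall k \near \oo, val (u_ k) (x_ k) = +oo%E.
  move=> xx; rewrite negb_and -!ltNge => /orP[xa|bx].
    have h : \forall k \near \oo, x_ k < a_ k.
      pose m := (x + a) / 2.
      near=> k; apply: (@lt_trans _ _ m).
        near: k; apply: (cvgr_lt x) => //; rewrite /m; lra.
      near: k; apply: (cvgr_gt a) => //; rewrite /m; lra.
    by apply: filterS h => k; rewrite uE_ /segment_fun ltNge => /negbTE ->.
  have h : \forall k \near \oo, b_ k < x_ k.
    pose m := (x + b) / 2.
    near=> k; apply: (@lt_trans _ _ m).
      near: k; apply: (cvgr_lt b) => //; rewrite /m; lra.
    near: k; apply: (cvgr_gt x) => //; rewrite /m; lra.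
  by apply: filterS h => k; rewrite uE_ /segment_fun ltNge => /negbTE ->; rewrite andbF.
split.
- move=> x x_ xx; rewrite uE /segment_fun; case: ifPn => hx; last first.
    apply: limn_einf_ge; apply: filterS (out x x_ xx hx) => k ->.
    exact: lexx.
  apply/lee_subgt0Pr => e e0; apply: limn_einf_ge.
  have [del del0 Hdel] := subgradient_continuous x Uf (divr_gt0 e0 (ltr0n R 2)).
  near=> k; rewrite uE_ /segment_fun; case: ifPn => hk; last exact: leey.
  rewrite -EFinB lee_fin.
  have h1 : `|x_ k - x| < del.
    by rewrite distrC; near: k; move/cvgrPdist_lt : xx; exact.
  have h2 : `|0 - d_ k| < e / 2.
    by near: k; move/cvgrPdist_lt : d_0; apply; rewrite divr_gt0.
  have := Hdel _ h1; have := VU k _ hk; move: h2.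
  rewrite sub0r normrN ltr_norml !ler_norml; lra.
- move=> x; rewrite uE /segment_fun; case: ifPn => hx; last first.
    exists (fun=> x); first exact: cvg_cst.
    apply: cvg_near_cst.
    by apply: (out x (fun=> x)) => //; exact: cvg_cst.
  (* Recovery sequence: [x] projected onto the [k]-th domain. *)
  pose x_ k := Num.max (a_ k) (Num.min x (b_ k)).
  have xx : x_ @ \oo --> x.
    apply/cvgrPdist_le => e e0; near=> k.
    have h1 : `|a - a_ k| < e by near: k; move/cvgrPdist_lt : a_a; exact.
    have h2 : `|b - b_ k| < e by near: k; move/cvgrPdist_lt : b_b; exact.
    have /andP[ax xb] := hx; have abk := ab_ k.
    move: h1 h2; rewrite !ltr_norml ler_norml /x_ => /andP[k1 k2] /andP[k3 k4].
    have [h1|h1] := leP x (b_ k); have [h2|h2] := leP (a_ k) x.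
    - by apply/andP; split; lra.
    - by apply/andP; split; lra.
    - by rewrite max_r//; apply/andP; split; lra.
    - by rewrite max_r//; apply/andP; split; lra.
  exists x_ => //.
  have hk k : a_ k <= x_ k <= b_ k.
    by rewrite /x_ le_max lexx/= ge_max ab_ ge_min lexx orbT.
  have -> : (fun k => val (u_ k) (x_ k)) = (fun k => (V k (x_ k))%:E).
    by apply/funext => k; rewrite uE_ segment_funE.
  apply: cvg_EFin; first exact: nearW.
  apply/cvgrPdist_le => e e0.
  have [del del0 Hdel] := subgradient_continuous x Uf (divr_gt0 e0 (ltr0n R 2)).
  near=> k.
  have h1 : `|x_ k - x| < del.
    by rewrite distrC; near: k; move/cvgrPdist_lt : xx; exact.
  have h2 : `|0 - d_ k| < e / 2.
    by near: k; move/cvgrPdist_lt : d_0; apply; rewrite divr_gt0.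
  have := Hdel _ h1; have := VU k _ (hk k); move: h2.
  rewrite /= sub0r normrN ltr_norml !ler_norml; lra.
exists M => // k; rewrite uE_; apply: (segment_fun_lipschitz (Vg k)).
exact: gM.
Unshelve. all: by end_near. Qed.

End tau_segment.

Section necessity.
Context {R : realType} (Z : Conv_ld R -> R).
Context (Zusc : tau_usc Z) (Ztr : translation_invariant Z).
Context (Zdual : dually_epi_translation_invariant Z) (Zval : valuation Z).
Implicit Types (U V f g : R -> R) (a b c x y t d e L : R).

(** Makes [Z] total, so that identities between functions can be rewritten without transporting
    membership proofs. The default 0 is never met on segments carrying a convex function. *)
Let ext (u : R -> \bar R) : R :=
  if pselect (Conv_ld R u) is left h then Z (conv_ld_elt h) else 0.

Let extE (u : Conv_ld R) : ext (val u) = Z u.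
Proof.
rewrite /ext; case: pselect => [h|nh]; first by congr Z; apply: val_inj.
by exfalso; apply: nh; have := valP u; rewrite inE.
Qed.

Let seg U a b (cU : convex1 U) (ab : a <= b) : Conv_ld R :=
  conv_ld_elt (segment_fun_Conv_ld (projT2 (cid cU)) ab).

Let E U a b := ext (segment_fun U a b).

Let segE U a b (cU : convex1 U) (ab : a <= b) : Z (seg cU ab) = E U a b.
Proof. by rewrite -extE. Qed.

Let E_eq U V a b : (forall x, a <= x <= b -> U x = V x) -> E U a b = E V a b.
Proof.
move=> UV; congr ext; apply/funext => x; rewrite /segment_fun.
by case: ifP => // /UV ->.
Qed.

Let E_shift U a b t : convex1 U -> a <= b ->
  E (fun x => U (x + t)) a b = E U (a + t) (b + t).
Proof.
move=> cU ab; have abt : a + t <= b + t by rewrite lerD2r.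
rewrite -(segE (convex1_shift t cU) ab) -(segE cU abt).
by apply: (Ztr (a := t)); apply/funext => x; rewrite /= /segment_fun !lerD2r.
Qed.

Let E_affine U a b k0 k1 : convex1 U -> a <= b ->
  E (fun x => U x + (k1 * x + k0)) a b = E U a b.
Proof.
move=> cU ab; have [Zlin Zcst] := Zdual.
have c0 : convex1 (fun x => U x + (k1 * x + 0)) by exact: convex1_affine.
rewrite -(segE (convex1_affine k0 k1 cU) ab) -(segE cU ab).
rewrite (Zcst k0 (seg c0 ab)).
  apply: (Zlin (GRing.scale k1)); apply/funext => x; rewrite /= /segment_fun.
  by case: ifP => // _; rewrite -EFinD addr0.
apply/funext => x; rewrite /= /segment_fun; case: ifP => // _.
by rewrite -EFinD; congr EFin; ring.
Qed.

(** The minimum of the restrictions to two adjacent segments is the restriction to their union, the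
    maximum is the restriction to the common point. *)
Let E_split U a b c : convex1 U -> a <= b -> b <= c ->
  E U a c + E U b b = E U a b + E U b c.
Proof.
move=> cU ab bc; rewrite -(segE cU ab) -(segE cU bc) -(segE cU (le_trans ab bc)).
rewrite -(segE cU (lexx b)); apply: Zval; apply/funext => x; rewrite /= /segment_fun.
  have [ax|xa] := leP a x; have [xb|bx] := leP x b; have [xc|cx] := leP x c;
    have [bx'|xb'] := leP b x => //=; rewrite ?minxx ?miney ?minye//; exfalso; lra.
have [ax|xa] := leP a x; have [xb|bx] := leP x b; have [xc|cx] := leP x c;
    have [bx'|xb'] := leP b x => //=; rewrite ?maxxx ?maxey ?maxye//; exfalso; lra.
Qed.

Let c0 := E (fun=> 0) 0 0.

Let E_point U b : convex1 U -> E U b b = c0.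
Proof.
move=> cU; have cc := @convex1_cst0 R.
rewrite (E_eq (V := fun x => 0 + (0 * x + U b))); last first.
  move=> x h; have -> : x = b by lra.
  by ring.
rewrite E_affine// /c0 -[in LHS](add0r b) -E_shift//.
Qed.

Let usc_near (u_ : nat -> Conv_ld R) u e : tau_cvg u_ u -> 0 < e ->
  ~ (forall k, Z u + e < Z (u_ k)).
Proof.
move=> uu e0 H; have : (limn_esup (fun k => (Z (u_ k))%:E) < (Z u + e)%:E)%E.
  by apply: le_lt_trans (Zusc uu) _; rewrite lte_fin ltrDl.
move=> /limn_esup_lt[N _ HN]; have := HN N (leqnn N).
by rewrite /= lte_fin ltNge ltW.
Qed.

Let ind l := E (fun=> 0) 0 l - c0.
Let c1 := ind 1.

(** Additivity alone does not give linearity. The missing bound near 0 comes from semicontinuity: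
    the zero functions on [0, l] tend to the one on {0} as [l] shrinks. *)
Let indE l : 0 <= l -> ind l = c1 * l.
Proof.
have cc := @convex1_cst0 R.
have [del del0 Hdel] : exists2 del, 0 < del & forall x, 0 <= x <= del -> ind x <= 1.
  apply: contrapT => H.
  have {}H (n : nat) : exists x, 0 <= x <= n.+1%:R^-1 /\ 1 < ind x.
    apply: contrapT => H'; apply: H; exists n.+1%:R^-1; first by rewrite invr_gt0.
    move=> x hx; rewrite leNgt; apply/negP => x1; apply: H'; by exists x.
  have [l_ Hl] := choice H.
  have l0 k : 0 <= l_ k by have [/andP[]] := Hl k.
  have /(usc_near (e := 1)) : tau_cvg (fun k => seg cc (l0 k)) (seg cc (lexx 0)).
    apply: (@tau_cvg_segment _ _ _ (fun _ _ => 0) (fun _ _ => 0) (fun=> 0) l_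
       (fun=> 0) (fun=> 0) (fun=> 0) 0 0 1) => //.
    - by move=> k x y; rewrite mul0r addr0.
    - by move=> x y; rewrite mul0r addr0.
    - by move=> k x _; rewrite normr0.
    - exact: cvg_cst.
    - apply: (@squeeze_cvgr _ _ _ _ (fun=> 0) (fun k => k.+1%:R^-1)).
      + by apply: nearW => k; have [] := Hl k.
      + exact: cvg_cst.
      + exact: cvg_harmonic.
    - exact: cvg_cst.
    - by move=> k x _; rewrite subrr normr0.
  move=> /(_ ltr01); apply => k; rewrite !segE -/c0.
  by have [_] := Hl k; rewrite /ind; lra.
apply: (@additive_bounded_linear _ _ _ 1 del0 _ Hdel) => x y x0 y0.
have xy : x <= x + y by rewrite lerDl.
have := E_split cc x0 xy; rewrite E_point//.
have := E_shift x cc y0; rewrite add0r [y + x]addrC => <-.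
by rewrite /ind; lra.
Qed.

Let z U a b := E U a b - c0 - c1 * (b - a).

Let z_interval_functional : interval_functional z.
Proof.
have cc := @convex1_cst0 R.
split.
- move=> U a b c cU ab bc; have := E_split cU ab bc; rewrite E_point// /z; lra.
- by move=> U a b t cU ab; rewrite /z E_shift//; ring.
- by move=> U a b k0 k1 cU ab; rewrite /z E_affine.
- by move=> U V a b UV; rewrite /z (E_eq UV).
- move=> a b ab; have ba : 0 <= b - a by rewrite subr_ge0.
  have := indE ba; rewrite /z /ind -(add0r a) -[in E _ _ b](subrK a b).
  by rewrite -(E_shift a cc ba) add0r => ->; ring.
(* If no [del] works, counterexamples for [del] = 1/(n+1) form a sequence that tau-converges to [U]
   and violates semicontinuity. *)
move=> U L a b e cU ab e0; apply: contrapT => H.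
have {}H (n : nat) : exists Vg : (R -> R) * (R -> R), [/\ subgradient Vg.1 Vg.2,
    forall x, a <= x <= b -> `|Vg.2 x| <= L,
    forall x, a <= x <= b -> `|Vg.1 x - U x| <= n.+1%:R^-1 &
    z U a b + e < z Vg.1 a b].
  apply: contrapT => H'; apply: H; exists n.+1%:R^-1; first by rewrite invr_gt0.
  move=> V g Vg gL VU; rewrite leNgt; apply/negP => lt; apply: H'.
  by exists (V, g).
have [W HW] := choice H; have [f Uf] := cU.
have cW k : convex1 (W k).1 by exists (W k).2; have [] := HW k.
have /(usc_near (e := e)) : tau_cvg (fun k => seg (cW k) ab) (seg cU ab).
  apply: (@tau_cvg_segment _ _ _ (fun k => (W k).1) (fun k => (W k).2) (fun=> a)
     (fun=> b) (fun k => k.+1%:R^-1) U f a b (`|L| + 1)) => //.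
  - by move=> k; have [] := HW k.
  - move=> k x hx; have [_ h _ _] := HW k; apply: le_trans (h x hx) _.
    by apply: le_trans (ler_norm _) _; rewrite lerDl.
  - exact: cvg_cst.
  - exact: cvg_cst.
  - exact: cvg_harmonic.
  - by move=> k; have [] := HW k.
move=> /(_ e0); apply => k; rewrite !segE.
by have [_ _ _] := HW k; rewrite /z; lra.
Qed.

Lemma necessity : exists c0 c1 (zeta : R -> R), conc_fun zeta /\
  forall u : Conv_ld R, ((Z u)%:E =
    c0%:E + c1%:E * lebesgue_measure (dom (val u)) +
    \int[lebesgue_measure]_(x in dom (val u))
      (zeta (second_derivative (val u) x))%:E)%E.
Proof.
have zP := z_interval_functional.
have concP : conc_fun (zeta z).
  split; [exact: zeta_ge0|exact: zeta_concave|exact: zeta0_cvg|exact: zeta_sublinear].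
exists c0, c1, (zeta z); split => // u.
have : Conv_ld R (val u) by have := valP u; rewrite inE.
move=> [uC uK [L L0 uL]].
have [U [f [a [b [ab Uf _ uE]]]]] := Conv_ld_segmentE uC uK L0 uL.
have cU : convex1 U by exists f.
have -> : Z u = c0 + c1 * (b - a) + z U a b.
  by rewrite -extE uE -/(E U a b) /z; ring.
rewrite uE dom_segment_fun lebesgue_measure_itv/= lte_fin.
have [ab'|ba] := ltP a b; last first.
  have -> : b = a by lra.
  rewrite subrr mulr0 addr0 mule0 adde0 set_itv1 integral_set1.
  by rewrite (z_point zP)// addr0 adde0.
rewrite -EFinB -EFinM.
have t01 : 0 <= (0 : R) <= 1 by rewrite lexx ler01.
have [J [-> HJ]] := riemann_second_derivative concP Uf ab' t01.
rewrite -!EFinD; congr (_ + _)%:E.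
have HS n : \sum_(i < n.+1) (b - a) / n.+1%:R * zeta z (widened_quotient f a b 0 n i) =
    \sum_(i < n.+1) (b - a) / n.+1%:R * zeta z
     ((f (a + i.+1%:R * ((b - a) / n.+1%:R)) - f (a + i%:R * ((b - a) / n.+1%:R))) /
      ((b - a) / n.+1%:R)).
  by apply: eq_bigr => i _; rewrite /widened_quotient !mul0r addr0 subr0.
(* The upper bound for [z] holds for every partition, so one fine enough for the integral suffices;
   the lower bound needs a partition fine enough for both. *)
apply/eqP; rewrite eq_le; apply/andP; split; apply/ler_addgt0Pr => e e0.
  have [M HM] := HJ _ e0; have := HM M (leqnn M); rewrite HS.
  have := z_le_riemann zP Uf ab' (n := M) erefl; rewrite ler_norml.
  by move: (bigop _ _ _) => S; lra.
have e20 : 0 < e / 2 by rewrite divr_gt0.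
have [M HM] := HJ _ e20; have [N HN] := z_ge_riemann zP Uf ab' e20.
have := HM (maxn M N) (leq_maxl _ _); rewrite HS ler_norml.
have := HN (maxn M N) _ (leq_maxr _ _) erefl.
by move: (bigop _ _ _) => S; lra.
Qed.

End necessity.

(** * Sufficiency *)

Section valuation.
Context {R : realType} (zeta : R -> R) (zP : conc_fun zeta).
Local Notation mu := (@lebesgue_measure R).
Implicit Types (u v w j : R -> \bar R) (U V f g : R -> R) (a b c x y t d e L : R).

Definition clusters_at0 (A : set R) :=
  forall del, 0 < del -> exists2 h, A h & 0 < `|h| < del.

(** Pigeonhole for the two order relations between [u] and [v] near a point: one of them occurs
    arbitrarily close to it. *)
Lemma clusters_at0_setU (A B : set R) : (forall h, A h \/ B h) ->
  clusters_at0 A \/ clusters_at0 B.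
Proof.
move=> AB; apply: contrapT => /not_orP[nA nB].
have {nA} [d1 d10 H1] : exists2 del, 0 < del & forall h, 0 < `|h| < del -> ~ A h.
  apply: contrapT => H; apply: nA => del del0; apply: contrapT => H'.
  by apply: H; exists del => // h hd Ah; apply: H'; exists h.
have {nB} [d2 d20 H2] : exists2 del, 0 < del & forall h, 0 < `|h| < del -> ~ B h.
  apply: contrapT => H; apply: nB => del del0; apply: contrapT => H'.
  by apply: H; exists del => // h hd Ah; apply: H'; exists h.
pose h := Num.min d1 d2 / 2.
have m0 : 0 < Num.min d1 d2 by rewrite lt_min d10.
have hm : 0 < `|h| < Num.min d1 d2.
  by rewrite gtr0_norm ?divr_gt0//=; rewrite /h; lra.
have := hm; rewrite lt_min => /and3P[h0 hd1 hd2].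
by case: (AB h); [apply: H1|apply: H2]; rewrite h0.
Qed.

Lemma clusters_at0_ball e : 0 < e -> clusters_at0 [set h | `|h| < e].
Proof.
move=> e0 del del0; have m0 : 0 < Num.min e del by rewrite lt_min e0.
exists (Num.min e del / 2) => /=; rewrite gtr0_norm ?divr_gt0//.
  by rewrite (@lt_le_trans _ _ (Num.min e del)) ?ge_min ?lexx//; lra.
by rewrite /= (@lt_le_trans _ _ (Num.min e del)) ?ge_min ?lexx ?orbT//; lra.
Qed.

(** At a point where the graphs cross, the minimum need not agree with either function on a
    neighbourhood; agreement along points tending to [x] already fixes the coefficients. *)
Lemma taylor2_eq_on u v x p q p' q' (A : set R) : clusters_at0 A ->
  (forall h, A h -> u (x + h) = v (x + h)) ->
  taylor2 u x p q -> taylor2 v x p' q' -> q = q'.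
Proof.
move=> HA uv /taylor2P[_ Hu] /taylor2P[_ Hv].
have [|_ _] := @expansion_eq0 R A (fine (u x) - fine (v x)) (p - p') (q / 2 - q' / 2) HA.
  move=> e e0; have e2 : 0 < e / 2 by rewrite divr_gt0.
  have [d1 d10 H1] := Hu _ e2; have [d2 d20 H2] := Hv _ e2.
  exists (Num.min d1 d2) => [|h Ah]; first by rewrite lt_min d10.
  rewrite lt_min => /andP[/H1 h1 /H2 h2].
  by move: h1 h2; rewrite (uv h Ah) !ler_norml; lra.
by lra.
Qed.

Definition zeta_energy u :=
  (\int[mu]_(x in dom u) (zeta (second_derivative u x))%:E)%E.

(** Extension by zero puts the four energies, whose domains differ, over one common set. *)
Let density u := (fun x => (zeta (second_derivative u x))%:E) \_ (dom u).

Lemma zeta_energy_valuation (u v w j : Conv_ld R) :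
  val w = (fun x => mine (val u x) (val v x)) ->
  val j = (fun x => maxe (val u x) (val v x)) ->
  (zeta_energy (val w) + zeta_energy (val j) =
   zeta_energy (val u) + zeta_energy (val v))%E.
Proof.
move=> wE jE.
have ae (s : Conv_ld R) : exists N, [/\ measurable N, mu N = 0%E,
    measurable_fun (~` N) (density (val s)),
    forall x, (0 <= density (val s) x)%E &
    forall x, dom (val s) x -> ~ N x ->
      exists p, taylor2 (val s) x p (second_derivative (val s) x)].
  have : Conv_ld R (val s) by have := valP s; rewrite inE.
  move=> [sC sK [L L0 sL]].
  have [U [f [a [b [ab Uf _ sE]]]]] := Conv_ld_segmentE sC sK L0 sL.
  have [N [mN N0 mD HN]] := ae_second_derivative Uf ab.
  exists N; split => //.
  - rewrite /density sE dom_segment_fun.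
    apply/measurable_restrict; [exact: measurable_itv|exact: measurableC|].
    rewrite setIC -setDE; apply/measurable_EFinP.
    (* [zeta] is monotone on the half-line only; composing with [max t 0] gives a monotone, hence
       measurable, function with the same values on second derivatives. *)
    have mz : measurable_fun [set: R] (fun t => zeta (Num.max t 0)).
      apply: nondecreasing_measurable => // t t' tt'.
      have m0 (r : R) : 0 <= Num.max r 0 by rewrite le_max lexx orbT.
      by apply: (conc_le zP) => //; rewrite ge_max m0 le_max tt'.
    apply: (eq_measurable_fun ((fun t => zeta (Num.max t 0)) \o
      second_derivative (segment_fun U a b))); last exact: measurableT_comp.
    by move=> x _ /=; rewrite max_l//; exact: second_derivative_ge0 Uf.
  - move=> x; rewrite /density /patch; case: ifPn => // _; rewrite lee_fin.
    by apply: (conc_ge0 zP); rewrite sE; exact: second_derivative_ge0 Uf.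
  - by move=> x; rewrite sE dom_segment_fun /= in_itv/= => hx; exact: HN.
have [Nu [mNu Nu0 mu_ u0 tu]] := ae u; have [Nv [mNv Nv0 mv v0 tv]] := ae v.
have [Nw [mNw Nw0 mw w0 tw]] := ae w; have [Nj [mNj Nj0 mj j0 tj]] := ae j.
pose N := Nu `|` Nv `|` (Nw `|` Nj).
have mN : measurable N by rewrite /N; do !apply: measurableU.
have null2 (A B : set (measurableTypeR R)) : measurable A -> measurable B ->
    mu A = 0%E -> mu B = 0%E -> mu (A `|` B) = 0%E.
  move=> mA mB A0 B0; apply/eqP; rewrite eq_le measure_ge0 andbT.
  apply: (@le_trans _ _ (mu A + mu B)%E); first exact: measureU2.
  by rewrite A0 B0 adde0.
have N0 : mu N = 0%E.
  rewrite /N; apply: (null2 (Nu `|` Nv) (Nw `|` Nj)); first exact: measurableU.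
  - exact: measurableU.
  - exact: null2.
  - exact: null2.
have off s : (forall x, (0 <= density s x)%E) ->
    zeta_energy s = (\int[mu]_(x in ~` N) density s x)%E.
  move=> s0; rewrite /zeta_energy integral_mkcond -/(density s).
  by rewrite (@integral_off_null _ setT N _ mN N0)// setTD.
have mNC : measurable (~` N : set (measurableTypeR R)) by exact: measurableC.
have mS (s : R -> \bar R) Ns : Ns `<=` N -> measurable_fun (~` Ns) (density s) ->
    measurable Ns -> measurable_fun (~` N) (density s).
  by move=> NsN + mNs; apply: measurable_funS; [exact: measurableC|exact: subsetC].
have mu' := mS _ _ (subset_trans (@subsetUl _ Nu Nv) (@subsetUl _ _ _)) mu_ mNu.
have mv' := mS _ _ (subset_trans (@subsetUr _ Nu Nv) (@subsetUl _ _ _)) mv mNv.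
have mw' := mS _ _ (subset_trans (@subsetUl _ Nw Nj) (@subsetUr _ _ _)) mw mNw.
have mj' := mS _ _ (subset_trans (@subsetUr _ Nw Nj) (@subsetUr _ _ _)) mj mNj.
have add s s' : (forall x, 0 <= density s x)%E -> (forall x, 0 <= density s' x)%E ->
    measurable_fun (~` N) (density s) -> measurable_fun (~` N) (density s') ->
    (zeta_energy s + zeta_energy s' = \int[mu]_(x in ~` N) (density s x + density s' x))%E.
  move=> s0 t0 ms mt; rewrite (off s s0) (off s' t0).
  rewrite (@ge0_integralD _ _ _ mu (~` N) mNC (density s) (density s'))//.
rewrite (add _ _ w0 j0 mw' mj') (add _ _ u0 v0 mu' mv').
apply: eq_integral => x; rewrite inE /= => /not_orP[/not_orP[xNu xNv] /not_orP[xNw xNj]].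
have far (s : Conv_ld R) : ~ dom (val s) x ->
    exists2 e, 0 < e & forall h, `|h| < e -> val s (x + h) = +oo%E.
  move=> sx; have : Conv_ld R (val s) by have := valP s; rewrite inE.
  move=> [_ /(compact_closed (@norm_hausdorff _ R)) sK _].
  have /nbhs_ballP[e /= e0 He] : nbhs x (~` dom (val s)).
    by apply: open_nbhs_nbhs; split => //; exact: closed_openC.
  exists e => // h he; have : ~ dom (val s) (x + h).
    by apply: He; rewrite /ball/= opprD addNKr normrN.
  by rewrite /dom /= => /negP; rewrite -leNgt leye_eq => /eqP.
have dE s : dom s x -> density s x = (zeta (second_derivative s x))%:E.
  by move=> sx; rewrite /density /patch mem_set.
have d0 s : ~ dom s x -> density s x = 0%E.
  by move=> sx; rewrite /density /patch memNset.
have [xu|xu] := pselect (dom (val u) x); have [xv|xv] := pselect (dom (val v) x).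
- have xw : dom (val w) x by rewrite wE /dom/= gt_min xu.
  have xj : dom (val j) x by rewrite jE /dom/= gt_max xu.
  rewrite !dE//.
  have [pu Tu] := tu x xu xNu; have [pv Tv] := tv x xv xNv.
  have [pw Tw] := tw x xw xNw; have [pj Tj] := tj x xj xNj.
  pose A := [set h | val w (x + h) = val u (x + h) /\ val j (x + h) = val v (x + h)].
  pose B := [set h | val w (x + h) = val v (x + h) /\ val j (x + h) = val u (x + h)].
  have AB h : A h \/ B h.
    rewrite /A /B /= wE jE; have [uv|vu] := leP (val u (x + h)) (val v (x + h)).
      by left.
    by right.
  have [cA|cB] := clusters_at0_setU AB.
    rewrite (taylor2_eq_on cA (fun h Ah => proj1 Ah) Tw Tu).
    by rewrite (taylor2_eq_on cA (fun h Ah => proj2 Ah) Tj Tv).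
  rewrite (taylor2_eq_on cB (fun h Bh => proj1 Bh) Tw Tv).
  by rewrite (taylor2_eq_on cB (fun h Bh => proj2 Bh) Tj Tu) addeC.
- have xw : dom (val w) x by rewrite wE /dom/= gt_min xu.
  have xj : ~ dom (val j) x by rewrite jE /dom/= gt_max => /andP[_ /xv].
  rewrite (d0 (val j))// (d0 (val v))// !dE// !adde0.
  have [pu Tu] := tu x xu xNu; have [pw Tw] := tw x xw xNw.
  have [e e0 He] := far v xv.
  rewrite (taylor2_eq_on (clusters_at0_ball e0) _ Tw Tu)// => h /He vh.
  by rewrite wE vh miney.
- have xw : dom (val w) x by rewrite wE /dom/= gt_min xv orbT.
  have xj : ~ dom (val j) x by rewrite jE /dom/= gt_max => /andP[/xu].
  rewrite (d0 (val j))// (d0 (val u))// !dE// adde0 add0e.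
  have [pv Tv] := tv x xv xNv; have [pw Tw] := tw x xw xNw.
  have [e e0 He] := far u xu.
  rewrite (taylor2_eq_on (clusters_at0_ball e0) _ Tw Tv)// => h /He uh.
  by rewrite wE uh minye.
- have xw : ~ dom (val w) x by rewrite wE /dom/= gt_min => /orP[/xu|/xv].
  have xj : ~ dom (val j) x by rewrite jE /dom/= gt_max => /andP[/xu].
  by rewrite !d0.
Qed.

End valuation.

(** * The integral term on segments and its semicontinuity *)

Section energy.
Context {R : realType} (zeta : R -> R) (zP : conc_fun zeta).
Local Notation mu := (@lebesgue_measure R).
Implicit Types (U V f g : R -> R) (a b c p q x y t d e K L M : R).

Definition energy U a b := fine (zeta_energy zeta (segment_fun U a b)).

Lemma energy_riemann U f a b theta : subgradient U f -> a < b ->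
  0 <= theta <= 1 -> zeta_energy zeta (segment_fun U a b) = (energy U a b)%:E /\
  forall e, 0 < e -> exists N : nat, forall n, (N <= n)%N ->
    `|\sum_(i < n.+1) (b - a) / n.+1%:R * zeta (widened_quotient f a b theta n i) -
      energy U a b| <= e.
Proof.
move=> Uf ab t01; have [J [JE HJ]] := riemann_second_derivative zP Uf ab t01.
by rewrite /energy /zeta_energy dom_segment_fun JE.
Qed.

Lemma energyE U f a b : subgradient U f -> a <= b ->
  zeta_energy zeta (segment_fun U a b) = (energy U a b)%:E.
Proof.
move=> Uf; rewrite le_eqVlt => /predU1P[->|ab].
  by rewrite /energy /zeta_energy dom_segment_fun set_itv1 integral_set1.
by have [] := @energy_riemann U f a b 0 Uf ab; rewrite ?lexx ?ler01.
Qed.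

Lemma energy_point U a : energy U a a = 0.
Proof. by rewrite /energy /zeta_energy dom_segment_fun set_itv1 integral_set1. Qed.

Lemma energy_ge0 U f a b : subgradient U f -> 0 <= energy U a b.
Proof.
move=> Uf; apply: fine_ge0; apply: integral_ge0 => x _.
by rewrite lee_fin (conc_ge0 zP)//; exact: second_derivative_ge0 Uf.
Qed.

Lemma zeta_energy_fin_num (u : Conv_ld R) : zeta_energy zeta (val u) \is a fin_num.
Proof.
have : Conv_ld R (val u) by have := valP u; rewrite inE.
move=> [uC uK [L L0 uL]].
have [U [f [a [b [ab Uf _ ->]]]]] := Conv_ld_segmentE uC uK L0 uL.
by rewrite (energyE Uf ab).
Qed.

Lemma fine_zeta_energy_valuation (u v w j : Conv_ld R) :
  val w = (fun x => mine (val u x) (val v x)) ->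
  val j = (fun x => maxe (val u x) (val v x)) ->
  fine (zeta_energy zeta (val w)) + fine (zeta_energy zeta (val j)) =
  fine (zeta_energy zeta (val u)) + fine (zeta_energy zeta (val v)).
Proof.
move=> wE jE.
apply: etrans (esym (fineD (zeta_energy_fin_num w) (zeta_energy_fin_num j))) _.
apply: etrans (congr1 fine (zeta_energy_valuation zP wE jE)) _.
exact: fineD (zeta_energy_fin_num u) (zeta_energy_fin_num v).
Qed.

Lemma energy_split U f a b c : subgradient U f -> a <= b -> b <= c ->
  energy U a c = energy U a b + energy U b c.
Proof.
move=> Uf ab bc; have ac := le_trans ab bc.
pose s x y (xy : x <= y) := conv_ld_elt (segment_fun_Conv_ld Uf xy).
rewrite -[LHS]addr0 -(energy_point U b).
apply: (@fine_zeta_energy_valuation (s _ _ ab) (s _ _ bc) (s _ _ ac) (s _ _ (lexx b))).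
  apply/funext => x; rewrite /= /segment_fun.
  have [ax|xa] := leP a x; have [xb|bx] := leP x b; have [xc|cx] := leP x c;
    have [bx'|xb'] := leP b x => //=; rewrite ?minxx ?miney ?minye//; exfalso; lra.
apply/funext => x; rewrite /= /segment_fun.
have [ax|xa] := leP a x; have [xb|bx] := leP x b; have [xc|cx] := leP x c;
    have [bx'|xb'] := leP b x => //=; rewrite ?maxxx ?maxey ?maxye//; exfalso; lra.
Qed.

Lemma energy_sum U f a d n : subgradient U f -> 0 <= d ->
  energy U a (a + n%:R * d) =
  \sum_(i < n) energy U (a + i%:R * d) (a + i.+1%:R * d).
Proof.
move=> Uf d0; elim: n => [|n IH]; first by rewrite big_ord0 mul0r addr0 energy_point.
rewrite big_ord_recr/= -IH; apply: (energy_split Uf).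
  by rewrite lerDl mulr_ge0.
by rewrite lerD2l ler_wpM2r// ler_nat.
Qed.

Lemma widened_quotient0_sum f a b n : a < b ->
  \sum_(i < n.+1) (b - a) / n.+1%:R * widened_quotient f a b 0 n i = f b - f a.
Proof.
move=> ab; set d := (b - a) / n.+1%:R.
have d0 : d != 0 by rewrite gt_eqF// divr_gt0// subr_gt0.
rewrite (eq_bigr (fun i : 'I_n.+1 => f (a + i.+1%:R * d) - f (a + i%:R * d))); last first.
  by move=> i _; rewrite /widened_quotient -/d mul0r addr0 subr0 mulrCA divff// mulr1.
rewrite -(big_mkord xpredT (fun i => f (a + i.+1%:R * d) - f (a + i%:R * d))).
rewrite (telescope_sumr (fun i => f (a + i%:R * d)))// mul0r addr0.
by rewrite /d mulrC divfK ?pnatr_eq0// subrKC.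
Qed.

Lemma energy_le U f a b B : subgradient U f -> a < b ->
  (forall n, \sum_(i < n.+1) (b - a) / n.+1%:R *
     zeta (widened_quotient f a b 0 n i) <= B) -> energy U a b <= B.
Proof.
move=> Uf ab H; apply/ler_addgt0Pr => e e0.
have [|_ /(_ _ e0)[N /(_ N (leqnn N))]] := @energy_riemann U f a b 0 Uf ab.
  by rewrite lexx ler01.
by have := H N; rewrite ler_norml; lra.
Qed.

Lemma energy_le_affine U f a b K e : subgradient U f -> a <= b ->
  (forall t, 0 <= t -> zeta t <= K + e * t) ->
  energy U a b <= (b - a) * K + e * (f b - f a).
Proof.
move=> Uf + H; rewrite le_eqVlt => /predU1P[->|ab].
  by rewrite energy_point !subrr mul0r mulr0 addr0.
have fh := subgradient_homo Uf.
apply: (energy_le Uf ab) => n; rewrite -(widened_quotient0_sum f n ab).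
set d := (b - a) / n.+1%:R; have d0 : 0 <= d by rewrite divr_ge0// subr_ge0 ltW.
have -> : (b - a) * K = \sum_(i < n.+1) d * K.
  by rewrite sumr_const card_ord -mulrnAl -mulr_natr divfK ?pnatr_eq0.
rewrite mulr_sumr -big_split/=; apply: ler_sum => i _.
rewrite [e * _]mulrCA -mulrDr ler_wpM2l// H//.
by apply: widened_quotient_ge0 => //; rewrite ?lexx ?ler01.
Qed.

Lemma energy_jensen U f a b : subgradient U f -> a < b ->
  energy U a b <= (b - a) * zeta ((f b - f a) / (b - a)).
Proof.
move=> Uf ab; have fh := subgradient_homo Uf.
apply: (energy_le Uf ab) => n; set d := (b - a) / n.+1%:R.
have d0 : 0 < d by rewrite divr_gt0// subr_gt0.
have nd : n.+1%:R * d = b - a by rewrite /d mulrC divfK ?pnatr_eq0.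
have w0 i : 0 <= widened_quotient f a b 0 n i.
  by apply: widened_quotient_ge0 => //; rewrite ?lexx ?ler01.
apply: le_trans (conc_jensen zP n (ltW d0) w0) _; rewrite nd.
have -> // : (f b - f a) / (b - a) = (\sum_(i < n.+1) widened_quotient f a b 0 n i) / n.+1%:R.
rewrite -(widened_quotient0_sum f n ab) -/d -mulr_sumr -nd invfM mulrACA.
by rewrite mulrC mulrA divfK ?gt_eqF.
Qed.

(** Riemann sums see only increments of the slope; this covers translations and added affine
    functions alike. *)
Lemma energy_eq U f a b V g p q : subgradient U f -> subgradient V g -> a <= b ->
  q - p = b - a ->
  (forall x y, g (p + y) - g (p + x) = f (a + y) - f (a + x)) ->
  energy V p q = energy U a b.
Proof.
move=> Uf Vg ab pq H; move: ab; rewrite le_eqVlt => /predU1P[ab|ab].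
  by have -> : q = p; [move: pq; rewrite ab; lra|rewrite ab !energy_point].
have pltq : p < q by lra.
have wE n i : widened_quotient g p q 0 n i = widened_quotient f a b 0 n i.
  by rewrite /widened_quotient pq !mul0r !addr0 !subr0 H.
apply/eqP; rewrite -subr_eq0 -normr_eq0 eq_le normr_ge0 andbT.
apply/ler_addgt0Pr => e e0; rewrite add0r; have e2 : 0 < e / 2 by rewrite divr_gt0.
have t01 : 0 <= (0 : R) <= 1 by rewrite lexx ler01.
have [_ /(_ _ e2)[N1 H1]] := energy_riemann Uf ab t01.
have [_ /(_ _ e2)[N2 H2]] := energy_riemann Vg pltq t01.
have := H1 _ (leq_maxl N1 N2); have := H2 _ (leq_maxr N1 N2).
under eq_bigr do rewrite wE.
rewrite pq; move: (\sum_(_ < _) _) (energy _ _ _) (energy _ _ _) => x y z.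
by rewrite !ler_norml; clear -R; lra.
Qed.

(** Short intervals carry little energy uniformly in the function: its gain is at most [2 * M], so
    the linear part of the bound on [zeta] contributes at most [e]. *)
Lemma energy_ends M e : 0 < M -> 0 < e -> exists K, forall V g p q,
  subgradient V g -> (forall x, `|g x| <= M) -> p <= q ->
  energy V p q <= (q - p) * K + e.
Proof.
move=> M0 e0; have e0' : 0 < e / (2 * M) by rewrite divr_gt0// mulr_gt0.
have [K K0 HK] := conc_affine_le zP e0'; exists (zeta K) => V g p q Vg gM pq.
have h t : 0 <= t -> zeta t <= zeta K + e / (2 * M) * t.
  move=> t0; apply: le_trans (HK t t0) _; rewrite lerD2r; apply: (conc_le zP).
    by rewrite le_min t0 ltW.
  by rewrite ge_min lexx orbT.
apply: le_trans (energy_le_affine Vg pq h) _; rewrite lerD2l.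
have gg : g q - g p <= 2 * M by have := gM p; have := gM q; rewrite !ler_norml; lra.
apply: (@le_trans _ _ (e / (2 * M) * (2 * M))); first by rewrite ler_wpM2l// ltW.
by rewrite divfK// gt_eqF// mulr_gt0.
Qed.

Section usc.
Context U f (Uf : subgradient U f) a b.
Context (V g : nat -> R -> R) (Vg : forall k, subgradient (V k) (g k)).
Context (VU : forall x, a < x < b -> (fun k => V k x) @ \oo --> U x).

(** The slope of [V k] at a node is bounded by its difference quotients towards the points at
    distance [eta], hence, by pointwise convergence at finitely many points, by the slopes of [U] at
    these points. Jensen's inequality on each cell then leads to the Riemann sum with theta = 1. *)
Lemma energy_inner (r e : R) : 0 < r -> 0 < e -> a + r < b - r ->
  \forall k \near \oo, energy (V k) (a + r) (b - r) <= energy U (a + r) (b - r) + e.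
Proof.
move=> r0 e0 ab; set c := a + r; set q := b - r; have cq : c < q by [].
have t11 : 0 <= (1 : R) <= 1 by rewrite lexx ler01.
have e2 : 0 < e / 2 by rewrite divr_gt0.
have fh := subgradient_homo Uf.
have [_ /(_ _ e2)[N0 HN0]] := energy_riemann Uf cq t11.
(* Ensures d < r, so that the enlarged cells stay inside ]a, b[, where convergence is known. *)
have [N1 HN1] := lt_succn ((q - c) / r).
pose n := maxn N0 N1; have := HN0 n (leq_maxl _ _).
set d := (q - c) / n.+1%:R => Hn.
have n0 : 0 < n.+1%:R :> R by [].
have d0 : 0 < d by rewrite divr_gt0// subr_gt0.
have dr : d < r.
  rewrite ltr_pdivrMr// mulrC -ltr_pdivrMr//; apply: lt_le_trans HN1 _.
  by rewrite ler_nat ltnS leq_maxr.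
have nd : n.+1%:R * d = q - c by rewrite /d mulrC divfK ?pnatr_eq0.
pose eta := d / n.+1%:R; have eta0 : 0 < eta by rewrite divr_gt0.
have etad : eta <= d by rewrite ler_pdivrMr// ler_peMr ?ler1n// ltW.
have h0 : 0 < e / 2 / (q - c) by rewrite divr_gt0// subr_gt0.
have [s s0 Hs] := conc_small zP h0.
(* Four values are compared per cell and divided by [eta], so the gain is off by at most
   [4 * del / eta = d * s]; the [s] in the quotient costs [zeta s <= e / 2 / (q - c)]. *)
pose del : R := s * (d * eta) / 4.
have del0 : 0 < del by rewrite divr_gt0// mulr_gt0// mulr_gt0.
pose P i := c + i%:R * d.
have Pin i : (i <= n.+1)%N -> c <= P i <= q.
  move=> iN; rewrite /P lerDl mulr_ge0 ?(ltW d0)//=.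
  have : i%:R * d <= n.+1%:R * d by rewrite ler_wpM2r ?(ltW d0)// ler_nat.
  by rewrite nd; lra.
have near1 x : a < x < b -> \forall k \near \oo, `|U x - V k x| < del.
  by move=> /VU /cvgrPdist_lt; apply.
have Pnear y (i : 'I_n.+2) : `|y| <= eta ->
    \forall k \near \oo, `|U (P i + y) - V k (P i + y)| < del.
  move=> ye; apply: near1; have := Pin i (ltnSE (ltn_ord i)).
  by move: ye; rewrite ler_norml /c /q; lra.
have all_near y : `|y| <= eta -> \forall k \near \oo,
    forall i : 'I_n.+2, `|U (P i + y) - V k (P i + y)| < del.
  by move=> ye; apply: filter_forall => i; exact: Pnear.
have A1 : \forall k \near \oo, forall i : 'I_n.+2, `|U (P i + eta) - V k (P i + eta)| < del.
  by apply: all_near; rewrite gtr0_norm.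
have A2 : \forall k \near \oo, forall i : 'I_n.+2, `|U (P i - eta) - V k (P i - eta)| < del.
  by apply: all_near; rewrite normrN gtr0_norm.
have A3 : \forall k \near \oo, forall i : 'I_n.+2, `|U (P i + 0) - V k (P i + 0)| < del.
  by apply: all_near; rewrite normr0 ltW.
apply: filterS3 A1 A2 A3 => k B1 B2 B3.
have gh := subgradient_homo (Vg k).
have term (i : 'I_n.+1) : energy (V k) (P i) (P i.+1) <=
    d * zeta (widened_quotient f c q 1 n i) + d * (e / 2 / (q - c)).
  have PS : P i.+1 - P i = d by rewrite /P -[i.+1%:R]natr1; ring.
  have Plt : P i < P i.+1 by lra.
  have wE : widened_quotient f c q 1 n i = (f (P i.+1 + eta) - f (P i - eta)) / d.
    by rewrite /widened_quotient !mul1r.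
  have w0 : 0 <= widened_quotient f c q 1 n i.
    by apply: widened_quotient_ge0 => //; rewrite ?lexx ?ler01.
  have gle : g k (P i) <= g k (P i.+1) by apply: gh; rewrite ltW.
  have gap : g k (P i.+1) - g k (P i) <= d * widened_quotient f c q 1 n i + d * s.
    rewrite wE [d * (_ / d)]mulrC divfK ?gt_eqF//.
    have := B1 (lift ord0 i); have := B3 (lift ord0 i).
    have := B2 (widen_ord (leqnSn _) i); have := B3 (widen_ord (leqnSn _) i).
    rewrite /= /bump /= add1n !addr0 !ltr_norml => b1 b2 b3 b4.
    have := Vg k (P i.+1) (P i.+1 + eta); have := Vg k (P i) (P i - eta).
    have := Uf (P i.+1 + eta) (P i.+1); have := Uf (P i - eta) (P i).
    move=> u1 u2 v1 v2.
    have : (g k (P i.+1) - g k (P i)) * eta <=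
        (f (P i.+1 + eta) - f (P i - eta) + d * s) * eta.
      have : 4 * del = d * s * eta by rewrite /del; field.
      by lra.
    by rewrite ler_pM2r.
  apply: le_trans (energy_jensen (Vg k) Plt) _; rewrite PS -mulrDr ler_wpM2l ?(ltW d0)//.
  apply: (@le_trans _ _ (zeta (widened_quotient f c q 1 n i + s))).
    apply: (conc_le zP); first by rewrite divr_ge0 ?(ltW d0)// subr_ge0.
    by rewrite ler_pdivrMr// mulrC mulrDr.
  apply: le_trans (conc_subadd zP w0 (ltW s0)) _; rewrite lerD2l.
  by apply: Hs; rewrite lexx ltW.
have qE : q = c + n.+1%:R * d by rewrite nd subrKC.
rewrite [X in energy (V k) c X]qE (energy_sum c n.+1 (Vg k) (ltW d0)).
apply: le_trans (ler_sum _ (fun i _ => term i)) _.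
rewrite big_split/= sumr_const card_ord -mulrnAl -[d *+ n.+1]mulr_natl nd.
rewrite [X in _ + X]mulrC divfK ?gt_eqF ?subr_gt0//.
by move: Hn; rewrite ler_norml; lra.
Qed.

End usc.

(** The domains move, so only a fixed inner segment is treated by convergence. The two end pieces
    are shorter than [r0], which makes the length term of [energy_ends] at most [e / 8]. *)
Lemma energy_usc U f a b (V g : nat -> R -> R) (a_ b_ : nat -> R) M e :
  subgradient U f -> a <= b -> (forall k, subgradient (V k) (g k)) ->
  (forall k, a_ k <= b_ k) -> 0 < M -> (forall k x, `|g k x| <= M) ->
  a_ @ \oo --> a -> b_ @ \oo --> b ->
  (forall x, a < x < b -> (fun k => V k x) @ \oo --> U x) -> 0 < e ->
  \forall k \near \oo, energy (V k) (a_ k) (b_ k) <= energy U a b + e.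
Proof.
move=> Uf ab Vg ab_ M0 gM a_a b_b VU e0.
have e4 : 0 < e / 8 by rewrite divr_gt0.
have [K HK] := energy_ends M0 e4.
have K0 : 0 < `|K| + 1 by rewrite ltr_wpDl.
pose r0 := e / 8 / (`|K| + 1); have r00 : 0 < r0 by rewrite divr_gt0.
have small x : 0 <= x -> x <= r0 -> x * K <= e / 8.
  move=> x0 xr; apply: (@le_trans _ _ (r0 * (`|K| + 1))); last first.
    by rewrite divfK ?gt_eqF.
  apply: (@le_trans _ _ (x * (`|K| + 1))); last by rewrite ler_wpM2r// ltW.
  by rewrite ler_wpM2l//; have := ler_norm K; lra.
have near_a rr : 0 < rr -> \forall k \near \oo, `|a - a_ k| < rr.
  by move=> rr0; move/cvgrPdist_lt : a_a; exact.
have near_b rr : 0 < rr -> \forall k \near \oo, `|b - b_ k| < rr.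
  by move=> rr0; move/cvgrPdist_lt : b_b; exact.
move: ab; rewrite le_eqVlt => /predU1P[ab|ab].
  have r2 : 0 < r0 / 2 by rewrite divr_gt0.
  near=> k.
  have ha : `|a - a_ k| < r0 / 2 by near: k; exact: near_a.
  have hb : `|b - b_ k| < r0 / 2 by near: k; exact: near_b.
  apply: le_trans (HK _ _ _ _ (Vg k) (gM k) (ab_ k)) _.
  have : (b_ k - a_ k) * K <= e / 8.
    by apply: small; [rewrite subr_ge0|move: ha hb; rewrite ab !ltr_norml; lra].
  by have := energy_ge0 a b Uf; lra.
pose r := Num.min (r0 / 2) ((b - a) / 4).
have r_0 : 0 < r by rewrite lt_min !divr_gt0// subr_gt0.
have rr0 : r <= r0 / 2 by rewrite ge_min lexx.
have rab : r <= (b - a) / 4 by rewrite ge_min lexx orbT.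
have mid : a + r < b - r by lra.
have inner := energy_inner Uf Vg VU r_0 e4 mid.
apply: filterS3 (near_a _ r_0) (near_b _ r_0) inner => k ha hb.
clear near_a near_b.
have [ha1 ha2] : a_ k <= a + r /\ a + r - a_ k <= r0 by move: ha; rewrite ltr_norml; lra.
have [hb1 hb2] : b - r <= b_ k /\ b_ k - (b - r) <= r0 by move: hb; rewrite ltr_norml; lra.
move=> hi; have s1 : (a + r - a_ k) * K <= e / 8 by apply: small => //; rewrite subr_ge0.
have s2 : (b_ k - (b - r)) * K <= e / 8 by apply: small => //; rewrite subr_ge0.
have k1 := HK _ _ _ _ (Vg k) (gM k) ha1; have k2 := HK _ _ _ _ (Vg k) (gM k) hb1.
rewrite (energy_split (Vg k) ha1 (le_trans (ltW mid) hb1)).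
rewrite (energy_split (Vg k) (ltW mid) hb1).
have m1 : a <= a + r by rewrite lerDl ltW.
have m2 : b - r <= b by rewrite gerBl ltW.
rewrite (energy_split Uf m1 (le_trans (ltW mid) m2)) (energy_split Uf (ltW mid) m2).
have l1 := energy_ge0 a (a + r) Uf; have l2 := energy_ge0 (b - r) b Uf.
move: k1 k2 s1 s2 hi l1 l2.
move: (energy (V k) (a_ k) (a + r)) (energy (V k) (b - r) (b_ k))
  (energy (V k) (a + r) (b - r)) (energy U (a + r) (b - r))
  (energy U a (a + r)) (energy U (b - r) b)
  ((a + r - a_ k) * K) ((b_ k - (b - r)) * K) => x1 x2 x3 x4 x5 x6 x7 x8.
by clear -e0; lra.
Unshelve. all: by end_near. Qed.

End energy.

(** * Domains and values along a tau-convergent sequence *)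

Section tau_limit.
Context {R : realType}.
Context (u_ : nat -> Conv_ld R) (u : Conv_ld R) (uu : tau_cvg u_ u).
Context (U f : R -> R) (a b : R) (ab : a <= b) (uE : val u = segment_fun U a b).
Context (V g : nat -> R -> R) (a_ b_ : nat -> R) (M : R).
Context (Vg : forall k, subgradient (V k) (g k)).
Context (uE_ : forall k, val (u_ k) = segment_fun (V k) (a_ k) (b_ k)).
Context (M0 : 0 < M) (gM : forall k x, `|g k x| <= M).

Let V_lip k x y : `|V k x - V k y| <= M * `|x - y|.
Proof.
have lip s t : V k s - V k t <= M * `|s - t|.
  have h : g k s * (s - t) <= M * `|s - t|.
    by rewrite (le_trans (ler_norm _))// normrM ler_wpM2r.
  by have := Vg k s t; lra.
by rewrite ler_norml lip andbT; have := lip y x; rewrite distrC; lra.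
Qed.

Let recovery x e : a <= x <= b -> 0 < e -> \forall k \near \oo,
  exists y, [/\ `|x - y| <= e, a_ k <= y <= b_ k & `|U x - V k y| <= e].
Proof.
move=> axb e0; have [_ /(_ x)[x_ xx]] := uu.
rewrite uE segment_funE// => /fine_cvgP[Hfin /cvgrPdist_le/(_ _ e0) Hcvg] _.
move/cvgrPdist_le : xx => /(_ _ e0) Hx.
apply: filterS3 Hfin Hcvg Hx => k fink ck xk; exists (x_ k); split => //.
  by move: fink; rewrite uE_ /segment_fun; case: ifP.
by move: fink ck; rewrite /= uE_ /segment_fun; case: ifP.
Qed.

(** The lower limit at such an [x] is infinite, whereas membership in the [k]-th domain would bound
    [V k x], by the Lipschitz constant and a recovery point near [a]. *)
Let outside x : ~~ (a <= x <= b) -> \forall k \near \oo, ~~ (a_ k <= x <= b_ k).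
Proof.
move=> xab; have [/(_ x (fun=> x) (cvg_cst _)) + _ _] := uu.
rewrite uE /segment_fun (negbTE xab) => xoo.
pose l := U a + 1 + M * (`|x - a| + 1).
have /limn_einf_gt Hl : (l%:E < limn_einf (fun k => val (u_ k) x))%E.
  by apply: lt_le_trans xoo; exact: ltry.
have aab : a <= a <= b by rewrite lexx.
apply: filterS2 Hl (recovery aab ltr01) => k lx [y [ya yk Uy]].
apply/negP => xk; move: lx; rewrite uE_ segment_funE// lte_fin ltNge => /negP; apply.
have xy : `|x - y| <= `|x - a| + 1.
  by apply: le_trans (ler_distD a x y) _; rewrite lerD2l.
have : M * `|x - y| <= M * (`|x - a| + 1) by rewrite ler_wpM2l// ltW.
have := V_lip k x y; move: Uy; rewrite !ler_norml /l; lra.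
Qed.

(** A recovery point for an end keeps the moving end from receding inwards; the point at distance
    [e] outside keeps it from running outwards. *)
Lemma tau_cvg_endpoints : a_ @ \oo --> a /\ b_ @ \oo --> b.
Proof.
split; apply/cvgrPdist_le => e e0.
  have aab : a <= a <= b by rewrite lexx.
  have out : ~~ (a <= a - e <= b) by rewrite negb_and -ltNge; apply/orP; left; lra.
  have e2 : 0 < e / 2 by rewrite divr_gt0.
  apply: filterS2 (recovery aab e2) (outside out) => k [y [ya yk _]].
  by rewrite negb_and -!ltNge => /orP[]; move: ya; rewrite !ler_norml; lra.
have bab : a <= b <= b by rewrite lexx ab.
have out : ~~ (a <= b + e <= b) by rewrite negb_and -!ltNge; apply/orP; right; lra.
have e2 : 0 < e / 2 by rewrite divr_gt0.
apply: filterS2 (recovery bab e2) (outside out) => k [y [ya yk _]].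
by rewrite negb_and -!ltNge => /orP[]; move: ya; rewrite !ler_norml; lra.
Qed.

Lemma tau_cvg_pointwise x : a <= x <= b -> (fun k => V k x) @ \oo --> U x.
Proof.
move=> axb; apply/cvgrPdist_le => e e0.
have M1 : 0 < M + 1 by rewrite addr_gt0.
have e1 : 0 < e / (M + 1) by rewrite divr_gt0.
apply: filterS (recovery axb e1) => k [y [xy _ Uy]].
apply: le_trans (ler_distD (V k y) _ _) _.
have : `|V k y - V k x| <= M * (e / (M + 1)).
  apply: le_trans (V_lip k y x) _; rewrite distrC ler_wpM2l//; exact: ltW.
have : (M + 1) * (e / (M + 1)) = e by rewrite mulrC divfK ?gt_eqF.
by move: Uy; lra.
Qed.

End tau_limit.

Section sufficiency.
Context {R : realType} (Z : Conv_ld R -> R) (c0 c1 : R) (zeta : R -> R).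
Context (zP : conc_fun zeta).
Context (ZE : forall u : Conv_ld R, ((Z u)%:E =
    c0%:E + c1%:E * lebesgue_measure (dom (val u)) +
    \int[lebesgue_measure]_(x in dom (val u))
      (zeta (second_derivative (val u) x))%:E)%E).
Implicit Types (U V f g : R -> R) (a b c x y t d e L : R).

Let Z_segment (u : Conv_ld R) U f a b : subgradient U f -> a <= b ->
  val u = segment_fun U a b -> Z u = c0 + c1 * (b - a) + energy zeta U a b.
Proof.
move=> Uf ab uE; apply: EFin_inj; rewrite ZE -/(zeta_energy zeta (val u)).
rewrite uE (energyE zP Uf ab) dom_segment_fun lebesgue_measure_itv/= lte_fin.
have [ab'|ba] := ltP a b; first by rewrite -EFinB -EFinM -!EFinD.
have -> : b = a by apply/eqP; rewrite eq_le ba.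
by rewrite subrr mulr0 mule0 adde0 -EFinD addr0.
Qed.

Let representation (u : Conv_ld R) : exists U f a b,
  [/\ a <= b, subgradient U f & val u = segment_fun U a b].
Proof.
have : Conv_ld R (val u) by have := valP u; rewrite inE.
move=> [uC uK [L L0 uL]].
have [U [f [a [b [ab Uf _ uE]]]]] := Conv_ld_segmentE uC uK L0 uL.
by exists U, f, a, b.
Qed.

Lemma sufficiency_translation : translation_invariant Z.
Proof.
move=> t u v vE; have [U [f [a [b [ab Uf uE]]]]] := representation u.
have abt : a - t <= b - t by rewrite lerD2r.
have Vg := subgradient_shift t Uf.
rewrite (Z_segment Uf ab uE) (Z_segment Vg abt); last first.
  by rewrite vE uE; apply/funext => x; rewrite /segment_fun lerBlDr lerBrDr.
have bat : b - t - (a - t) = b - a by ring.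
rewrite (energy_eq zP Uf Vg ab bat) ?bat// => x y.
by congr (f _ - f _); ring.
Qed.

Let Z_affine (u v : Conv_ld R) k1 k0 :
  val v = (fun x => val u x + (k1 * x + k0)%:E)%E -> Z v = Z u.
Proof.
move=> vE; have [U [f [a [b [ab Uf uE]]]]] := representation u.
have Vg := subgradientD Uf (subgradient_affine k1 k0).
rewrite (Z_segment Uf ab uE) (Z_segment Vg ab); last first.
  rewrite vE uE; apply/funext => x; rewrite /segment_fun; case: ifP => // _.
by rewrite (energy_eq zP Uf Vg ab)// => x y; ring.
Qed.

Lemma sufficiency_dual : dually_epi_translation_invariant Z.
Proof.
split=> [l|k] u v vE.
  apply: (@Z_affine u v (l 1) 0); rewrite vE; apply/funext => x.
  rewrite addr0; congr (_ + _%:E)%E.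
  by rewrite -[X in l X](mulr1 x) -[x * 1]/(x *: (1 : R^o)) linearZ/= mulrC.
by apply: (@Z_affine u v 0 k); rewrite vE; apply/funext => x; rewrite mul0r add0r.
Qed.

Lemma sufficiency_valuation : valuation Z.
Proof.
move=> u v w j wE jE.
have [Uu [fu [au [bu [abu Ufu uE]]]]] := representation u.
have [Uv [fv [av [bv [abv Ufv vE]]]]] := representation v.
have [Uw [fw [aw [bw [abw Ufw wE']]]]] := representation w.
have [Uj [fj [aj [bj [abj Ufj jE']]]]] := representation j.
have HE : energy zeta Uw aw bw + energy zeta Uj aj bj =
    energy zeta Uu au bu + energy zeta Uv av bv.
  by rewrite /energy -uE -vE -wE' -jE'; exact: fine_zeta_energy_valuation.
have domE U x a b : (segment_fun U a b x < +oo)%E = (a <= x <= b).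
  by rewrite /segment_fun; case: ifP => _; rewrite ?ltry ?ltxx.
have Hw x : (aw <= x <= bw) = (au <= x <= bu) || (av <= x <= bv).
  by rewrite -(domE Uw) -(domE Uu) -(domE Uv) -uE -vE -wE' wE gt_min.
have Hj x : (aj <= x <= bj) = (au <= x <= bu) && (av <= x <= bv).
  by rewrite -(domE Uj) -(domE Uu) -(domE Uv) -uE -vE -jE' jE gt_max.
rewrite (Z_segment Ufu abu uE) (Z_segment Ufv abv vE) (Z_segment Ufw abw wE').
rewrite (Z_segment Ufj abj jE').
(* Additivity of length: the union and the intersection of the two domains are again segments, with
   ends given by minima and maxima. *)
suff : bw - aw + (bj - aj) = bu - au + (bv - av).
  have regroup (p q x y : R) :
      c0 + c1 * p + x + (c0 + c1 * q + y) = c0 + c0 + c1 * (p + q) + (x + y).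
    by ring.
  move=> HL; apply: etrans (regroup _ _ _ _) _; rewrite HL HE.
  exact: esym (regroup _ _ _ _).
have := Hj aj; rewrite lexx abj => /esym/andP[/andP[j1 j2] /andP[j3 j4]].
have := Hj bj; rewrite lexx abj => /esym/andP[/andP[j5 j6] /andP[j7 j8]].
have := Hw au; rewrite lexx abu => /andP[w1 _].
have := Hw bu; rewrite lexx abu => /andP[_ w2].
have := Hw av; rewrite lexx abv orbT => /andP[w3 _].
have := Hw bv; rewrite lexx abv orbT => /andP[_ w4].
have : aw = Num.min au av.
  apply/eqP; rewrite eq_le le_min w1 w3/= ge_min.
  by have := Hw aw; rewrite lexx abw => /esym/orP[] /andP[-> _]; rewrite ?orbT.
have : bw = Num.max bu bv.
  apply/eqP; rewrite eq_le ge_max w2 w4/= andbT le_max.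
  by have := Hw bw; rewrite lexx abw => /esym/orP[] /andP[_ ->]; rewrite ?orbT.
have : aj = Num.max au av.
  apply/eqP; rewrite eq_le ge_max j1 j3/= andbT.
  have := Hj (Num.max au av); rewrite !le_max !ge_max !lexx abu abv orbT/=.
  by rewrite (le_trans j1 j4) (le_trans j3 j2) => /andP[].
have : bj = Num.min bu bv.
  apply/eqP; rewrite eq_le le_min j6 j8/=.
  have := Hj (Num.min bu bv); rewrite !le_min !ge_min !lexx abu abv orbT/=.
  by rewrite (le_trans j1 j4) (le_trans j3 j2) => /andP[].
by move=> -> -> -> ->; case: (leP au av) => _; case: (leP bu bv) => _; ring.
Qed.

Lemma sufficiency_usc : tau_usc Z.
Proof.
move=> u_ u uu; have [U [f [a [b [ab Uf uE]]]]] := representation u.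
have [_ _ [M M0 uM]] := uu.
(* All terms are represented with the common constant [M] in place of their own Lipschitz constants,
   so the slopes are bounded uniformly in [k]. *)
have /choice[r Hr] k : exists r : (R -> R) * (R -> R) * (R * R),
    [/\ r.2.1 <= r.2.2, subgradient r.1.1 r.1.2, forall x, `|r.1.2 x| <= M &
     val (u_ k) = segment_fun r.1.1 r.2.1 r.2.2].
  have : Conv_ld R (val (u_ k)) by have := valP (u_ k); rewrite inE.
  move=> [uC uK _].
  have [V [g [p [q [pq Vg gM vE]]]]] := Conv_ld_segmentE uC uK M0 (uM k).
  by exists ((V, g), (p, q)).
pose V k := (r k).1.1; pose g k := (r k).1.2; pose a_ k := (r k).2.1; pose b_ k := (r k).2.2.
have Vg k : subgradient (V k) (g k) by have [] := Hr k.
have gM k x : `|g k x| <= M by have [_ _ + _] := Hr k; exact.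
have ab_ k : a_ k <= b_ k by have [] := Hr k.
have uE_ k : val (u_ k) = segment_fun (V k) (a_ k) (b_ k) by have [] := Hr k.
have [a_a b_b] := tau_cvg_endpoints uu ab uE Vg uE_ M0 gM.
have VU x : a < x < b -> (fun k => V k x) @ \oo --> U x.
  move=> /andP[ax xb]; apply: (tau_cvg_pointwise uu uE Vg uE_ M0 gM).
  by rewrite !ltW.
apply/lee_addgt0Pr => e e0; apply: limn_esup_le.
have e2 : 0 < e / 2 by rewrite divr_gt0.
have len : (fun k => c1 * (b_ k - a_ k)) @ \oo --> c1 * (b - a).
  by apply: cvgM; [exact: cvg_cst|exact: cvgB].
move/cvgrPdist_le : len => /(_ _ e2) len.
have := energy_usc zP Uf ab Vg ab_ M0 gM a_a b_b VU e2.
move: len; apply: filterS2 => k len Hk.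
rewrite -EFinD lee_fin (Z_segment Uf ab uE) (Z_segment (Vg k) (ab_ k) (uE_ k)).
move: len Hk; move: (energy _ _ _ _) (energy _ _ _ _) => x y.
by rewrite ler_norml; lra.
Qed.

End sufficiency.

(** * Limits and quantified bounds for zeta *)

Section Conc.
Context {R : realType} (zeta : R -> R).

Lemma conc_fun_Conc : conc_fun zeta -> Conc R zeta.
Proof.
move=> zP; split; first exact: conc_ge0.
- move=> l x y; rewrite !inE/= !in_itv/= !andbT => x0 y0.
  rewrite !convRE mulrN mulrN -opprD lerN2.
  apply: (conc_concave zP) => //; apply/andP; split => //.
- apply/cvgrPdist_le => e e0; have [del del0 H] := conc_small zP e0.
  near=> t; have t0 : 0 < t by [].
  rewrite sub0r normrN ger0_norm ?(conc_ge0 zP (ltW t0))// H// (ltW t0)/=.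
  by near: t; exact: nbhs_right_le.
- apply/cvgrPdist_le => e e0; have [K K0 H] := conc_sublinear zP e0.
  near=> t; have tK : K <= t by near: t; apply: nbhs_pinfty_ge; exact: num_real.
  have t0 : 0 < t by exact: lt_le_trans tK.
  rewrite sub0r normrN ger0_norm ?divr_ge0 ?(conc_ge0 zP)//; try exact: ltW.
  by rewrite ler_pdivrMr// H.
Unshelve. all: by end_near. Qed.

Lemma Conc_conc_fun : Conc R zeta -> conc_fun zeta.
Proof.
move=> [z0 zconv zlim zsub].
have zconc t s l : 0 <= t -> 0 <= s -> 0 <= l <= 1 ->
    l * zeta t + (1 - l) * zeta s <= zeta (l * t + (1 - l) * s).
  move=> t0 s0 /andP[l0 l1].
  have := zconv (Itv01 l0 l1) t s; rewrite !inE/= !in_itv/= !andbT => /(_ t0 s0).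
  by rewrite !convRE/= !mulrN -opprD lerN2.
split => // e e0.
  have e2 : 0 < e / 2 by rewrite divr_gt0.
  move/cvgrPdist_le : zlim => /(_ _ e2)[del /= del0 H].
  have zt t : 0 < t -> t < del -> zeta t <= e / 2.
    move=> t0 td; have := H t; rewrite /= sub0r normrN gtr0_norm// => /(_ td t0).
    by rewrite sub0r normrN; apply: le_trans (ler_norm _).
  exists (del / 2) => [|t /andP[]]; first by rewrite divr_gt0.
  rewrite le_eqVlt => /predU1P[<- _|t0 td]; last by have := zt t t0; lra.
  (* The right limit says nothing at t = 0; concavity between 0 and [del / 2] bounds half of
     [zeta 0] by the value at their midpoint. *)
  have d2 : 0 <= del / 2 by rewrite divr_ge0// ltW.
  have h : 0 <= (2^-1 : R) <= 1 by lra.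
  have := zconc _ _ _ (lexx 0) d2 h; rewrite mulr0 add0r.
  have := zt ((1 - 2^-1) * (del / 2)); have := z0 _ d2; lra.
move/cvgrPdist_le : zsub => /(_ _ e0)[K [Kr H]].
exists (Num.max K 0 + 1) => [|t]; first by rewrite ltr_wpDl// le_max lexx orbT.
move=> Kt; have K1 : Num.max K 0 < t by lra.
move: K1; rewrite gt_max => /andP[K1 t0].
have := H t K1; rewrite /= sub0r normrN => /(le_trans (ler_norm _)).
by rewrite ler_pdivrMr.
Qed.

End Conc.

(* The formula holds in \bar R: it includes the finiteness of the integral. *)
Theorem theorem2 (R : realType) (Z : Conv_ld R -> R) :
  [/\ tau_usc Z, translation_invariant Z,
      dually_epi_translation_invariant Z & valuation Z]
  <->
  exists (c0 c1 : R) (zeta : R -> R), Conc R zeta /\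
    forall u : Conv_ld R,
      ((Z u)%:E =
        c0%:E + c1%:E * lebesgue_measure (dom (val u)) +
        \int[lebesgue_measure]_(x in dom (val u))
          (zeta (second_derivative (val u) x))%:E)%E.
Proof.
split=> [[Zusc Ztr Zdual Zval]|[c0 [c1 [zeta [/Conc_conc_fun zP ZE]]]]].
  have [c0 [c1 [zeta [zP ZE]]]] := necessity Zusc Ztr Zdual Zval.
  by exists c0, c1, zeta; split => //; exact: conc_fun_Conc.
split.
- exact: sufficiency_usc ZE.
- exact: sufficiency_translation ZE.
- exact: sufficiency_dual ZE.
- exact: sufficiency_valuation ZE.
Qed.
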